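(* The global context-bounded backwards reachability problem for ground annotated stack tree rewrite systems with global state is decidable. That is, there is an algorithm which, given an order-$n$ GASTRS with global state $\mathcal{G}=(\Sigma,\mathbb{P},\mathbb{G},\mathcal{R})$, an order-$n$ annotated stack tree automaton $\mathcal{T}^0_g$ for each $g\in\mathbb{G}$, and a bound $\iota\in\mathbb{N}$, computes an annotated stack tree automaton $\mathcal{T}_g$ for each $g\in\mathbb{G}$ such that $t\in\mathcal{L}(\mathcal{T}_g)$ if and only if there is a run $$(g,t)=(g_0,t_0)\to\cdots\to(g_m,t_m)=(g',t')$$ with $t'\in\mathcal{L}(\mathcal{T}^0_{g'})$ in which at most $\iota$ transitions satisfy $g_i\ne g_{i+1}$.
   Context: **Annotated stacks.** Fix an order $n\ge 1$ and a finite stack alphabet $\Sigma$. The sets $\mathcal{S}_1,\dots,\mathcal{S}_n$ of annotated stacks of order $1,\dots,n$ form the smallest family such that: for $2\le k\le n$, $\mathcal{S}_k$ is the set of all (possibly empty) finite sequences $[s_1\ldots s_m]_k$ with all $s_i\in\mathcal{S}_{k-1}$; and $\mathcal{S}_1$ is the set of all finite sequences $[a_1^{s_1}\ldots a_m^{s_m}]_1$, $m\ge 0$, with $a_i\in\Sigma$ and each annotation $s_i\in\bigcup_{1\le k\le n}\mathcal{S}_k$. The top is the leftmost element. For $s$ of order $k-1$ (an annotated character if $k=1$), $s:_k s'$ places $s$ on top of $s'$: $s:_k[s_1\ldots s_m]_k=[s\,s_1\ldots s_m]_k$, and for $k'>k$, $s:_k[s_1\ldots s_m]_{k'}=[(s:_k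 s_1)\,s_2\ldots s_m]_{k'}$; it associates to the right. **Stack operations.** $\mathrm{Ops}_0=\{\mathrm{rew}_{a\to b}\mid a,b\in\Sigma\}$, $\mathrm{Ops}_1=\{\mathrm{push}^1_1,\mathrm{pop}_1\}\cup\mathrm{Ops}_0$, and for $k\ge2$, $\mathrm{Ops}_k=\{\mathrm{push}^k_1,\mathrm{push}_k,\mathrm{pop}_k,\mathrm{collapse}_k\}\cup\mathrm{Ops}_{k-1}$. They are partial functions on order-$n$ stacks: $\mathrm{rew}_{a\to b}(a^{s'}:_1 s)=b^{s'}:_1 s$; $\mathrm{push}^k_1(s)=a^{s_k}:_1 s$ when $s=a^{s'}:_1 s_1:_2 s_2:_3\cdots:_n s_n$ (each $s_i$ of order $i$); $\mathrm{push}_k(s:_k s')=s:_k s:_k s'$; $\mathrm{pop}_k(s:_k s')=s'$; $\mathrm{collapse}_k(a^{s}:_1 s_1:_{k+1}s_2)=s:_{k+1}s_2$ when $s$ has order $k<n$; $\mathrm{collapse}_n(a^s:_1 s')=s$ when $s$ has order $n$. **Annotated stack trees.** Trees are finite nonempty ordered trees $t=(D,\lambda)$ of arity at most a fixed $d$, where $D\subset\{1,\dots,d\}^*$ is closed under prefixes and smaller siblings. An order-$n$ annotated stack tree over $\Sigma$ and a finite set $\mathbb{P}$ of control states has each leaf labelled by an element of $\mathbb{P}\times\mathcal{S}_n$ and each internal node by an element of $\mathcal{S}_n$. **Stack tree operations** are of the following forms ($p,p',p_i\in\mathbb{P}$, $m\geq 1$): - $p\xrightarrow{\sigma}p'$ with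 $\sigma\in\mathrm{Ops}_n$: a leaf labelled $(p,s)$ is relabelled $(p',\sigma(s))$; - $p\xrightarrow{+}(p_1,\ldots,p_m)$: a leaf $v$ labelled $(p,s)$ is relabelled $s$ and receives $m$ children $v1,\dots,vm$ labelled $(p_1,s),\ldots,(p_m,s)$; - $(p_1,\ldots,p_m)\xrightarrow{-}p$: if $v$ is labelled $s$, its children are exactly $v1,\dots,vm$, all of them are leaves, and they are labelled $(p_1,s_1),\ldots,(p_m,s_m)$, these children are removed and $v$ is relabelled $(p,s)$. For an operation $\theta$, $\theta(t)$ is the set of trees obtained from $t$ by applying $\theta$ once, at some position. **GASTRS with global state.** An order-$n$ GASTRS with global state is $\mathcal{G}=(\Sigma,\mathbb{P},\mathbb{G},\mathcal{R})$ with $\Sigma$ a finite stack alphabet, $\mathbb{P}$ a finite set of control states, $\mathbb{G}$ a finite set of global states and $\mathcal{R}$ a finite set of triples $(g,\theta,g')$ with $g,g'\in\mathbb{G}$ and $\theta$ a stack tree operation. Configurations are pairs $(g,t)$ with $g\in\mathbb{G}$ and $t$ an order-$n$ annotated stack tree; $(g,t)\to(g',t')$ iff there is $(g,\theta,g')\in\mathcal{R}$ with $t'\in\theta(t)$. **Annotated stack tree automata.** An order-$n$ automaton over $\Sigma,\mathbb{P}$ is $\mathcal{T}=(\mathbb{Q},\mathbb{R}_n,\ldots,\mathbb{R}_1,\Sigma,\Delta,\Delta_n,\ldots,\Delta_1,\mathbb{P},\mathbb{F},\mathbb{F}_n,\ldots,\mathbb{F}_1)$ with finite state sets $\mathbb{Q}$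 and pairwise disjoint $\mathbb{R}_n,\dots,\mathbb{R}_1$; $\mathbb{P}\subseteq\mathbb{Q}$ (initial) and $\mathbb{F}\subseteq\mathbb{Q}$ (final); $\mathbb{F}_k\subseteq\mathbb{R}_k$; a finite set $\Delta\subset\mathbb{Q}\times\{(i,m)\mid1\le i\le m\}\times(\mathbb{Q}\setminus\mathbb{F})\times\mathbb{R}_n$, whose elements are written $q\leftarrow_{i/m}(q',r)$; $\Delta_k\subseteq\mathbb{R}_k\times\mathbb{R}_{k-1}\times2^{\mathbb{R}_k}$ for $2\le k\le n$; and $\Delta_1\subseteq\bigcup_{1\le k\le n}(\mathbb{R}_1\times\Sigma\times2^{\mathbb{R}_k}\times2^{\mathbb{R}_1})$. *Stacks:* an order-$k$ stack is accepted from $r\in\mathbb{R}_k$ as follows. $[\,]_k$ is accepted iff $r\in\mathbb{F}_k$. For $k\ge2$, $s:_k s'$ (with $s'$ of order $k$) is accepted iff for some $(r,r',R)\in\Delta_k$, $s$ is accepted from $r'$ and $s'$ is accepted from every state in $R$. For $k=1$, $a^{u}:_1 s'$ is accepted iff for some $(r,a,R_{\mathrm{br}},R)\in\Delta_1$, $u$ is accepted from every state in $R_{\mathrm{br}}$ (so $u$ must have order $j$ if $\emptyset\ne R_{\mathrm{br}}\subseteq\mathbb{R}_j$) and $s'$ is accepted from every state in $R$. *Trees:* a run over $t=(D,\lambda)$ is a labelling $\lambda':D\to\mathbb{Q}$ such that a leaf labelled $(p,s)$ gets state $p$, and an internal node $v$ with children $v1,\ldots,vm$ gets a state $q$ for which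 there are transitions $q\leftarrow_{i/m}(q_i,r_i)$, $1\le i\le m$, with $\lambda'(vi)=q_i$ and the stack at $vi$ accepted from $r_i$. The run is accepting if there is a transition $q_f\leftarrow_{1/1}(\lambda'(\varepsilon),r)$ with $q_f\in\mathbb{F}$ and the stack at the root $\varepsilon$ accepted from $r$. $\mathcal{L}(\mathcal{T})$ is the set of trees having an accepting run. *)

(* Defs.v *)
From mathcomp Require Import all_boot.
From Stdlib Require List.

Set Implicit Arguments.
Unset Strict Implicit.
Unset Printing Implicit Defensive.

(* Letters, control states, global states and automaton states are natural
   numbers, and finite sets of them are given as sequences (order and
   repetitions are irrelevant), so that systems and automata are concrete
   finite objects on which an algorithm can operate. *)

(* An annotated character a^u is treated as a stack of order 0: this makes
   s :_k s' uniform in k.  [s_1 ... s_m]_k is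
   SCons s_1 (... (SCons s_m (SEmpty k))), topmost element first. *)
Inductive stack : Type :=
| SChar of nat & stack
| SEmpty of nat
| SCons of stack & stack.

Fixpoint order (s : stack) : nat :=
  match s with
  | SChar _ _ => 0
  | SEmpty k => k
  | SCons _ s' => order s'
  end.

Fixpoint stack_wf (n : nat) (Sigma : seq nat) (s : stack) : bool :=
  match s with
  | SChar a u => [&& a \in Sigma, 0 < order u & stack_wf n Sigma u]
  | SEmpty k => 0 < k <= n
  | SCons s1 s2 => [&& order s2 == (order s1).+1,
                      stack_wf n Sigma s1 & stack_wf n Sigma s2]
  end.

(* s is in S_k, for 1 <= k <= n *)
Definition is_stack (n : nat) (Sigma : seq nat) (k : nat) (s : stack) : bool :=
  [&& 0 < k <= n, order s == k & stack_wf n Sigma s].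

(* s :_k s' where k = (order s).+1; undefined if s' has order < k, or if it has
   no topmost stack of order k. *)
Fixpoint scons (s s' : stack) : option stack :=
  if order s' == (order s).+1 then Some (SCons s s') else
  if s' is SCons s1 s2 then omap (fun s1' => SCons s1' s2) (scons s s1)
  else None.

(* s_0 :_1 s_1 :_2 ... :_n s_n, associating to the right *)
Fixpoint scons_seq (s0 : stack) (l : seq stack) : option stack :=
  if l is s1 :: l' then obind (scons s0) (scons_seq s1 l') else Some s0.

Inductive stack_op : Type :=
| Rew of nat & nat       (* rew_{a -> b} *)
| PushChar of nat        (* push^k_1 *)
| Push of nat            (* push_k *)
| Pop of nat             (* pop_k *)
| Collapse of nat.       (* collapse_k *)

Definition in_Ops (n : nat) (Sigma : seq nat) (o : stack_op) : bool :=
  match o with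
  | Rew a b => (a \in Sigma) && (b \in Sigma)
  | PushChar k => 1 <= k <= n
  | Push k => 2 <= k <= n
  | Pop k => 1 <= k <= n
  | Collapse k => 2 <= k <= n
  end.

(* stack_op_sem n o s s' : the partial function o maps the order-n stack s
   to s' *)
Definition stack_op_sem (n : nat) (o : stack_op) (s s' : stack) : Prop :=
  match o with
  | Rew a b => exists u r,
      scons (SChar a u) r = Some s /\ scons (SChar b u) r = Some s'
  | PushChar k => exists a u l,
      [/\ map order l = iota 1 n,
          scons_seq (SChar a u) l = Some s &
          scons (SChar a (nth u l k.-1)) s = Some s']
  | Push k => exists x r,
      [/\ order x = k.-1, scons x r = Some s & scons x s = Some s']
  | Pop k => exists x, order x = k.-1 /\ scons x s' = Some s
  | Collapse k =>
      if k < n then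
        exists a u s1 s2 w,
          [/\ order u = k, order s1 = k, scons s1 s2 = Some w,
              scons (SChar a u) w = Some s & scons u s2 = Some s']
      else
        exists a r, order s' = n /\ scons (SChar a s') r = Some s
  end.

Inductive tree : Type :=
| Leaf of nat & stack
| Node of stack & seq tree.

Definition tree_stack (t : tree) : stack :=
  match t with Leaf _ s => s | Node s _ => s end.

Fixpoint tree_wf (d n : nat) (Sigma P : seq nat) (t : tree) : bool :=
  match t with
  | Leaf p s => (p \in P) && is_stack n Sigma n s
  | Node s ts => [&& is_stack n Sigma n s, 0 < size ts <= d &
                     all (tree_wf d n Sigma P) ts]
  end.

(* The subtree at position v; children are numbered from 1. *)
Fixpoint subtree (t : tree) (v : seq nat) : option tree :=
  match v with
  | [::] => Some t
  | i :: v' =>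
      match t with
      | Node _ ts => if 0 < i <= size ts then subtree (nth t ts i.-1) v'
                     else None
      | Leaf _ _ => None
      end
  end.

Inductive tree_op : Type :=
| OpStack of nat & stack_op & nat    (* p --sigma--> p' *)
| OpPlus of nat & seq nat            (* p --+--> (p_1, ..., p_m) *)
| OpMinus of seq nat & nat.          (* (p_1, ..., p_m) -- - --> p *)

Definition tree_op_wf (n : nat) (Sigma P : seq nat) (theta : tree_op) : bool :=
  match theta with
  | OpStack p o p' => [&& p \in P, in_Ops n Sigma o & p' \in P]
  | OpPlus p ps => [&& p \in P, 0 < size ps & all (mem P) ps]
  | OpMinus ps p => [&& all (mem P) ps, 0 < size ps & p \in P]
  end.

(* tree_op_sem n theta t t' : t' is in theta(t) *)
Inductive tree_op_sem (n : nat) : tree_op -> tree -> tree -> Prop :=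
| SemStack p o p' s s' :
    stack_op_sem n o s s' ->
    tree_op_sem n (OpStack p o p') (Leaf p s) (Leaf p' s')
| SemPlus p ps s :
    tree_op_sem n (OpPlus p ps) (Leaf p s) (Node s [seq Leaf q s | q <- ps])
| SemMinus ps p s ss :
    size ss = size ps ->
    tree_op_sem n (OpMinus ps p)
      (Node s [seq Leaf x.1 x.2 | x <- zip ps ss]) (Leaf p s)
| SemChild theta s l t t' r :
    tree_op_sem n theta t t' ->
    tree_op_sem n theta (Node s (l ++ t :: r)) (Node s (l ++ t' :: r)).

Record gastrs : Type := Gastrs {
  alphabet : seq nat;
  controls : seq nat;
  globals : seq nat;
  rules : seq (nat * tree_op * nat)
}.

Definition gastrs_wf (n : nat) (G : gastrs) : bool :=
  all (fun x : nat * tree_op * nat =>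
         [&& x.1.1 \in globals G, x.2 \in globals G &
             tree_op_wf n (alphabet G) (controls G) x.1.2]) (rules G).

Definition step (d n : nat) (G : gastrs) (c c' : nat * tree) : Prop :=
  [/\ tree_wf d n (alphabet G) (controls G) c.2,
      tree_wf d n (alphabet G) (controls G) c'.2 &
      exists theta, List.In (c.1, theta, c'.1) (rules G) /\
                    tree_op_sem n theta c.2 c'.2].

(* QT, FT, DeltaT are the components Q, F, Delta reading the tree structure;
   RK k, FK k, DeltaK k stand for R_k, F_k, Delta_k.  Only 1 <= k <= n
   (2 <= k <= n for DeltaK) matters. *)
Record automaton : Type := Automaton {
  QT : seq nat;
  FT : seq nat;
  RK : nat -> seq nat;
  FK : nat -> seq nat;
  (* (q, (i, m), (q', r)) stands for q <-_{i/m} (q', r) *)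
  DeltaT : seq (nat * (nat * nat) * (nat * nat));
  (* Delta_k: triples (r, r', R) *)
  DeltaK : nat -> seq (nat * nat * seq nat);
  (* tuples (r, a, R_br, R) *)
  Delta1 : seq (nat * nat * seq nat * seq nat)
}.

Record automaton_wf (n : nat) (Sigma P : seq nat) (T : automaton) : Prop :=
  AutomatonWf {
  wf_P : {subset P <= QT T};
  wf_F : {subset FT T <= QT T};
  wf_R : forall j k x, 1 <= j <= n -> 1 <= k <= n ->
    x \in RK T j -> x \in RK T k -> j = k;
  wf_FR : forall k, 1 <= k <= n -> {subset FK T k <= RK T k};
  wf_Delta : forall q i m q' r, (q, (i, m), (q', r)) \in DeltaT T ->
    [/\ q \in QT T, 1 <= i <= m, q' \in QT T, q' \notin FT T & r \in RK T n];
  wf_DeltaK : forall k r r' X, 2 <= k <= n -> (r, r', X) \in DeltaK T k ->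
    [/\ r \in RK T k, r' \in RK T k.-1 & {subset X <= RK T k}];
  wf_Delta1 : forall r a Xbr X, (r, a, Xbr, X) \in Delta1 T ->
    [/\ r \in RK T 1, a \in Sigma, {subset X <= RK T 1} &
        exists k, 1 <= k <= n /\ {subset Xbr <= RK T k}]
}.

Fixpoint stack_accepted (T : automaton) (s : stack) (r : nat) : Prop :=
  match s with
  | SChar _ _ => False
  | SEmpty k => r \in FK T k
  | SCons (SChar a u) s' => exists Xbr X,
      [/\ (r, a, Xbr, X) \in Delta1 T,
          forall x, x \in Xbr -> stack_accepted T u x &
          forall x, x \in X -> stack_accepted T s' x]
  | SCons s1 s' => exists r1 X,
      [/\ (r, r1, X) \in DeltaK T (order s'),
          stack_accepted T s1 r1 &
          forall x, x \in X -> stack_accepted T s' x]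
  end.

(* The labelling is given on all words; only the positions of t matter. *)
Definition is_run (T : automaton) (t : tree) (lam : seq nat -> nat) : Prop :=
  forall v u, subtree t v = Some u ->
    lam v \in QT T /\
    match u with
    | Leaf p _ => lam v = p
    | Node _ ts => forall i, 1 <= i <= size ts ->
        exists r, (lam v, (i, size ts), (lam (rcons v i), r)) \in DeltaT T /\
                  stack_accepted T (tree_stack (nth u ts i.-1)) r
    end.

(* t is in L(T); meant for t satisfying tree_wf *)
Definition in_lang (T : automaton) (t : tree) : Prop :=
  exists lam, is_run T t lam /\
    exists qf r, [/\ qf \in FT T, (qf, (1, 1), (lam [::], r)) \in DeltaT T &
                     stack_accepted T (tree_stack t) r].

Definition bounded_reach (d n : nat) (G : gastrs) (T0 : nat -> automaton)
    (iota : nat) (g : nat) (t : tree) : Prop :=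
  exists (m : nat) (gs : nat -> nat) (ts : nat -> tree),
    [/\ gs 0 = g, ts 0 = t,
        forall i, i < m -> step d n G (gs i, ts i) (gs i.+1, ts i.+1),
        in_lang (T0 (gs m)) (ts m) &
        \sum_(i < m) (gs i != gs i.+1) <= iota].

(* Binary trees as a universal data type, and the partial recursive functions
   on them: primitive recursion on trees plus a while loop, [dnil] being read
   as "false".  This is Turing-complete (it contains N. D. Jones's WHILE
   language). *)
Inductive data : Type :=
| dnil
| dcons of data & data.

Definition dfst (x : data) : data := if x is dcons a _ then a else dnil.
Definition dsnd (x : data) : data := if x is dcons _ b then b else dnil.

Inductive code : Type :=
| CId
| CConst of data
| CFst
| CSnd
| CPair of code & code
| CComp of code & code
| CRec of code & code
| CWhile of code & code.

(* eval c x y : the program c terminates on input x with output y *)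
Inductive eval : code -> data -> data -> Prop :=
| EvId x : eval CId x x
| EvConst y x : eval (CConst y) x y
| EvFst x : eval CFst x (dfst x)
| EvSnd x : eval CSnd x (dsnd x)
| EvPair c1 c2 x y1 y2 :
    eval c1 x y1 -> eval c2 x y2 -> eval (CPair c1 c2) x (dcons y1 y2)
| EvComp c1 c2 x y z :
    eval c2 x y -> eval c1 y z -> eval (CComp c1 c2) x z
| EvRecNil c0 c1 e y :
    eval c0 e y -> eval (CRec c0 c1) (dcons e dnil) y
| EvRecCons c0 c1 e a b ya yb y :
    eval (CRec c0 c1) (dcons e a) ya ->
    eval (CRec c0 c1) (dcons e b) yb ->
    eval c1 (dcons e (dcons (dcons a b) (dcons ya yb))) y ->
    eval (CRec c0 c1) (dcons e (dcons a b)) y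
| EvWhileStop c1 c2 x :
    eval c1 x dnil -> eval (CWhile c1 c2) x x
| EvWhileLoop c1 c2 x a b y z :
    eval c1 x (dcons a b) -> eval c2 x y -> eval (CWhile c1 c2) y z ->
    eval (CWhile c1 c2) x z.

Lemma eval_det c x y z : eval c x y -> eval c x z -> y = z.
Proof.
move=> Hy; elim: Hy z => {c x y}; intros;
  match goal with H : eval _ _ ?z |- _ = ?z => inversion H; subst end;
  repeat match goal with
  | IH : forall z, eval ?c ?x z -> _ = z, H : eval ?c ?x _ |- _ =>
      move: (IH _ H) => {H} ?; subst
  end; congruence.
Qed.

Fixpoint enc_nat (m : nat) : data :=
  if m is m'.+1 then dcons dnil (enc_nat m') else dnil.

Definition enc_seq (X : Type) (enc : X -> data) (l : seq X) : data :=
  foldr (fun x => dcons (enc x)) dnil l.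

Definition enc_tuple : seq data -> data := enc_seq id.

Definition enc_set : seq nat -> data := enc_seq enc_nat.

Definition enc_stack_op (o : stack_op) : data :=
  match o with
  | Rew a b => enc_tuple [:: enc_nat 0; enc_nat a; enc_nat b]
  | PushChar k => enc_tuple [:: enc_nat 1; enc_nat k]
  | Push k => enc_tuple [:: enc_nat 2; enc_nat k]
  | Pop k => enc_tuple [:: enc_nat 3; enc_nat k]
  | Collapse k => enc_tuple [:: enc_nat 4; enc_nat k]
  end.

Definition enc_tree_op (theta : tree_op) : data :=
  match theta with
  | OpStack p o p' =>
      enc_tuple [:: enc_nat 0; enc_nat p; enc_stack_op o; enc_nat p']
  | OpPlus p ps => enc_tuple [:: enc_nat 1; enc_nat p; enc_set ps]
  | OpMinus ps p => enc_tuple [:: enc_nat 2; enc_set ps; enc_nat p]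
  end.

Definition enc_gastrs (G : gastrs) : data :=
  enc_tuple
    [:: enc_set (alphabet G); enc_set (controls G); enc_set (globals G);
        enc_seq (fun x : nat * tree_op * nat =>
                   enc_tuple [:: enc_nat x.1.1; enc_tree_op x.1.2; enc_nat x.2])
          (rules G)].

Definition enc_automaton (n : nat) (T : automaton) : data :=
  enc_tuple
    [:: enc_set (QT T); enc_set (FT T);
        enc_seq (fun k => enc_set (RK T k)) (iota 1 n);
        enc_seq (fun k => enc_set (FK T k)) (iota 1 n);
        enc_seq (fun x : nat * (nat * nat) * (nat * nat) =>
                   enc_tuple [:: enc_nat x.1.1; enc_nat x.1.2.1;
                                 enc_nat x.1.2.2; enc_nat x.2.1;
                                 enc_nat x.2.2]) (DeltaT T);
        enc_seq (fun k => enc_seq (fun x : nat * nat * seq nat =>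
                   enc_tuple [:: enc_nat x.1.1; enc_nat x.1.2; enc_set x.2])
                   (DeltaK T k)) (iota 2 n.-1);
        enc_seq (fun x : nat * nat * seq nat * seq nat =>
                   enc_tuple [:: enc_nat x.1.1.1; enc_nat x.1.1.2;
                                 enc_set x.1.2; enc_set x.2]) (Delta1 T)].

Definition enc_family (n : nat) (Gs : seq nat) (T : nat -> automaton) : data :=
  enc_seq (fun g => enc_tuple [:: enc_nat g; enc_automaton n (T g)]) Gs.

Definition enc_instance (d n : nat) (G : gastrs) (T0 : nat -> automaton)
    (iota : nat) : data :=
  enc_tuple [:: enc_nat d; enc_nat n; enc_gastrs G;
                enc_family n (globals G) T0; enc_nat iota].

(* Main.v *)
(* Reading a rewriting step backwards at a leaf only changes the stack language
   attached to that leaf.  For the predecessors under the operations of one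
   global state, every hole (a position below a state of the tree automaton)
   and every control state p get a name for the set of stacks s such that the
   leaf (p, s) can be rewritten into a tree fitting the hole.  These sets are
   the least solution of finitely many rules "s is in x if the operation o maps
   s into every member of Y".

   The rules are turned into an alternating stack automaton.  Its states of
   order k are chains x, d_n, ..., d_{k+1} of a name and sets of states, read
   as quotients of the set x; there are finitely many, and only what they
   accept at the head of a stack has to be saturated.  As an operation inspects
   only the head, it also acts on the sets of states accepting the parts of a
   stack, and soundness and completeness of the saturation are two logical
   relations between stacks and sets of states.

   A change of the global state is one operation, read backwards by tree
   automata that guess the branch in which it takes place.  Alternating both
   constructions iota times bounds the number of changes.  Every step is
   primitive recursive, hence given by a code without loops. *)
From HB Require Import structures.
From mathcomp Require Import all_boot zify.
Require Import Defs.

Set Implicit Arguments.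
Unset Strict Implicit.
Unset Printing Implicit Defensive.

(** * Computable functions *)

(** Operations copy parts of a stack, and after a [+] operation the new node and all its children
    carry the same stack s. The demand on a leaf (p, s) is therefore a conjunction on one s: this
    forces alternation, and quotients by sets of states rather than by single states. A chain of
    length f + 1 extends a chain of length f by a set of states whose own chains have length f, so
    every order costs one exponential. All these states exist before saturation starts; saturation
    only selects facts from a fixed finite universe.

    What a leaf may turn into depends on its place, because a transition reads the position i/m
    together with the stack. Names are therefore indexed by holes, which are finitely many since the
    arity is bounded by d. A [-] operation turns a node into a leaf again; backwards it is an
    additional transition into a state that remembers the control states expected at the children,
    while the stack of the node must satisfy the name of the leaf that it becomes. *)

Fixpoint num (x : data) : nat :=
  if x is dcons a b then ((num a + num b) * (num a + num b) + num a).+1 else 0.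

(** With s = a + b, the number s^2 + a lies between s^2 and (s + 1)^2 - 1, so s is determined, then
    a and b. The numbering provides equality on [data], an equality test by codes, and the numbers
    of the automaton states. *)
Lemma num_inj : injective num.
Proof.
elim=> [|a IHa b IHb] [|c d] //= [E].
have Es : num a + num b = num c + num d by nia.
have Ea : num a = num c by nia.
by rewrite (IHa _ Ea) (IHb d) //; lia.
Qed.

HB.instance Definition _ := Equality.copy data (inj_type num_inj).

(** Injectivity makes comparing encodings the same as comparing values, so that one test of equality
    ([comp_eq]) serves every encoded type. *)
Class Enc (A : Type) := { enc : A -> data; enc_inj : injective enc }.

Lemma enc_nat_inj : injective enc_nat.
Proof. by elim=> [|m IH] [|p] //= [/IH->]. Qed.

Lemma enc_seq_inj (A : Type) (f : A -> data) : injective f -> injective (enc_seq f).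
Proof. by move=> fI; elim=> [|x s IH] [|y t] //= [/fI-> /IH->]. Qed.

#[global] Instance Enc_data : Enc data := {| enc := id; enc_inj := fun _ _ e => e |}.
#[global] Instance Enc_nat : Enc nat := {| enc := enc_nat; enc_inj := enc_nat_inj |}.
#[global] Instance Enc_seq A (E : Enc A) : Enc (seq A) :=
  {| enc := enc_seq enc; enc_inj := enc_seq_inj enc_inj |}.

Definition enc_unit (x : unit) := dnil.
Lemma enc_unit_inj : injective enc_unit.
Proof. by case; case. Qed.
#[global] Instance Enc_unit : Enc unit := {| enc := enc_unit; enc_inj := enc_unit_inj |}.

Definition enc_bool (b : bool) := if b then dcons dnil dnil else dnil.
Lemma enc_bool_inj : injective enc_bool.
Proof. by case; case. Qed.
#[global] Instance Enc_bool : Enc bool := {| enc := enc_bool; enc_inj := enc_bool_inj |}.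

Definition enc_pair A B (EA : Enc A) (EB : Enc B) (x : A * B) := dcons (enc x.1) (enc x.2).
Lemma enc_pair_inj A B EA EB : injective (@enc_pair A B EA EB).
Proof. by move=> [a b] [c d] [/(@enc_inj _ EA)-> /(@enc_inj _ EB)->]. Qed.
#[global] Instance Enc_pair A B EA EB : Enc (A * B) :=
  {| enc := @enc_pair A B EA EB; enc_inj := @enc_pair_inj A B EA EB |}.

Definition enc_opt A (EA : Enc A) (x : option A) :=
  if x is Some a then dcons dnil (enc a) else dnil.
Lemma enc_opt_inj A EA : injective (@enc_opt A EA).
Proof. by move=> [a|] [b|] //= [/(@enc_inj _ EA)->]. Qed.
#[global] Instance Enc_opt A EA : Enc (option A) :=
  {| enc := @enc_opt A EA; enc_inj := @enc_opt_inj A EA |}.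

Lemma enc_stack_op_inj : injective enc_stack_op.
Proof.
move=> [a b|k|k|k|k] [a' b'|k'|k'|k'|k'] //=; rewrite /enc_tuple /=;
  first [by case=> /enc_nat_inj-> /enc_nat_inj-> | by case=> /enc_nat_inj->].
Qed.
#[global] Instance Enc_stack_op : Enc stack_op :=
  {| enc := enc_stack_op; enc_inj := enc_stack_op_inj |}.
HB.instance Definition _ := Equality.copy stack_op (inj_type enc_stack_op_inj).

Lemma enc_tree_op_inj : injective enc_tree_op.
Proof.
move=> [p o q|p ps|ps p] [p' o' q'|p' ps'|ps' p'] //=; rewrite /enc_tuple /=.
- by case=> /enc_nat_inj-> /enc_stack_op_inj-> /enc_nat_inj->.
- by case=> /enc_nat_inj-> /(enc_seq_inj enc_nat_inj)->.
- by case=> /(enc_seq_inj enc_nat_inj)-> /enc_nat_inj->.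
Qed.
#[global] Instance Enc_tree_op : Enc tree_op :=
  {| enc := enc_tree_op; enc_inj := enc_tree_op_inj |}.

(* Every code below is loop-free and defined on all of [data], so that no
   termination condition on ill-formed encodings ever arises. *)
Definition dcomp (F : data -> data) := exists c, forall x, eval c x (F x).

Fixpoint drec (f0 f1 : data -> data) (e t : data) : data :=
  if t is dcons a b then
    f1 (dcons e (dcons (dcons a b) (dcons (drec f0 f1 e a) (drec f0 f1 e b))))
  else f0 e.

Lemma dcomp_ext F G : F =1 G -> dcomp F -> dcomp G.
Proof. by move=> FG [c Hc]; exists c => x; rewrite -FG. Qed.
Lemma dcomp_id : dcomp id.
Proof. by exists CId => x; constructor. Qed.
Lemma dcomp_const y : dcomp (fun=> y).
Proof. by exists (CConst y) => x; constructor. Qed.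
Lemma dcomp_fst F : dcomp F -> dcomp (fun x => dfst (F x)).
Proof. by move=> [c Hc]; exists (CComp CFst c) => x; econstructor; eauto; constructor. Qed.
Lemma dcomp_snd F : dcomp F -> dcomp (fun x => dsnd (F x)).
Proof. by move=> [c Hc]; exists (CComp CSnd c) => x; econstructor; eauto; constructor. Qed.
Lemma dcomp_cons F G : dcomp F -> dcomp G -> dcomp (fun x => dcons (F x) (G x)).
Proof. by move=> [c Hc] [d Hd]; exists (CPair c d) => x; constructor. Qed.
Lemma dcomp_comp F G : dcomp F -> dcomp G -> dcomp (fun x => F (G x)).
Proof. by move=> [c Hc] [d Hd]; exists (CComp c d) => x; econstructor; eauto. Qed.
Lemma dcomp_rec f0 f1 E T :
  dcomp f0 -> dcomp f1 -> dcomp E -> dcomp T -> dcomp (fun x => drec f0 f1 (E x) (T x)).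
Proof.
move=> [c0 H0] [c1 H1] [cE HE] [cT HT]; exists (CComp (CRec c0 c1) (CPair cE cT)) => x.
apply: EvComp; first by constructor; [apply: HE | apply: HT].
by elim: (T x) => [|a IHa b IHb] /=; econstructor; eauto.
Qed.

Definition dif (c a b : data) : data := if c is dcons _ _ then a else b.
(** The language has no conditional. Recursion on the tested tree with the recursive results thrown
    away selects the branch: [dnil] takes the base case, [dcons] the step. *)
Lemma dcomp_if C F G : dcomp C -> dcomp F -> dcomp G -> dcomp (fun x => dif (C x) (F x) (G x)).
Proof.
move=> HC HF HG; apply: (@dcomp_ext (fun x => drec G (fun y => F (dfst y)) x (C x))).
  by move=> x; case: (C x).
apply: dcomp_rec => //; last exact: dcomp_id.
by apply: dcomp_comp => //; apply: dcomp_fst; apply: dcomp_id.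
Qed.

(** The realizer F is total, but it is constrained on encodings only. *)
Definition comp A B {EA : Enc A} {EB : Enc B} (f : A -> B) :=
  exists F, dcomp F /\ forall a, F (enc a) = enc (f a).

Lemma comp_code A B {EA : Enc A} {EB : Enc B} (f : A -> B) :
  comp f -> exists c, forall a, eval c (enc a) (enc (f a)).
Proof. by move=> [F [[c Hc] HF]]; exists c => a; rewrite -HF. Qed.

Lemma comp_ext A B {EA : Enc A} {EB : Enc B} (f g : A -> B) : f =1 g -> comp f -> comp g.
Proof. by move=> fg [F [HF H]]; exists F; split => // a; rewrite H fg. Qed.


Lemma comp_const {E : Type} {EE : Enc E} B {EB : Enc B} (b : B) : comp (fun _ : E => b).
Proof. by exists (fun=> enc b); split => //; apply: dcomp_const. Qed.
Lemma comp_id {E : Type} {EE : Enc E} : comp (fun e : E => e).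
Proof. by exists id; split => //; apply: dcomp_id. Qed.
Lemma comp_ap {E : Type} {EE : Enc E} A B {EA : Enc A} {EB : Enc B} (t : A -> B) (u : E -> A) :
  comp t -> comp u -> comp (fun e => t (u e)).
Proof.
move=> [F [HF H]] [G [HG K]]; exists (fun x => F (G x)); split; first exact: dcomp_comp.
by move=> a; rewrite K H.
Qed.
Lemma comp_pair {E : Type} {EE : Enc E} A B {EA : Enc A} {EB : Enc B} (f : E -> A) (g : E -> B) :
  comp f -> comp g -> comp (fun e => (f e, g e)).
Proof.
move=> [F [HF H]] [G [HG K]]; exists (fun x => dcons (F x) (G x)).
by split => [|a]; [exact: dcomp_cons | rewrite H K].
Qed.
Lemma comp_fst {E : Type} {EE : Enc E} A B {EA : Enc A} {EB : Enc B} (f : E -> A * B) : comp f -> comp (fun e => (f e).1).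
Proof.
by move=> [F [HF H]]; exists (fun x => dfst (F x)); split => [|a]; [exact: dcomp_fst | rewrite H].
Qed.
Lemma comp_snd {E : Type} {EE : Enc E} A B {EA : Enc A} {EB : Enc B} (f : E -> A * B) : comp f -> comp (fun e => (f e).2).
Proof.
by move=> [F [HF H]]; exists (fun x => dsnd (F x)); split => [|a]; [exact: dcomp_snd | rewrite H].
Qed.
Lemma comp_enc {E : Type} {EE : Enc E} A {EA : Enc A} (f : E -> A) : comp f -> comp (fun e => enc (f e)).
Proof. by move=> [F [HF H]]; exists F. Qed.
Lemma comp_dcons {E : Type} {EE : Enc E} (f g : E -> data) : comp f -> comp g -> comp (fun e => dcons (f e) (g e)).
Proof.
move=> [F [HF H]] [G [HG K]]; exists (fun x => dcons (F x) (G x)).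
by split => [|a]; [exact: dcomp_cons | rewrite H K].
Qed.
Lemma comp_if {E : Type} {EE : Enc E} B {EB : Enc B} (c : E -> bool) (f g : E -> B) :
  comp c -> comp f -> comp g -> comp (fun e => if c e then f e else g e).
Proof.
move=> [C [HC H]] [F [HF K]] [G [HG L]]; exists (fun x => dif (C x) (F x) (G x)).
by split => [|a]; [exact: dcomp_if | rewrite H K L; case: (c a)].
Qed.
Lemma comp_Some {E : Type} {EE : Enc E} B {EB : Enc B} (f : E -> B) : comp f -> comp (fun e => Some (f e)).
Proof.
move=> [F [HF H]]; exists (fun x => dcons dnil (F x)); split => [|a]; last by rewrite H.
by apply: dcomp_cons => //; apply: dcomp_const.
Qed.
Lemma comp_isSome {E : Type} {EE : Enc E} B {EB : Enc B} (f : E -> option B) : comp f -> comp (fun e => isSome (f e)).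
Proof.
move=> [F [HF H]]; exists (fun x => dif (F x) (dcons dnil dnil) dnil).
split => [|a]; last by rewrite H; case: (f a).
by apply: dcomp_if => //; apply: dcomp_const.
Qed.
Lemma comp_odflt {E : Type} {EE : Enc E} B {EB : Enc B} (d : E -> B) (f : E -> option B) :
  comp d -> comp f -> comp (fun e => odflt (d e) (f e)).
Proof.
move=> [D [HD K]] [F [HF H]]; exists (fun x => dif (F x) (dsnd (F x)) (D x)).
split => [|a]; last by rewrite H K; case: (f a).
by apply: dcomp_if => //; apply: dcomp_snd.
Qed.
Lemma comp_cons {E : Type} {EE : Enc E} B {EB : Enc B} (f : E -> B) (g : E -> seq B) :
  comp f -> comp g -> comp (fun e => f e :: g e).
Proof.
move=> [F [HF H]] [G [HG K]]; exists (fun x => dcons (F x) (G x)).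
by split => [|a]; [exact: dcomp_cons | rewrite H K].
Qed.
Lemma comp_S {E : Type} {EE : Enc E} (f : E -> nat) : comp f -> comp (fun e => (f e).+1).
Proof.
move=> [F [HF H]]; exists (fun x => dcons dnil (F x)); split => [|a]; last by rewrite H.
by apply: dcomp_cons => //; apply: dcomp_const.
Qed.
Lemma comp_pred {E : Type} {EE : Enc E} (f : E -> nat) : comp f -> comp (fun e => (f e).-1).
Proof.
move=> [F [HF H]]; exists (fun x => dsnd (F x)); split => [|a]; last by rewrite H; case: (f a).
exact: dcomp_snd.
Qed.
Lemma comp_behead {E : Type} {EE : Enc E} B {EB : Enc B} (f : E -> seq B) : comp f -> comp (fun e => behead (f e)).
Proof.
move=> [F [HF H]]; exists (fun x => dsnd (F x)); split => [|a]; last by rewrite H; case: (f a).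
exact: dcomp_snd.
Qed.
Lemma comp_head {E : Type} {EE : Enc E} B {EB : Enc B} (d : E -> B) (f : E -> seq B) :
  comp d -> comp f -> comp (fun e => head (d e) (f e)).
Proof.
move=> [D [HD K]] [F [HF H]]; exists (fun x => dif (F x) (dfst (F x)) (D x)).
split => [|a]; last by rewrite H K; case: (f a).
by apply: dcomp_if => //; apply: dcomp_fst.
Qed.
(** An encoded list is a right comb, so in the recursion on it the result for the second subtree is
    the fold over the tail; the result for the first subtree, an encoded element, is dropped by
    G. *)
Lemma comp_foldr {E : Type} {EE : Enc E} A B {EA : Enc A} {EB : Enc B} (f : E -> A -> B -> B) (z : E -> B) (l : E -> seq A) :
  comp (fun y : E * A * B => f y.1.1 y.1.2 y.2) -> comp z -> comp l ->
  comp (fun e => foldr (f e) (z e) (l e)).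
Proof.
move=> [F [HF Hf]] [Z [HZ Hz]] [L [HL Hl]].
pose G y := F (dcons (dcons (dfst y) (dfst (dfst (dsnd y)))) (dsnd (dsnd (dsnd y)))).
exists (fun x => drec Z G x (L x)); split.
  apply: dcomp_rec => //; last exact: dcomp_id.
  apply: dcomp_comp => //.
  by repeat first [exact: dcomp_id | apply: dcomp_cons | apply: dcomp_fst | apply: dcomp_snd].
move=> e; rewrite Hl; elim: (l e) => [|a s IH] /=; first exact: Hz.
rewrite {1}/G /= IH; exact: (Hf (e, a, foldr (f e) (z e) s)).
Qed.
Lemma comp_iter {E : Type} {EE : Enc E} B {EB : Enc B} (n : E -> nat) (f : E -> B -> B) (z : E -> B) :
  comp n -> comp (fun y : E * B => f y.1 y.2) -> comp z -> comp (fun e => iter (n e) (f e) (z e)).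
Proof.
move=> [N [HN Hn]] [F [HF Hf]] [Z [HZ Hz]].
pose G y := F (dcons (dfst y) (dsnd (dsnd (dsnd y)))).
exists (fun x => drec Z G x (N x)); split.
  apply: dcomp_rec => //; last exact: dcomp_id.
  apply: dcomp_comp => //.
  by repeat first [exact: dcomp_id | apply: dcomp_cons | apply: dcomp_fst | apply: dcomp_snd].
move=> e; rewrite Hn; elim: (n e) => [|m IH] /=; first exact: Hz.
rewrite {1}/G /= IH; exact: (Hf (e, iter m (f e) (z e))).
Qed.

(** A hook, redefined whenever new closure lemmas are available, so that [comp_tac] proves
    computability by descent through a term. A bound variable is handled by pairing its value with
    the environment. *)
Ltac comp_reg := fail.
Ltac comp_step :=
  match goal with
  | |- comp (fun _ => ?b) => apply: comp_const
  | |- comp (fun e => e) => apply: comp_id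
  | |- comp (@fst _ _) => exact: (comp_fst comp_id)
  | |- comp (@snd _ _) => exact: (comp_snd comp_id)
  | |- comp (fun e => (_, _)) => apply: comp_pair
  | |- comp (fun e => fst _) => apply: comp_fst
  | |- comp (fun e => snd _) => apply: comp_snd
  | |- comp (fun e => enc _) => apply: comp_enc
  | |- comp (fun e => dcons _ _) => apply: comp_dcons
  | |- comp (fun e => if _ then _ else _) => apply: comp_if
  | |- comp (fun e => Some _) => apply: comp_Some
  | |- comp (fun e => isSome _) => apply: comp_isSome
  | |- comp (fun e => odflt _ _) => apply: comp_odflt
  | |- comp (fun e => cons _ _) => apply: comp_cons
  | |- comp (fun e => S _) => apply: comp_S
  | |- comp (fun e => predn _) => apply: comp_pred
  | |- comp (fun e => behead _) => apply: comp_behead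
  | |- comp (fun e => head _ _) => apply: comp_head
  | |- comp (fun e => foldr _ _ _) => apply: comp_foldr
  | |- comp (fun e => iter _ _ _) => apply: comp_iter
  | H : comp ?t |- comp ?t => exact: H
  | H : comp ?t |- comp (fun e => ?t _) => apply: (comp_ap H)
  | _ => comp_reg
  end.
Ltac comp_tac := repeat (cbv beta; comp_step).


Lemma comp_addn {E : Type} {EE : Enc E} (f g : E -> nat) : comp f -> comp g -> comp (fun e => f e + g e).
Proof.
move=> Hf Hg; apply: (@comp_ext _ _ _ _ (fun e => iter (f e) succn (g e))) => [e|].
  by elim: (f e) => //= m ->.
by comp_tac.
Qed.
Lemma comp_subn {E : Type} {EE : Enc E} (f g : E -> nat) : comp f -> comp g -> comp (fun e => f e - g e).
Proof.
move=> Hf Hg; apply: (@comp_ext _ _ _ _ (fun e => iter (g e) predn (f e))) => [e|].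
  by elim: (g e) => [|m /= ->]; rewrite ?subn0 ?subnS.
by comp_tac.
Qed.
Lemma comp_negb {E : Type} {EE : Enc E} (f : E -> bool) : comp f -> comp (fun e => ~~ f e).
Proof. by move=> Hf; rewrite /negb; comp_tac. Qed.
Lemma comp_andb {E : Type} {EE : Enc E} (f g : E -> bool) : comp f -> comp g -> comp (fun e => f e && g e).
Proof. by move=> Hf Hg; rewrite /andb; comp_tac. Qed.
Lemma comp_nilp {E : Type} {EE : Enc E} A {EA : Enc A} (f : E -> seq A) : comp f -> comp (fun e => nilp (f e)).
Proof.
move=> Hf; apply: (@comp_ext _ _ _ _ (fun e => foldr (fun _ _ => false) true (f e))) => [e|].
  by case: (f e).
by comp_tac.
Qed.
Lemma comp_size {E : Type} {EE : Enc E} A {EA : Enc A} (f : E -> seq A) : comp f -> comp (fun e => size (f e)).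
Proof.
move=> Hf; apply: (@comp_ext _ _ _ _ (fun e => foldr (fun _ m => m.+1) 0 (f e))) => [e|].
  by elim: (f e) => //= a s ->.
by comp_tac.
Qed.
Lemma comp_eq0 {E : Type} {EE : Enc E} (f : E -> nat) : comp f -> comp (fun e => f e == 0).
Proof.
move=> Hf; apply: (@comp_ext _ _ _ _ (fun e => iter (f e) (fun=> false) true)) => [e|].
  by case: (f e).
by comp_tac.
Qed.

Ltac comp_reg ::= match goal with
  | |- comp (fun e => addn _ _) => apply: comp_addn
  | |- comp (fun e => subn _ _) => apply: comp_subn
  | |- comp (fun e => negb _) => apply: comp_negb
  | |- comp (fun e => andb _ _) => apply: comp_andb
  | |- comp (fun e => nilp _) => apply: comp_nilp
  | |- comp (fun e => size _) => apply: comp_size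
  end.


Lemma comp_leq {E : Type} {EE : Enc E} (f g : E -> nat) : comp f -> comp g -> comp (fun e => f e <= g e).
Proof. by move=> Hf Hg; rewrite /leq; apply: comp_eq0; comp_tac. Qed.
Lemma comp_muln {E : Type} {EE : Enc E} (f g : E -> nat) : comp f -> comp g -> comp (fun e => f e * g e).
Proof.
move=> Hf Hg; apply: (@comp_ext _ _ _ _ (fun e => iter (f e) (addn (g e)) 0)) => [e|].
  by elim: (f e) => //= m ->.
by comp_tac.
Qed.
Lemma comp_orb {E : Type} {EE : Enc E} (f g : E -> bool) : comp f -> comp g -> comp (fun e => f e || g e).
Proof. by move=> Hf Hg; rewrite /orb; comp_tac. Qed.
Lemma comp_cat {E : Type} {EE : Enc E} A {EA : Enc A} (f g : E -> seq A) :
  comp f -> comp g -> comp (fun e => f e ++ g e).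
Proof.
move=> Hf Hg; apply: (@comp_ext _ _ _ _ (fun e => foldr (fun a s => a :: s) (g e) (f e))) => [e|].
  by elim: (f e) => //= a s ->.
by comp_tac.
Qed.
Lemma comp_map {E : Type} {EE : Enc E} A B {EA : Enc A} {EB : Enc B} (f : E -> A -> B) (l : E -> seq A) :
  comp (fun y : E * A => f y.1 y.2) -> comp l -> comp (fun e => map (f e) (l e)).
Proof.
move=> Hf Hl; apply: (@comp_ext _ _ _ _ (fun e => foldr (fun a s => f e a :: s) [::] (l e))) => [e|].
  by elim: (l e) => //= a s ->.
comp_tac; apply: (comp_ap (t := fun y => f y.1 y.2) (u := fun y : E * A * seq B => (y.1.1, y.1.2))) => //.
by comp_tac.
Qed.
Lemma comp_filter {E : Type} {EE : Enc E} A {EA : Enc A} (f : E -> A -> bool) (l : E -> seq A) :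
  comp (fun y : E * A => f y.1 y.2) -> comp l -> comp (fun e => filter (f e) (l e)).
Proof.
move=> Hf Hl.
apply: (@comp_ext _ _ _ _ (fun e => foldr (fun a s => if f e a then a :: s else s) [::] (l e))) => [e|].
  by elim: (l e) => //= a s ->.
comp_tac; apply: (comp_ap (t := fun y => f y.1 y.2) (u := fun y : E * A * seq A => (y.1.1, y.1.2))) => //.
by comp_tac.
Qed.
Lemma comp_has {E : Type} {EE : Enc E} A {EA : Enc A} (f : E -> A -> bool) (l : E -> seq A) :
  comp (fun y : E * A => f y.1 y.2) -> comp l -> comp (fun e => has (f e) (l e)).
Proof.
move=> Hf Hl.
apply: (@comp_ext _ _ _ _ (fun e => ~~ nilp (filter (f e) (l e)))) => [e|].
  by rewrite /nilp size_filter -lt0n has_count.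
by comp_tac; apply: comp_filter.
Qed.
Lemma comp_all {E : Type} {EE : Enc E} A {EA : Enc A} (f : E -> A -> bool) (l : E -> seq A) :
  comp (fun y : E * A => f y.1 y.2) -> comp l -> comp (fun e => all (f e) (l e)).
Proof.
move=> Hf Hl.
apply: (@comp_ext _ _ _ _ (fun e => ~~ has (fun a => ~~ f e a) (l e))) => [e|].
  by rewrite -all_predC; apply: eq_all => a /=; rewrite negbK.
by apply: comp_negb; apply: comp_has => //; apply: comp_negb.
Qed.
Lemma comp_flatten {E : Type} {EE : Enc E} A {EA : Enc A} (f : E -> seq (seq A)) :
  comp f -> comp (fun e => flatten (f e)).
Proof.
move=> Hf; apply: (@comp_ext _ _ _ _ (fun e => foldr (fun a s => a ++ s) [::] (f e))) => [e|] //.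
by apply: comp_foldr; comp_tac; apply: comp_cat; comp_tac.
Qed.
Lemma comp_iota {E : Type} {EE : Enc E} (f g : E -> nat) : comp f -> comp g -> comp (fun e => iota (f e) (g e)).
Proof.
move=> Hf Hg; apply: (@comp_ext _ _ _ _
  (fun e => iter (g e) (fun s => s ++ [:: f e + size s]) [::])) => [e|].
  elim: (g e) => //= m IH; rewrite IH.
  by rewrite size_iota -[RHS]/(iota (f e) m.+1) -[m.+1]addn1 iotaD.
by comp_tac; apply: comp_cat; comp_tac.
Qed.
Lemma comp_drop {E : Type} {EE : Enc E} A {EA : Enc A} (n : E -> nat) (f : E -> seq A) :
  comp n -> comp f -> comp (fun e => drop (n e) (f e)).
Proof.
move=> Hn Hf; apply: (@comp_ext _ _ _ _ (fun e => iter (n e) behead (f e))) => [e|].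
  by elim: (n e) => [|m IH] /=; rewrite ?drop0 // IH -drop1 drop_drop.
by comp_tac.
Qed.
Lemma comp_drec {E : Type} {EE : Enc E} B {EB : Enc B} (f : E -> data) (z : B) (g : data -> data -> B -> B -> B) :
  comp f -> comp (fun y : data * data * (B * B) => g y.1.1 y.1.2 y.2.1 y.2.2) ->
  comp (fun e => @data_rect (fun=> B) z (fun a ya b yb => g a b ya yb) (f e)).
Proof.
move=> [F [HF H]] [G [HG K]].
exists (fun x => drec (fun=> enc z) (fun y => G (dsnd y)) x (F x)); split.
  apply: dcomp_rec => //; [exact: dcomp_const | | exact: dcomp_id].
  by apply: dcomp_comp => //; apply: dcomp_snd; apply: dcomp_id.
move=> e; rewrite H; elim: (f e) => //= a -> b ->.
by rewrite -(K (a, b, (_, _))).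
Qed.

Ltac comp_reg_arith := match goal with
  | |- comp (fun e => addn _ _) => apply: comp_addn
  | |- comp (fun e => subn _ _) => apply: comp_subn
  | |- comp (fun e => muln _ _) => apply: comp_muln
  | |- comp (fun e => leq _ _) => apply: comp_leq
  | |- comp (fun e => negb _) => apply: comp_negb
  | |- comp (fun e => andb _ _) => apply: comp_andb
  | |- comp (fun e => orb _ _) => apply: comp_orb
  | |- comp (fun e => nilp _) => apply: comp_nilp
  | |- comp (fun e => size _) => apply: comp_size
  | |- comp (fun e => cat _ _) => apply: comp_cat
  | |- comp (fun e => map _ _) => apply: comp_map
  | |- comp (fun e => filter _ _) => apply: comp_filter
  | |- comp (fun e => has _ _) => apply: comp_has
  | |- comp (fun e => all _ _) => apply: comp_all
  | |- comp (fun e => flatten _) => apply: comp_flatten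
  | |- comp (fun e => iota _ _) => apply: comp_iota
  | |- comp (fun e => drop _ _) => apply: comp_drop
  end.
Ltac comp_reg ::= comp_reg_arith.


Lemma comp_num {E : Type} {EE : Enc E} (f : E -> data) : comp f -> comp (fun e => num (f e)).
Proof.
move=> Hf; apply: (@comp_ext _ _ _ _ (fun e =>
  @data_rect (fun=> nat) 0 (fun _ m _ p => ((m + p) * (m + p) + m).+1) (f e))) => [e|].
  by elim: (f e) => //= a -> b ->.
by apply: (@comp_drec E EE nat _ f 0 (fun _ _ m p => ((m + p) * (m + p) + m).+1)) => //; comp_tac.
Qed.
Lemma comp_eqn {E : Type} {EE : Enc E} (f g : E -> nat) : comp f -> comp g -> comp (fun e => f e == g e).
Proof.
move=> Hf Hg; apply: (@comp_ext _ _ _ _ (fun e => (f e <= g e) && (g e <= f e))) => [e|].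
  by rewrite eqn_leq.
by comp_tac.
Qed.


(** Equality at any encoded type is reduced to equality of natural numbers through [enc] and [num],
    both injective. *)
Lemma comp_eq {E : Type} {EE : Enc E} (A : eqType) {EA : Enc A} (f g : E -> A) :
  comp f -> comp g -> comp (fun e => f e == g e).
Proof.
move=> Hf Hg; apply: (@comp_ext _ _ _ _ (fun e => num (enc (f e)) == num (enc (g e)))) => [e|].
  by rewrite (inj_eq num_inj) (inj_eq enc_inj).
by apply: comp_eqn; apply: comp_num; comp_tac.
Qed.
Lemma comp_mem {E : Type} {EE : Enc E} (A : eqType) {EA : Enc A} (f : E -> A) (l : E -> seq A) :
  comp f -> comp l -> comp (fun e => f e \in l e).
Proof.
move=> Hf Hl; apply: (@comp_ext _ _ _ _ (fun e => has (fun a => a == f e) (l e))) => [e|].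
  by rewrite has_pred1.
by comp_tac; apply: comp_eq; comp_tac.
Qed.
Lemma comp_nth {E : Type} {EE : Enc E} A {EA : Enc A} (d : E -> A) (f : E -> seq A) (n : E -> nat) :
  comp d -> comp f -> comp n -> comp (fun e => nth (d e) (f e) (n e)).
Proof.
move=> Hd Hf Hn; apply: (@comp_ext _ _ _ _ (fun e => head (d e) (drop (n e) (f e)))) => [e|].
  by rewrite -nth0 nth_drop addn0.
by comp_tac.
Qed.
Lemma comp_rev {E : Type} {EE : Enc E} A {EA : Enc A} (f : E -> seq A) : comp f -> comp (fun e => rev (f e)).
Proof.
move=> Hf; apply: (@comp_ext _ _ _ _ (fun e => foldr (fun a s => s ++ [:: a]) [::] (f e))) => [e|].
  by elim: (f e) => //= a s ->; rewrite rev_cons cats1.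
by comp_tac.
Qed.
Lemma comp_sumn {E : Type} {EE : Enc E} (f : E -> seq nat) : comp f -> comp (fun e => sumn (f e)).
Proof. by move=> Hf; rewrite /sumn; comp_tac. Qed.

Ltac comp_reg_base := match goal with
  | |- comp (fun e => nth _ _ _) => apply: comp_nth
  | |- comp (fun e => rev _) => apply: comp_rev
  | |- comp (fun e => sumn _) => apply: comp_sumn
  | |- comp (fun e => num _) => apply: comp_num
  | |- comp (fun e => _ == _) => apply: comp_eq
  | |- comp (fun e => _ \in _) => apply: comp_mem
  | _ => comp_reg_arith
  end.
Ltac comp_reg ::= comp_reg_base.

(** * Subsets of a finite list, represented by its subsequences *)

Definition sublists (A : Type) (s : seq A) : seq (seq A) :=
  foldr (fun x r => r ++ map (cons x) r) [:: [::]] s.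

(** [filter p s] is the canonical representative of the subset cut out by p; through it an exactly
    computed set of states is found among the finitely many candidates. *)
Lemma filter_sublists (A : eqType) (p : pred A) (s : seq A) : filter p s \in sublists s.
Proof.
elim: s => //= x s IH; case: (p x); rewrite mem_cat ?IH //.
by apply/orP; right; apply: map_f.
Qed.
Lemma sublists_sub (A : eqType) (s d : seq A) : d \in sublists s -> {subset d <= s}.
Proof.
elim: s d => [|x s IH] d /=; first by rewrite inE => /eqP->.
rewrite mem_cat => /orP[/IH H|/mapP[r /IH H ->]] y.
  by move/H; rewrite inE orbC => ->.
by rewrite !inE => /orP[->//|/H->]; rewrite orbT.
Qed.

Lemma comp_sublists {E : Type} {EE : Enc E} A {EA : Enc A} (f : E -> seq A) : comp f -> comp (fun e => sublists (f e)).
Proof. by move=> Hf; rewrite /sublists; comp_tac. Qed.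
Lemma comp_take {E : Type} {EE : Enc E} A {EA : Enc A} (n : E -> nat) (f : E -> seq A) :
  comp n -> comp f -> comp (fun e => take (n e) (f e)).
Proof.
move=> Hn Hf; apply: (@comp_ext _ _ _ _
  (fun e => rev (drop (size (f e) - n e) (rev (f e))))) => [e|].
  by rewrite -rev_take revK.
by comp_tac.
Qed.
Lemma comp_foldl {E : Type} {EE : Enc E} A B {EA : Enc A} {EB : Enc B} (f : E -> B -> A -> B) (z : E -> B) (l : E -> seq A) :
  comp (fun y : E * B * A => f y.1.1 y.1.2 y.2) -> comp z -> comp l ->
  comp (fun e => foldl (f e) (z e) (l e)).
Proof.
move=> Hf Hz Hl; apply: (@comp_ext _ _ _ _ (fun e => foldr (fun a b => f e b a) (z e) (rev (l e)))) => [e|].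
  by rewrite -[l e in RHS]revK foldl_rev.
comp_tac.
by apply: (comp_ap (t := fun y => f y.1.1 y.1.2 y.2) (u := fun y : E * A * B => (y.1.1, y.2, y.1.2))) => //; comp_tac.
Qed.

Lemma comp_field {E : Type} {EE : Enc E} (A B : Type) {EA : Enc A} {EB : Enc B} (sel : A -> B) (F : data -> data) (f : E -> A) :
  dcomp F -> (forall a, F (enc a) = enc (sel a)) -> comp f -> comp (fun e => sel (f e)).
Proof. by move=> HF H Hf; apply: (@comp_ap E EE _ _ _ _ sel) => //; exists F. Qed.

(** Tag and arguments are read by total projections because [comp] has rules for conditionals but
    none for pattern matching on operations. *)
Definition so_tag (o : stack_op) := match o with
  Rew _ _ => 0 | PushChar _ => 1 | Push _ => 2 | Pop _ => 3 | Collapse _ => 4 end.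
Definition so_arg (o : stack_op) := match o with
  Rew a _ => a | PushChar k => k | Push k => k | Pop k => k | Collapse k => k end.
Definition so_arg2 (o : stack_op) := match o with Rew _ b => b | _ => 0 end.

(** Partial projections with lists of length at most one as options: flattening their map over a
    list of operations collects those of one kind. *)
Definition sel_stack (t : tree_op) : seq (nat * (stack_op * nat)) :=
  if t is OpStack p o p' then [:: (p, (o, p'))] else [::].
Definition sel_plus (t : tree_op) : seq (nat * seq nat) :=
  if t is OpPlus p ps then [:: (p, ps)] else [::].
Definition sel_minus (t : tree_op) : seq (seq nat * nat) :=
  if t is OpMinus ps p then [:: (ps, p)] else [::].

Ltac dcomp_tac := repeat first [exact: dcomp_id | exact: dcomp_const | apply: dcomp_if | apply: dcomp_cons
   | apply: dcomp_fst | apply: dcomp_snd].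

Lemma comp_so_tag {E : Type} {EE : Enc E} (f : E -> stack_op) : comp f -> comp (fun e => so_tag (f e)).
Proof. by apply: (comp_field (F := dfst)) => [|[]//]; dcomp_tac. Qed.
Lemma comp_so_arg {E : Type} {EE : Enc E} (f : E -> stack_op) : comp f -> comp (fun e => so_arg (f e)).
Proof. by apply: (comp_field (F := fun x => dfst (dsnd x))) => [|[]//]; dcomp_tac. Qed.
Lemma comp_so_arg2 {E : Type} {EE : Enc E} (f : E -> stack_op) : comp f -> comp (fun e => so_arg2 (f e)).
Proof. by apply: (comp_field (F := fun x => dfst (dsnd (dsnd x)))) => [|[]//]; dcomp_tac. Qed.
Lemma comp_sel_stack {E : Type} {EE : Enc E} (f : E -> tree_op) : comp f -> comp (fun e => sel_stack (f e)).
Proof.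
apply: (comp_field (F := fun x => dif (dfst x) dnil (dcons (dcons (dfst (dsnd x))
  (dcons (dfst (dsnd (dsnd x))) (dfst (dsnd (dsnd (dsnd x)))))) dnil))) => [|[]//]; dcomp_tac.
Qed.
Lemma comp_sel_plus {E : Type} {EE : Enc E} (f : E -> tree_op) : comp f -> comp (fun e => sel_plus (f e)).
Proof.
apply: (comp_field (F := fun x => dif (dfst x) (dif (dsnd (dfst x)) dnil (dcons (dcons (dfst (dsnd x))
  (dfst (dsnd (dsnd x)))) dnil)) dnil)) => [|[]//]; dcomp_tac.
Qed.
Lemma comp_sel_minus {E : Type} {EE : Enc E} (f : E -> tree_op) : comp f -> comp (fun e => sel_minus (f e)).
Proof.
apply: (comp_field (F := fun x => dif (dsnd (dfst x)) (dcons (dcons (dfst (dsnd x))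
  (dfst (dsnd (dsnd x)))) dnil) dnil)) => [|[]//]; dcomp_tac.
Qed.

Ltac comp_reg1 := match goal with
  | |- comp (fun e => sublists _) => apply: comp_sublists
  | |- comp (fun e => take _ _) => apply: comp_take
  | |- comp (fun e => foldl _ _ _) => apply: comp_foldl
  | |- comp (fun e => so_tag _) => apply: comp_so_tag
  | |- comp (fun e => so_arg _) => apply: comp_so_arg
  | |- comp (fun e => so_arg2 _) => apply: comp_so_arg2
  | |- comp (fun e => sel_stack _) => apply: comp_sel_stack
  | |- comp (fun e => sel_plus _) => apply: comp_sel_plus
  | |- comp (fun e => sel_minus _) => apply: comp_sel_minus
  | _ => comp_reg_base
  end.
Ltac comp_reg ::= comp_reg1.

(** * Stack operations over an arbitrary algebra *)

Section Algebra.
Variables (V : Type) (chr : nat -> V -> V) (cns : nat -> V -> V -> V) (emp : nat -> V).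

(** The spine v :_{k+1} l_0 :_{k+2} l_1 ...; the current order travels with the accumulator because
    [cns] is indexed by it. *)
Definition plug (k : nat) (v : V) (l : seq V) : V :=
  (foldl (fun kv d => (kv.1.+1, cns kv.1.+1 kv.2 d)) (k, v) l).2.

Lemma plug_cons k v d l : plug k v (d :: l) = plug k.+1 (cns k.+1 v d) l.
Proof. by []. Qed.

(* [op_fun] applies an operation ([None]: the identity) to the order-n stack
   h :_{j+1} l_0 :_{j+2} ... :_n l_{n-j-1}, where the head h is the empty stack
   of order j ([None]), or, for j = 0, a character a with an annotation u of
   order k ([Some (a, (k, u))]).  The result has at most one element.  All
   operations inspect only the head, so they make sense in any algebra. *)
Definition hval (j : nat) (h : option (nat * (nat * V))) : V :=
  if isSome h then chr (odflt (0, (0, emp 0)) h).1 (odflt (0, (0, emp 0)) h).2.2 else emp j.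

Definition op_fun (n : nat) (oo : option stack_op) (h : option (nat * (nat * V)))
    (l : seq V) : seq V :=
  let j := n - size l in
  let c := odflt (0, (0, emp 0)) h in
  let o := odflt (Pop 0) oo in
  let k := so_arg o in
  if ~~ isSome oo then [:: plug j (hval j h) l] else
  if so_tag o == 0 then
    if isSome h && (c.1 == k) then [:: plug 0 (chr (so_arg2 o) c.2.2) l] else [::]
  else if so_tag o == 1 then
    if isSome h then
      (* Below a character, l_i has order i + 1, so the annotation to be copied is entry k - 1. *)
      [:: plug 1 (cns 1 (chr c.1 (nth (emp 0) l k.-1))
                        (cns 1 (chr c.1 c.2.2) (head (emp 0) l))) (behead l)]
    else [::]
  else if so_tag o == 2 then
    if j < k then
      (* The head and the first k - 1 - j entries make up the topmost stack of order k - 1; the next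
         entry is the stack of order k on which it lies. *)
      [:: plug k (cns k (plug j (hval j h) (take (k.-1 - j) l))
                 (cns k (plug j (hval j h) (take (k.-1 - j) l)) (nth (emp 0) l (k.-1 - j))))
               (drop (k - j) l)]
    else [::]
  else if so_tag o == 3 then
    if j < k then [:: plug k (nth (emp 0) l (k.-1 - j)) (drop (k - j) l)] else [::]
  else
    if isSome h && (c.2.1 == k) then [:: plug k c.2.2 (drop k l)] else [::].

End Algebra.

Section Parametricity.
Variables (n : nat) (Sigma : seq nat).
Variables (V1 : Type) (chr1 : nat -> V1 -> V1) (cns1 : nat -> V1 -> V1 -> V1) (emp1 : nat -> V1).
Variables (V2 : Type) (chr2 : nat -> V2 -> V2) (cns2 : nat -> V2 -> V2 -> V2) (emp2 : nat -> V2).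
Variable R : nat -> V1 -> V2 -> Prop.
Hypothesis Rchr : forall a k u d, a \in Sigma -> 0 < k <= n -> R k u d -> R 0 (chr1 a u) (chr2 a d).
Hypothesis Rcns : forall k v d v' d', k < n -> R k v d -> R k.+1 v' d' ->
  R k.+1 (cns1 k.+1 v v') (cns2 k.+1 d d').
Hypothesis Remp : forall k, 0 < k <= n -> R k (emp1 k) (emp2 k).

Fixpoint rel_list k (l1 : seq V1) (l2 : seq V2) : Prop :=
  match l1, l2 with
  | [::], [::] => True
  | a :: l1', b :: l2' => R k.+1 a b /\ rel_list k.+1 l1' l2'
  | _, _ => False
  end.

Lemma rel_list_size k l1 l2 : rel_list k l1 l2 -> size l1 = size l2.
Proof. by elim: l1 k l2 => [|a l1 IH] k [|b l2] //= [_ /IH->]. Qed.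

Lemma rel_list_drop m k l1 l2 :
  m <= size l1 -> rel_list k l1 l2 -> rel_list (k + m) (drop m l1) (drop m l2).
Proof.
elim: m k l1 l2 => [|m IH] k l1 l2; first by rewrite addn0 !drop0.
case: l1 l2 => [|a l1] [|b l2] //= Hm [_ H].
by rewrite addnS -addSn; apply: IH.
Qed.

Lemma rel_list_take m k l1 l2 : rel_list k l1 l2 -> rel_list k (take m l1) (take m l2).
Proof.
elim: m k l1 l2 => [|m IH] k l1 l2; first by rewrite !take0.
by case: l1 l2 => [|a l1] [|b l2] //= [H /IH].
Qed.

Lemma rel_list_nth m k l1 l2 d1 d2 :
  m < size l1 -> rel_list k l1 l2 -> R (k + m).+1 (nth d1 l1 m) (nth d2 l2 m).
Proof.
elim: m k l1 l2 => [|m IH] k [|a l1] [|b l2] //= Hm [H H'].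
  by rewrite addn0.
by rewrite addnS -addSn; apply: IH.
Qed.

Lemma rel_plug k v d l1 l2 : k + size l1 <= n -> R k v d -> rel_list k l1 l2 ->
  R (k + size l1) (plug cns1 k v l1) (plug cns2 k d l2).
Proof.
elim: l1 k v d l2 => [|a l1 IH] k v d [|b l2] //=; first by rewrite addn0.
rewrite addnS => Hk H [Ha Hl]; rewrite !plug_cons -addSn; apply: IH => //.
by apply: Rcns => //; lia.
Qed.

Definition rel_head j (h1 : option (nat * (nat * V1))) (h2 : option (nat * (nat * V2))) : Prop :=
  match h1, h2 with
  | None, None => 0 < j
  | Some (a, (k, u)), Some (a', (k', d)) =>
      [/\ j = 0, a = a', a \in Sigma, k = k' & 0 < k <= n /\ R k u d]
  | _, _ => False
  end.

Lemma rel_hval j h1 h2 : j <= n -> rel_head j h1 h2 -> R j (hval chr1 emp1 j h1) (hval chr2 emp2 j h2).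
Proof.
case: h1 h2 => [[a [k u]]|] [[b [k' d]]|] //= Hj; last by move=> H; apply: Remp; lia.
by move=> [-> <- Ha _ [Hk HR]]; apply: Rchr HR.
Qed.

(** Parametricity: the case distinctions of [op_fun] depend only on the length of l, the letter and
    the order of its annotation, and related arguments agree on these. The instances are the typing
    of results and both directions of the saturation. *)
Lemma op_fun_rel oo h1 h2 l1 l2 :
  (if oo is Some o then in_Ops n Sigma o else true) ->
  size l1 <= n -> rel_head (n - size l1) h1 h2 -> rel_list (n - size l1) l1 l2 ->
  op_fun chr1 cns1 emp1 n oo h1 l1 = [::] /\ op_fun chr2 cns2 emp2 n oo h2 l2 = [::] \/
  exists v1 v2, [/\ op_fun chr1 cns1 emp1 n oo h1 l1 = [:: v1],
    op_fun chr2 cns2 emp2 n oo h2 l2 = [:: v2] & R n v1 v2].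
Proof.
move=> Ho Hn Hh Hl; rewrite /op_fun -(rel_list_size Hl).
have Hv := rel_hval (leq_subr _ _) Hh.
set j := n - size l1 in Hh Hl Hv *.
have Hj : j + size l1 = n by rewrite /j; lia.
clearbody j.
have Hpl k v d m : R k v d -> j + m = k -> m <= size l1 ->
    R n (plug cns1 k v (drop m l1)) (plug cns2 k d (drop m l2)).
  move=> Hvd Ek Hm; have -> : n = k + size (drop m l1) by rewrite size_drop; lia.
  apply: rel_plug => //; first by rewrite size_drop; lia.
  by rewrite -Ek; apply: rel_list_drop.
case: oo Ho => [o|] Ho /=; last first.
  right; do 2 eexists; split; eauto.
  by have := Hpl _ _ _ 0 Hv; rewrite !drop0 addn0; apply.
case: o Ho => [a b|k|k|k|k] /= Ho.
- case: h1 h2 Hh {Hv} => [[a1 [k1 u1]]|] [[a2 [k2 u2]]|] //= Hh; last by left.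
  case: Hh => Ej <- Ha _ [Hk Hu]; case: eqP => E; last by left.
  right; do 2 eexists; split; eauto; have := Hpl 0 (chr1 b u1) (chr2 b u2) 0; rewrite !drop0; apply; try lia.
  by apply: Rchr Hu => //; case/andP: Ho.
- case: h1 h2 Hh {Hv} => [[a1 [k1 u1]]|] [[a2 [k2 u2]]|] //= Hh; last by left.
  case: Hh => Ej <- Ha _ [Hk Hu].
  right; do 2 eexists; split; eauto.
  move: Ho Hpl Hl Hj; rewrite Ej; case: l1 Hn => [|x l1] Hn Ho Hpl Hl Hj; first by move: Hj => /=; lia.
  case: l2 Hl Hpl => [|y l2] // Hl Hpl.
  have := Hpl 1 _ _ 1; rewrite /= !drop0; apply => //; case: (Hl) => Hxy Hl'.
  apply: (Rcns (k := 0)); first by lia.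
    apply: (Rchr (k := k)) => //.
    have := @rel_list_nth k.-1 0 _ _ (emp1 0) (emp2 0) _ Hl.
    by rewrite add0n prednK; last lia; apply; move: Hj => /=; lia.
  by apply: (Rcns (k := 0)) => //; [lia | apply: Rchr Hu].
- case: ifP => Hjk; last by left.
  right; do 2 eexists; split; eauto.
  have Hx : R k.-1 (plug cns1 j (hval chr1 emp1 j h1) (take (k.-1 - j) l1))
                 (plug cns2 j (hval chr2 emp2 j h2) (take (k.-1 - j) l2)).
    have Es : size (take (k.-1 - j) l1) = k.-1 - j by rewrite size_takel; lia.
    have := @rel_plug j _ _ (take (k.-1 - j) l1) (take (k.-1 - j) l2) _ Hv (rel_list_take _ Hl).
    by rewrite Es; have -> : j + (k.-1 - j) = k.-1 by [lia]; apply; lia.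
  apply: Hpl; try lia.
  have := @rel_list_nth (k.-1 - j) j _ _ (emp1 0) (emp2 0) _ Hl.
  have -> : (j + (k.-1 - j)).+1 = k.-1.+1 by lia.
  move=> H; rewrite -(@prednK k) //; last by lia.
  by apply: Rcns => //; [lia | apply: Rcns => //; [lia | apply: H; lia]].
- case: ifP => Hjk; last by left.
  right; do 2 eexists; split; eauto; apply: Hpl; try lia.
  have := @rel_list_nth (k.-1 - j) j _ _ (emp1 0) (emp2 0) _ Hl.
  by have -> : (j + (k.-1 - j)).+1 = k by [lia]; apply; lia.
- case: h1 h2 Hh {Hv} => [[a1 [k1 u1]]|] [[a2 [k2 u2]]|] //= Hh; last by left.
  case: Hh => Ej _ Ha Ek [Hk Hu]; rewrite -Ek; case: eqP => E; last by left.
  right; do 2 eexists; split; eauto; rewrite -E; apply: Hpl => //; lia.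
Qed.

End Parametricity.

(** * Stacks seen as a head followed by a list of stacks *)

Definition cns_stack (k : nat) := SCons.

Lemma plug_stack k v l : plug cns_stack k v l = foldl SCons v l.
Proof. by elim: l k v => //= a l IH k v; rewrite plug_cons IH. Qed.

(** [scons] descends the left spine of r to the topmost stack r1 on which x can be placed; l
    collects the rests passed on the way, lowest order first. *)
Lemma scons_foldl x r s : scons x r = Some s -> exists r1 l,
  [/\ r = foldl SCons r1 l, s = foldl SCons (SCons x r1) l & order r1 = (order x).+1].
Proof.
elim: r s => [a u _|k|r1 IH r2 _] s //=; case: ifP => // /eqP E.
- by case=> <-; exists (SEmpty k), [::].
- by case=> <-; exists (SCons r1 r2), [::].
case Er: (scons x r1) => [s1|] //= [<-].
have [r0 [l [-> -> E0]]] := IH _ Er.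
by exists r0, (rcons l r2); rewrite !foldl_rcons.
Qed.

Definition levels k l := map order l == iota k.+1 (size l).

Lemma levels_cons k a l : levels k (a :: l) = (order a == k.+1) && levels k.+1 l.
Proof. by rewrite /levels /= eqseq_cons. Qed.

Lemma levels_cat k l l' : levels k (l ++ l') = levels k l && levels (k + size l) l'.
Proof.
elim: l k => [|a l IH] k /=; first by rewrite addn0.
by rewrite !levels_cons IH andbA addSnnS.
Qed.

Lemma order_foldl v l : levels (order v) l -> order (foldl SCons v l) = order v + size l.
Proof.
elim: l v => [|a l IH] v; rewrite /= ?addn0 // levels_cons => /andP[/eqP Ea Hl].
by rewrite IH /= Ea // addSnnS.
Qed.

Lemma foldl_scons x r l : order r = (order x).+1 -> levels (order r) l ->
  scons x (foldl SCons r l) = Some (foldl SCons (SCons x r) l).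
Proof.
move=> E; elim/last_ind: l => [|l a IH].
  by case: r E => [b u|k|r1 r2] //= E _; rewrite E eqxx.
rewrite -cats1 levels_cat levels_cons => /andP[Hl /andP[/eqP Ea _]].
rewrite cats1 !foldl_rcons /= Ea IH //= ifF //; apply/eqP; lia.
Qed.

Lemma scons_seq_foldl v l : levels (order v) l -> scons_seq v l = Some (foldl SCons v l).
Proof.
elim: l v => //= a l IH v; rewrite levels_cons => /andP[/eqP Ea Hl].
by rewrite IH ?Ea //= foldl_scons ?Ea.
Qed.

Lemma foldl_SCons_inj v l v' l' : size l = size l' ->
  foldl SCons v l = foldl SCons v' l' -> v = v' /\ l = l'.
Proof.
elim/last_ind: l l' => [|l a IH] l'; case/lastP: l' => [|l' b] //; rewrite ?size_rcons //.
by case=> E; rewrite !foldl_rcons => -[/(IH _ E)[-> ->] ->].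
Qed.

Section View.
Variables (n : nat) (Sigma : seq nat).
Notation wf := (stack_wf n Sigma).
Notation is_stk := (is_stack n Sigma).

Lemma wf_order s : wf s -> order s <= n.
Proof. by elim: s => [a u|k /andP[]|s1 _ s2 IH /and3P[_ _ /IH]]. Qed.

Lemma is_stackE k s : is_stk k s = [&& 0 < k, order s == k & wf s].
Proof.
rewrite /is_stack; case: eqP => [<-|_]; last by rewrite !andbF.
by case Hw: (wf s); rewrite ?andbF // (wf_order Hw) !andbT.
Qed.

Lemma foldl_wf v l : wf (foldl SCons v l) = [&& wf v, levels (order v) l & all wf l].
Proof.
elim: l v => [|a l IH] v /=; first by rewrite andbT.
rewrite IH /= levels_cons; case: eqP => [->|_] /=; last by rewrite andbF.
by case: (wf v) (wf a) (levels _ l) => [] [] [].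
Qed.

Definition head_ok j (h : option (nat * (nat * stack))) : bool :=
  match h with
  | None => 0 < j
  | Some (a, (k, u)) => [&& j == 0, a \in Sigma & is_stk k u]
  end.

Notation hv := (hval SChar SEmpty).

Definition view h l s : Prop :=
  [/\ size l <= n, head_ok (n - size l) h, levels (n - size l) l, all wf l &
      s = foldl SCons (hv (n - size l) h) l ].

Lemma view_wf h l s : 0 < n -> view h l s -> is_stk n s.
Proof.
move=> Hn [Hl Hh Hlv Hw ->]; rewrite is_stackE Hn foldl_wf Hw andbT /=.
have [Eo Ew] : order (hv (n - size l) h) = n - size l /\ wf (hv (n - size l) h).
  case: h Hh => [[a [k u]]|] /=; last by move=> *; split => //; lia.
  case/and3P=> /eqP-> -> Hu; split => //=.
  by case/and3P: Hu => /andP[Hk _] /eqP-> ->; rewrite Hk.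
by rewrite order_foldl Eo ?Ew ?Hlv ?andbT //; apply/eqP; lia.
Qed.

Lemma decomp x : wf x -> exists h l, [/\ size l <= order x,
  head_ok (order x - size l) h, levels (order x - size l) l, all wf l &
  x = foldl SCons (hv (order x - size l) h) l].
Proof.
elim: x => [a u _|k|s1 IH s2 _] /=.
- case/and3P=> Ha Hu Hw; exists (Some (a, (order u, u))), [::].
  by split => //=; rewrite Ha is_stackE Hu eqxx.
- by move=> Hk; exists None, [::]; split => //=; rewrite subn0; case/andP: Hk.
case/and3P=> /eqP Eo H1 H2; have [h [l [Hl Hh Hlv Hw E]]] := IH H1.
exists h, (rcons l s2); rewrite size_rcons Eo subSS; split => //.
- by rewrite -cats1 levels_cat Hlv levels_cons Eo subnK // eqxx.
- by rewrite all_rcons H2.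
by rewrite foldl_rcons -E.
Qed.

Lemma view_exists s : is_stk n s -> exists h l, view h l s.
Proof.
by rewrite is_stackE => /and3P[_ /eqP Eo /decomp]; rewrite Eo.
Qed.

Lemma drop_cat_S (T : Type) (x : T) s t : drop (size s).+1 (s ++ x :: t) = t.
Proof. by rewrite -cat_rcons -(size_rcons s x) drop_size_cat. Qed.

Notation opf := (op_fun SChar cns_stack SEmpty n).

Lemma view_char a u l : size l = n -> wf (foldl SCons (SChar a u) l) ->
  [/\ a \in Sigma, is_stk (order u) u, levels 0 l & all wf l].
Proof. by move=> E; rewrite foldl_wf /= is_stackE eqxx => /and3P[/and3P[-> -> ->] -> ->]. Qed.

Lemma foldl_order v l : wf (foldl SCons v l) -> order (foldl SCons v l) = order v + size l.
Proof. by rewrite foldl_wf => /and3P[_ H _]; apply: order_foldl. Qed.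

(** The semantics splits s at the order that the operation concerns. For push_k and pop_k the part
    above the split is split further by [decomp], which gives the complete spine on which [op_fun]
    acts. *)
Lemma op_sem_view o s s' : in_Ops n Sigma o -> is_stk n s -> stack_op_sem n o s s' ->
  exists h l, view h l s /\ opf (Some o) h l = [:: s'].
Proof.
rewrite is_stackE => Ho /and3P[Hn /eqP Es Hw].
case: o Ho => [a b|k|k|k|k] /= Ho.
- move=> [u [r [/scons_foldl[r1 [l [Er E Eo]]] E']]]; subst r s.
  have Sl : size (r1 :: l) = n by rewrite -Es (foldl_order (l := r1 :: l)).
  have [Ha Hu Hlv Hwl] := view_char Sl Hw.
  exists (Some (a, (order u, u))), (r1 :: l); split.
    by rewrite /view Sl subnn; split => //=; rewrite Ha.
  rewrite /op_fun /= eqxx plug_stack; congr [:: _]; apply: Some_inj; rewrite -E'.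
  by rewrite foldl_scons //; move: Hlv; rewrite levels_cons Eo => /andP[].
- move=> [a [u [l [Hlv]]]]; have Sl : size l = n by rewrite -(size_map order) Hlv size_iota.
  rewrite scons_seq_foldl; last by rewrite /levels /= Hlv Sl.
  case=> E; subst s; have [Ha Hu Hlv' Hwl] := view_char Sl Hw.
  case: l Sl Hlv Hlv' Hwl Hw Es => [|l1 l] Sl Hlv Hlv' Hwl Hw Es; first by move: Hn; rewrite -Sl.
  move=> E'; exists (Some (a, (order u, u))), (l1 :: l); split.
    by rewrite /view Sl subnn; split => //=; rewrite Ha.
  rewrite /op_fun [so_arg _]/= [so_tag _]/= /= !plug_stack; congr [:: _]; apply: Some_inj; rewrite -E'.
  move: Hlv'; rewrite levels_cons => /andP[/eqP El Hlv'].
  have Hl1 : levels (order l1) l by rewrite El.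
  rewrite (foldl_scons (r := SCons (SChar a u) l1)) //=.
  (* Only the default differs, and entry k - 1 exists because k <= n. *)
  suff -> : nth (SEmpty 0) (l1 :: l) k.-1 = nth u (l1 :: l) k.-1 by [].
  apply: set_nth_default; rewrite Sl; lia.
- move=> [x [r [Ex /scons_foldl[r1 [l [_ E Eo]]]]]]; subst s.
  have Hl1 : levels (order x) (r1 :: l) by move: (Hw); rewrite (foldl_wf x (r1 :: l)) => /and3P[].
  have Hl : levels (order r1) l by move: Hl1; rewrite levels_cons Eo eqxx.
  rewrite (foldl_scons (r := SCons x r1)) // => -[<-].
  have Hx : wf x by move: (Hw); rewrite (foldl_wf x (r1 :: l)) => /and3P[].
  have [h [lx [Hlx Hh Hlvx Hwx EX]]] := decomp Hx.
  have Sl : order x + (size l).+1 = n by rewrite -Es (foldl_order (v := x) (l := r1 :: l)).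
  have Sj : n - size (lx ++ r1 :: l) = order x - size lx by rewrite size_cat /=; lia.
  have Hlk : k.-1 - (order x - size lx) = size lx by lia.
  exists h, (lx ++ r1 :: l); split.
    rewrite /view Sj; split => //; first by rewrite size_cat /=; lia.
    - by rewrite levels_cat Hlvx subnK.
    - by rewrite all_cat Hwx /=; move: Hw; rewrite (foldl_wf x (r1 :: l)) => /and3P[].
    by rewrite foldl_cat -EX.
  rewrite /op_fun [so_arg _]/= [so_tag _]/= /= Sj Hlk take_size_cat // nth_cat ltnn subnn !plug_stack -EX.
  have -> : k - (order x - size lx) = (size lx).+1 by lia.
  by rewrite drop_cat_S /= ifT //; lia.
- move=> [x [Ex /scons_foldl[r1 [l [E' E Eo]]]]]; subst s s'.
  have Hl1 : levels (order x) (r1 :: l) by move: (Hw); rewrite (foldl_wf x (r1 :: l)) => /and3P[].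
  have Hx : wf x by move: (Hw); rewrite (foldl_wf x (r1 :: l)) => /and3P[].
  have [h [lx [Hlx Hh Hlvx Hwx EX]]] := decomp Hx.
  have Sl : order x + (size l).+1 = n by rewrite -Es (foldl_order (v := x) (l := r1 :: l)).
  have Sj : n - size (lx ++ r1 :: l) = order x - size lx by rewrite size_cat /=; lia.
  have Hlk : k.-1 - (order x - size lx) = size lx by lia.
  exists h, (lx ++ r1 :: l); split.
    rewrite /view Sj; split => //; first by rewrite size_cat /=; lia.
    - by rewrite levels_cat Hlvx subnK.
    - by rewrite all_cat Hwx /=; move: Hw; rewrite (foldl_wf x (r1 :: l)) => /and3P[].
    by rewrite foldl_cat -EX.
  rewrite /op_fun [so_arg _]/= [so_tag _]/= /= Sj Hlk nth_cat ltnn subnn !plug_stack.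
  have -> : k - (order x - size lx) = (size lx).+1 by lia.
  by rewrite drop_cat_S /= ifT //; lia.
case: ltnP => Hk.
  move=> [a [u [s1 [s2 [w [Eu Es1 /scons_foldl[r1 [l [E2 Ew Eo]]] Es' E']]]]]]; subst s2 w.
  have /scons_foldl[q [l' [Eq E Eoq]]] := Es'; subst s.
  have Sl : size (q :: l') = n by rewrite -Es (foldl_order (v := SChar a u) (l := q :: l')).
  have [Ha Hu Hlv' Hwl] := view_char (l := q :: l') Sl Hw.
  exists (Some (a, (order u, u))), (q :: l'); split.
    by rewrite /view Sl subnn; split => //=; rewrite Ha.
  rewrite /op_fun [so_arg _]/= [so_tag _]/= /= Eu eqxx plug_stack; congr [:: _].
  have Hww : wf (foldl SCons q l').
    by rewrite foldl_wf; move: Hlv' Hwl; rewrite levels_cons /= => /andP[/eqP-> ->] /andP[-> ->].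
  have := Hww; rewrite -Eq (foldl_wf (SCons s1 r1)) => /and3P[_ /= Hlvr _].
  have Sl' : size l = n - k.+1.
    have := foldl_order Hww; rewrite -Eq (order_foldl (v := SCons s1 r1)) //= Eo Es1 Eoq /=.
    by move: Sl => /=; lia.
  have Sd : size (drop k.-1 l') = (n - k.+1).+1 by rewrite size_drop; move: Sl => /=; lia.
  have Ed : drop k (q :: l') = drop k.-1 l' by case: k Ho {Hk Es1 Eu Sl' Sd Eo}.
  (* The stack w has two spines, one from s1 and r1, one from q. Compared from order k + 1 upwards
     they have the same length, so r1 and l are the end of l'. *)
  rewrite Ed; move: Eq; rewrite -{1}(cat_take_drop k.-1 l') foldl_cat.
  case: (drop k.-1 l') Sd => [|z l''] //= [Sd] /foldl_SCons_inj[|[_ <-] <-]; first by rewrite Sl' Sd.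
  by move: E'; rewrite foldl_scons // ?Eu ?Eo ?Es1 // => -[].
move=> [a [r [Eo /scons_foldl[q [l' [Eq E Eoq]]]]]]; subst s.
have Sl : size (q :: l') = n by rewrite -Es (foldl_order (v := SChar a s') (l := q :: l')).
have [Ha Hu Hlv' Hwl] := view_char (l := q :: l') Sl Hw.
have Ek : k = n by lia.
exists (Some (a, (n, s'))), (q :: l'); split.
  rewrite /view Sl subnn; split => //=; rewrite Ha; by move: Hu; rewrite Eo.
rewrite /op_fun [so_arg _]/= [so_tag _]/= /= Ek eqxx.
by have -> : drop n (q :: l') = [::] by rewrite drop_oversize ?Sl.
Qed.

Lemma view_op_sem o h l s s' : 0 < n -> in_Ops n Sigma o -> view h l s ->
  opf (Some o) h l = [:: s'] -> stack_op_sem n o s s'.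
Proof.
move=> Hn Ho [Hl Hh Hlv Hw ->]; rewrite /op_fun.
case: o Ho => [a b|k|k|k|k] /= Ho.
- case: h Hh => [[a' [k' u]]|] //= /and3P[/eqP Ej Ha Hu]; case: eqP => // <- [<-].
  rewrite plug_stack; case: l Hl Ej Hlv Hw => [|r1 l] Hl Ej Hlv Hw; first by move: Ej => /=; lia.
  move: Hlv; rewrite Ej levels_cons => /andP[/eqP E1 Hlv].
  by exists u, (foldl SCons r1 l); rewrite !foldl_scons ?E1.
- case: h Hh => [[a' [k' u]]|] //= /and3P[/eqP Ej Ha Hu] [<-].
  have Sl : size l = n by lia.
  exists a', u, l; move: (Hlv); rewrite Ej => Hlv0; split.
  + by rewrite -Sl; apply/eqP.
  + by rewrite scons_seq_foldl.
  rewrite !plug_stack; case: l Sl Hlv0 {Hl Ej Hlv Hw} => [|r1 l] Sl Hlv; first by move: Sl Hn => /= <-.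
  move: Hlv; rewrite levels_cons => /andP[/eqP E1 Hlv].
  rewrite /= (foldl_scons (r := SCons (SChar a' u) r1)) //= ?E1 //.
  suff -> : nth (SEmpty 0) (r1 :: l) k.-1 = nth u (r1 :: l) k.-1 by [].
  by apply: set_nth_default; rewrite Sl; lia.
- case: ifP => // Hjk [<-]; rewrite !plug_stack; set j := n - size l in Hh Hlv Hjk *.
  have Hm : k.-1 - j < size l by lia.
  have Ed := drop_nth (SEmpty 0) Hm; have Em : (k.-1 - j).+1 = k - j by lia.
  have := Hlv; rewrite -{1}(cat_take_drop (k.-1 - j) l) levels_cat Ed Em => /andP[Hl1].
  rewrite levels_cons size_takel; last by lia.
  have -> : j + (k.-1 - j) = k.-1 by lia.
  have -> : k.-1.+1 = k by lia.
  case/andP=> /eqP Er Hl2.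
  have Eh : order (hv j h) = j.
    by case: h Hh => [[a [k' u]]|] //= /and3P[/eqP-> _ _].
  have Ex : order (foldl SCons (hv j h) (take (k.-1 - j) l)) = k.-1.
    by rewrite order_foldl Eh ?size_takel //; lia.
  exists (foldl SCons (hv j h) (take (k.-1 - j) l)), (foldl SCons (nth (SEmpty 0) l (k.-1 - j)) (drop (k - j) l)).
  have Ek : k.-1.+1 = k by lia.
  split => //; first by rewrite foldl_scons ?Er ?Ex ?Ek // -[in RHS](cat_take_drop (k.-1 - j) l) foldl_cat Ed Em.
  rewrite -{2}(cat_take_drop (k.-1 - j) l) Ed Em foldl_cat /=.
  by rewrite (foldl_scons (r := SCons _ (nth _ _ _))) //= ?Er ?Ex ?Ek.
- case: ifP => // Hjk [<-]; rewrite !plug_stack; set j := n - size l in Hh Hlv Hjk *.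
  have Hm : k.-1 - j < size l by lia.
  have Ed := drop_nth (SEmpty 0) Hm; have Em : (k.-1 - j).+1 = k - j by lia.
  have := Hlv; rewrite -{1}(cat_take_drop (k.-1 - j) l) levels_cat Ed Em => /andP[Hl1].
  rewrite levels_cons size_takel; last by lia.
  have -> : j + (k.-1 - j) = k.-1 by lia.
  have -> : k.-1.+1 = k by lia.
  case/andP=> /eqP Er Hl2.
  have Eh : order (hv j h) = j.
    by case: h Hh => [[a [k' u]]|] //= /and3P[/eqP-> _ _].
  have Ex : order (foldl SCons (hv j h) (take (k.-1 - j) l)) = k.-1.
    by rewrite order_foldl Eh ?size_takel //; lia.
  exists (foldl SCons (hv j h) (take (k.-1 - j) l)); split => //.
  have Ek : k.-1.+1 = k by lia.
  by rewrite foldl_scons ?Er ?Ex ?Ek // -[in RHS](cat_take_drop (k.-1 - j) l) foldl_cat Ed Em.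
case: h Hh => [[a' [k' u]]|] //= /and3P[/eqP Ej Ha Hu]; case: eqP => // E [<-]; subst k'.
have Sl : size l = n by lia.
have Ou : order u = k by move: Hu; rewrite is_stackE => /and3P[_ /eqP].
rewrite plug_stack; case: l Sl Hlv Hw {Hl} Ej => [|r1 l] Sl Hlv Hw Ej; first by move: Sl Hn => /= <-.
move: Hlv; rewrite Ej levels_cons => /andP[/eqP E1 Hlv]; move: Sl => /= Sl.
have Hk0 : 0 < k by lia.
have Ed' : drop k (r1 :: l) = drop k.-1 l by case: (k) Hk0.
rewrite Ed'; case: ltnP => Hk.
  have Hm : k.-1 < size l by lia.
  have Ed := drop_nth (SEmpty 0) Hm; rewrite prednK // in Ed.
  have := Hlv; rewrite -{1}(cat_take_drop k.-1 l) levels_cat Ed => /andP[Hl1].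
  rewrite levels_cons size_takel; last by lia.
  rewrite add1n prednK // => /andP[/eqP Er Hl2].
  have E2 : order (foldl SCons r1 (take k.-1 l)) = k.
    by rewrite order_foldl E1 ?size_takel //; lia.
  exists a', u, (foldl SCons r1 (take k.-1 l)), (foldl SCons (nth (SEmpty 0) l k.-1) (drop k l)), (foldl SCons r1 l).
  split=> //.
  - by rewrite foldl_scons ?Er ?E2 // -[in RHS](cat_take_drop k.-1 l) foldl_cat Ed.
  - by rewrite foldl_scons ?E1.
  by rewrite foldl_scons ?Er ?Ou ?Ed.
have Ek : k = n by lia.
rewrite drop_oversize /=; last by lia.
by exists a', (foldl SCons r1 l); rewrite foldl_scons ?E1 // Ou Ek.
Qed.

Lemma op_sem_wf o s s' : in_Ops n Sigma o -> is_stk n s -> stack_op_sem n o s s' -> is_stk n s'.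
Proof.
move=> Ho Hs H; have [h [l [[Hl Hh Hlv Hw _] E]]] := op_sem_view Ho Hs H.
(* Typing is a unary property; as a binary relation that ignores its second argument it becomes an
   instance of parametricity. *)
pose R k (v v' : stack) := order v = k /\ wf v.
have [] := @op_fun_rel n Sigma _ SChar cns_stack SEmpty _ SChar cns_stack SEmpty R _ _ _ (Some o) h h l l.
- by move=> a k u d Ha Hk [Eu Wu]; split=> //=; rewrite Ha Eu Wu; case/andP: Hk => ->.
- by move=> k v d v' d' Hk [Ev Wv] [Ev' Wv']; split=> //=; rewrite Ev Ev' Wv Wv' eqxx.
- by move=> k Hk; split.
- by [].
- by [].
- case: h Hh {E} => [[a [k u]]|] //= /and3P[/eqP-> Ha]; rewrite is_stackE => /and3P[Hk /eqP Eu Wu].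
  by split=> //; split=> //; rewrite Hk -Eu; apply: wf_order.
- elim: l (n - size l) Hlv Hw {Hl Hh E} => //= a l IH k; rewrite levels_cons.
  by case/andP=> /eqP Ea Hl /andP[Wa Hw]; split; [split | apply: IH].
- by case; rewrite E.
case=> v1 [v2 [E1 _ [Eo Wo]]]; move: E1; rewrite E => -[->]; rewrite is_stackE Eo Wo eqxx.
by move: Hs; rewrite is_stackE => /andP[->].
Qed.
End View.

(** * Saturation *)

Lemma filter_mem_filter (T : eqType) (p : pred T) (U : seq T) :
  filter (mem (filter p U)) U = filter p U.
Proof. by apply: eq_in_filter => x Hx /=; rewrite mem_filter Hx andbT. Qed.

Lemma count_filter_eq (T : eqType) (p q : pred T) (U : seq T) :
  (forall x, p x -> q x) -> count q U <= count p U -> filter p U = filter q U.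
Proof.
move=> pq; have Hc U' : count p U' <= count q U' by apply: sub_count.
elim: U => //= x U IH; have := pq x; case: (p x) => [->//|_]; first by move=> Hle; rewrite IH.
by case: (q x) => /= Hle; [have := Hc U; lia | apply: IH].
Qed.

(** The disjunct [t \in S] makes the iterates increase, whatever p is. As long as they do not
    stabilise, each gains an element of U, so [size U] rounds suffice. *)
Lemma iter_filter_fix (T : eqType) (U : seq T) (p : seq T -> pred T) :
  let F S := filter (fun t => (t \in S) || p S t) U in
  F (iter (size U) F [::]) = iter (size U) F [::].
Proof.
move=> F; pose X i := iter i F [::].
have XE i : X i = filter (mem (X i)) U.
  case: i => [|i]; first by rewrite /X /=; elim: (U) => //= a V <-.
  by rewrite -[X i.+1]/(F (X i)) filter_mem_filter.
have XU i : size (X i) <= size U by rewrite XE size_filter count_size.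
have Hstep i : size (X i.+1) <= size (X i) -> F (X i) = X i.
  rewrite -[X i.+1]/(F (X i)) [in X in _ <= X]XE !size_filter => H.
  by rewrite [in RHS]XE; apply/esym; apply: count_filter_eq H => t /= ->.
suff H i : i <= size (X i) \/ F (X i) = X i.
  case: (H (size U)) => // Hle; apply: Hstep.
  exact: leq_trans (XU _) Hle.
elim: i => [|i [IH|IH]]; first by left.
  case: (leqP (size (X i.+1)) (size (X i))) => [/Hstep E|Hlt]; last by left; apply: leq_ltn_trans Hlt.
  by right; rewrite -[X i.+1]/(F (X i)) !E.
by right; rewrite -[X i.+1]/(F (X i)) !IH.
Qed.

(* States of order k are data: base states carry the tag [dnil]; the state
   [st x [:: d_{k+1}; ...; d_n]], for a name x and sets d_i of states of order
   i, stands for "the stacks s with s :_{k+1} s_{k+1} ... :_n s_n in x for all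
   s_i accepted from every state in d_i". *)
Definition isb (z : data) := dfst z == dnil.
Definition st (x : data) (l : seq (seq data)) : data := dcons (dcons dnil (enc l)) x.
Definition stv (v : data * seq (seq data)) := st v.1 v.2.

Lemma st_inj x l x' l' : st x l = st x' l' -> x = x' /\ l = l'.
Proof. by case=> E ->; split => //; apply: (enc_seq_inj (enc_seq_inj (@inj_id _))) E. Qed.
Lemma isb_st x l : isb (st x l) = false.
Proof. by []. Qed.

(* A fact (v, None) lets the state [stv v], of order n - size v.2, accept the
   empty stack; a fact (v, Some (a, (k, X))), for [stv v] of order 0, lets it
   read a with an annotation of order k accepted from every state in X. *)
Definition fact := ((data * seq (seq data)) * option (nat * (nat * seq data)))%type.

Section Engine.
Variables (n : nat) (Sigma : seq nat).
(* A base automaton: states, transitions and final states of order k; the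
   states of order 0, given by [bC], read a single annotated character. *)
Variables (bU : nat -> seq data) (bD : nat -> seq (data * (data * seq data)))
  (bF : nat -> seq data) (bC : seq (data * (nat * seq data))).
Variables (names : seq data) (rules : seq (data * (option stack_op * seq data))).

(* [V f]: the pairs (x, l) with [st x l] of order n - f. *)
Definition Vpair (f : nat) : nat * seq (data * seq (seq data)) :=
  iter f (fun p => (p.1.+1,
    flatten [seq [seq (v.1, d :: v.2) | d <- sublists (bU (n - p.1) ++ map stv p.2)] | v <- p.2]))
  (0, [seq (x, [::]) | x <- names]).
Definition V f := (Vpair f).2.
(** All states of order k. Since V (f + 1) is built from the states of order n - f, which contain V
    f, [Vpair] inlines this union and carries f along. *)
Definition UU k := bU k ++ map stv (V (n - k)).
(** A quotient by l reads s :_k s' by guessing a set d for s' and passing to the quotient by d :: l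
    for s. One transition for every guess is present from the outset and never changes. *)
Definition delta k : seq (data * (data * seq data)) :=
  bD k ++ flatten [seq [seq (stv v, (st v.1 (d :: v.2), d)) | d <- sublists (UU k)] | v <- V (n - k)].

Definition univ : seq fact :=
  flatten [seq [seq (v, None) | v <- V f] | f <- iota 0 n] ++
  flatten [seq flatten [seq flatten [seq [seq (v, Some (a, (k, X))) | X <- sublists (UU k)]
    | k <- iota 1 n] | a <- Sigma] | v <- V n].

Definition fin (Th : seq fact) k : seq data :=
  bF k ++ [seq stv t.1 | t <- Th & ~~ isSome t.2 && (size t.1.2 == n - k)].
Definition chars (Th : seq fact) : seq (data * (nat * seq data)) :=
  bC ++ [seq (stv t.1, ((odflt (0, (0, [::])) t.2).1, (odflt (0, (0, [::])) t.2).2.2))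
        | t <- Th & isSome t.2].
(** From the sets of states accepting the two parts of a stack, the set accepting the whole.
    Together with [achar] and [fin] this gives the algebra of sets of states in which [op_fun] is
    executed symbolically. *)
Definition acons_of (D : seq (data * (data * seq data))) (d1 d2 : seq data) : seq data :=
  [seq t.1 | t <- D & (t.2.1 \in d1) && all (fun z => z \in d2) t.2.2].
Definition acons k := acons_of (delta k).
Definition achar_of (C : seq (data * (nat * seq data))) (a : nat) (d : seq data) : seq data :=
  [seq c.1 | c <- C & (c.2.1 == a) && all (fun z => z \in d) c.2.2].
Definition achar Th := achar_of (chars Th).

(** The chain and the head of a fact form a symbolic stack whose components are sets of states. The
    fact follows from a rule for its name if the operation takes this symbolic stack to a set that
    contains all of Y. *)
Definition derivable (Th : seq fact) (t : fact) : bool :=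
  has (fun r => (r.1 == t.1.1) && has (fun D => all (fun y => y \in D) r.2.2)
         (op_fun (achar Th) acons (fin Th) n r.2.1 t.2 t.1.2)) rules.
Definition sat : seq fact :=
  iter (size univ) (fun Th => [seq t <- univ | (t \in Th) || derivable Th t]) [::].

Fixpoint den (Th : seq fact) (s : stack) : seq data :=
  match s with
  | SChar a u => achar Th a (den Th u)
  | SEmpty k => fin Th k
  | SCons s1 s2 => acons (order s2) (den Th s1) (den Th s2)
  end.

Fixpoint bden (s : stack) : seq data :=
  match s with
  | SChar a u => achar_of bC a (bden u)
  | SEmpty k => bF k
  | SCons s1 s2 => acons_of (bD (order s2)) (bden s1) (bden s2)
  end.

Definition opsem (oo : option stack_op) (s s' : stack) : Prop :=
  if oo is Some o then stack_op_sem n o s s' else s' = s.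

Inductive sem : data -> stack -> Prop :=
| sem_base z s : isb z -> z \in bden s -> sem z s
| sem_rule x oo Y s s' : is_stack n Sigma n s -> x \in names -> (x, (oo, Y)) \in rules ->
    opsem oo s s' -> (forall y, y \in Y -> sem y s') -> sem (st x [::]) s.

Hypothesis n_gt0 : 0 < n.
Hypothesis bUb : forall k z, z \in bU k -> isb z.
Hypothesis bU_disj : forall j k z, 0 < j <= n -> 0 < k <= n -> z \in bU j -> z \in bU k -> j = k.
Hypothesis bFU : forall k, 0 < k <= n -> {subset bF k <= bU k}.
Hypothesis bDU : forall k t, 0 < k <= n -> t \in bD k ->
  [/\ t.1 \in bU k, isb t.2.1, 1 < k -> t.2.1 \in bU k.-1 & {subset t.2.2 <= bU k}].
Hypothesis bCU : forall c, c \in bC ->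
  [/\ isb c.1, c.2.1 \in Sigma & exists k, 0 < k <= n /\ {subset c.2.2 <= bU k}].
Hypothesis rules_ok : forall x o Y, (x, (Some o, Y)) \in rules -> in_Ops n Sigma o /\ Y != [::].

Lemma VS f : V f.+1 =
  flatten [seq [seq (v.1, d :: v.2) | d <- sublists (bU (n - f) ++ map stv (V f))] | v <- V f].
Proof.
rewrite /V /Vpair iterS -/(Vpair f) /=.
suff -> : (Vpair f).1 = f by [].
by elim: f => //= f; rewrite {1}/Vpair => ->.
Qed.

Lemma mem_V0 v : (v \in V 0) = (v.1 \in names) && nilp v.2.
Proof.
case: v => x l; apply/mapP/andP => /= [[y Hy [-> ->]] //|[Hx /nilP->]]; by exists x.
Qed.

Lemma V_size f v : v \in V f -> size v.2 = f.
Proof.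
elim: f v => [|f IH] v; first by rewrite mem_V0 => /andP[_ /nilP->].
by rewrite VS => /flatten_mapP[w /IH Hw /mapP[d _ ->]] /=; rewrite Hw.
Qed.

Lemma V_names f v : v \in V f -> v.1 \in names.
Proof.
elim: f v => [|f IH] v; first by rewrite mem_V0 => /andP[].
by rewrite VS => /flatten_mapP[w /IH Hw /mapP[d _ ->]] /=.
Qed.

Lemma mem_VS f x d l : f <= n ->
  ((x, d :: l) \in V f.+1) = ((x, l) \in V f) && (d \in sublists (UU (n - f))).
Proof.
move=> Hf; have EU : UU (n - f) = bU (n - f) ++ map stv (V f) by rewrite /UU subKn.
rewrite VS EU; apply/flatten_mapP/andP => [[[y m] Hw /mapP[d' Hd [-> -> ->]]] //|[Hv Hd]].
by exists (x, l) => //; apply/mapP; exists d.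
Qed.

Lemma UU_disj j k z : 0 < j <= n -> 0 < k <= n -> z \in UU j -> z \in UU k -> j = k.
Proof.
move=> Hj Hk; rewrite !mem_cat => /orP[Bj|/mapP[v Hv ->]] /orP[Bk|/mapP[w Hw E]].
- exact: bU_disj Bj Bk.
- by move/bUb: Bj; rewrite E isb_st.
- by move/bUb: Bk; rewrite isb_st.
by have [_] := st_inj E => /(congr1 size); rewrite (V_size Hv) (V_size Hw); lia.
Qed.

Lemma mem_delta k t : 0 < k <= n -> reflect
  (t \in bD k \/ exists x d l, [/\ (x, l) \in V (n - k), d \in sublists (UU k) & t = (st x l, (st x (d :: l), d))])
  (t \in delta k).
Proof.
move=> Hk; rewrite mem_cat; apply: (iffP orP) => -[H|H]; try by left.
  by right; case/flatten_mapP: H => -[x l] Hv /mapP[d Hd ->]; exists x, d, l.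
right; case: H => x [d [l [Hv Hd ->]]].
by apply/flatten_mapP; exists (x, l) => //; apply/mapP; exists d.
Qed.

Lemma delta_U k t : 0 < k <= n -> t \in delta k ->
  [/\ t.1 \in UU k, 1 < k -> t.2.1 \in UU k.-1 & {subset t.2.2 <= UU k}].
Proof.
move=> Hk /(mem_delta _ Hk)[/(bDU Hk)[H1 _ H2 H3]|[x [d [l [Hv Hd ->]]]]].
  split=> [|/H2|z /H3]; rewrite mem_cat ?H1 // => ->//.
split=> [|Hk1|]; last exact: sublists_sub.
  by rewrite mem_cat; apply/orP; right; apply/mapP; exists (x, l).
rewrite mem_cat; apply/orP; right; apply/mapP; exists (x, d :: l) => //.
have -> : n - k.-1 = (n - k).+1 by lia.
by rewrite mem_VS ?leq_subr // Hv subKn; case/andP: Hk.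
Qed.

Lemma mem_acons_of (D : seq (data * (data * seq data))) (d1 d2 : seq data) z : reflect
  (exists r1 X, [/\ (z, (r1, X)) \in D, r1 \in d1 & {subset X <= d2}]) (z \in acons_of D d1 d2).
Proof.
apply: (iffP mapP) => [[[y [r1 X]]]|[r1 [X [H H1 H2]]]].
  by rewrite mem_filter => /andP[/andP[/= H1 /allP H2] H3] ->; exists r1, X.
by exists (z, (r1, X)) => //; rewrite mem_filter H /= H1 /= andbT; apply/allP.
Qed.

Lemma mem_achar_of (C : seq (data * (nat * seq data))) a (d : seq data) z : reflect
  (exists X, (z, (a, X)) \in C /\ {subset X <= d}) (z \in achar_of C a d).
Proof.
apply: (iffP mapP) => [[[y [b X]]]|[X [H H1]]].
  by rewrite mem_filter => /andP[/andP[/= /eqP-> /allP H2] H3] ->; exists X.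
by exists (z, (a, X)) => //; rewrite mem_filter H /= eqxx /= andbT; apply/allP.
Qed.

Lemma mem_fin Th k z : reflect
  (z \in bF k \/ exists v, [/\ (v, None) \in Th, size v.2 = n - k & z = stv v]) (z \in fin Th k).
Proof.
rewrite mem_cat; apply: (iffP orP) => -[H|H]; try by left.
  right; case/mapP: H => -[v h]; rewrite mem_filter => /andP[/= /andP[Hh /eqP Hs] H ->].
  by exists v; split=> //; move: Hh H; case: h.
by right; case: H => v [H Hs ->]; apply/mapP; exists (v, None) => //; rewrite mem_filter H /= Hs eqxx.
Qed.

Lemma mem_chars Th z a X : reflect
  ((z, (a, X)) \in bC \/ exists v k, (v, Some (a, (k, X))) \in Th /\ z = stv v) ((z, (a, X)) \in chars Th).
Proof.
rewrite mem_cat; apply: (iffP orP) => -[H|H]; try by left.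
  right; case/mapP: H => -[v [[b [k Y]]|]]; rewrite mem_filter //= => H [-> -> ->].
  by exists v, k.
right; case: H => v [k [H ->]]; apply/mapP; exists (v, Some (a, (k, X))) => //.
by rewrite mem_filter H.
Qed.

Lemma mem_univ_None v : ((v, None) \in univ) = (size v.2 < n) && (v \in V (size v.2)).
Proof.
rewrite mem_cat; apply/orP/andP => [[|]|[H1 H2]].
- case/flatten_mapP=> f; rewrite mem_iota => Hf /mapP[w Hw [->]]; rewrite (V_size Hw); by split=> //; lia.
- by case/flatten_mapP=> w _ /flatten_mapP[a _ /flatten_mapP[k _ /mapP[X _]]].
by left; apply/flatten_mapP; exists (size v.2); [rewrite mem_iota; lia | apply/mapP; exists v].
Qed.

Lemma mem_univ_Some v a k X : ((v, Some (a, (k, X))) \in univ) =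
  [&& v \in V n, a \in Sigma, 0 < k <= n & X \in sublists (UU k)].
Proof.
rewrite mem_cat; apply/orP/and4P => [[|]|[H1 H2 H3 H4]].
- by case/flatten_mapP=> f _ /mapP[w Hw].
- case/flatten_mapP=> w Hw /flatten_mapP[b Hb /flatten_mapP[j Hj /mapP[Y HY [-> -> -> ->]]]].
  by split=> //; move: Hj; rewrite mem_iota; lia.
right; apply/flatten_mapP; exists v => //; apply/flatten_mapP; exists a => //.
apply/flatten_mapP; exists k; first by rewrite mem_iota; lia.
by apply/mapP; exists X.
Qed.

(* The intended meaning of the states of order n - f. *)
Fixpoint I (f : nat) (z : data) (s : stack) : Prop :=
  match f with
  | 0 => sem z s
  | m.+1 => (isb z /\ z \in bden s) \/
      exists x d l, z = st x (d :: l) /\ forall s2, is_stack n Sigma (n - m) s2 ->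
        (forall w, w \in d -> I m w s2) -> I m (st x l) (SCons s s2)
  end.

Lemma sem_isb z s : isb z -> sem z s -> z \in bden s.
Proof. by move=> Hz H; case: H Hz. Qed.

Lemma I_base f z s : isb z -> I f z s <-> z \in bden s.
Proof.
move=> Hz; case: f => [|f] /=; first by split=> [/(sem_isb Hz)|]; [|apply: sem_base].
by split=> [[[]//|[x [d [l [E]]]]]|]; [move: Hz; rewrite E isb_st | left].
Qed.

(** The logical relation of soundness: every state of d holds of s in the intended meaning. The
    guard 0 < k is there because base states of order 0 are given by [bC] and need not belong to
    [UU]. *)
Definition sound_at k (s : stack) (d : seq data) : Prop :=
  [/\ order s = k, stack_wf n Sigma s, 0 < k -> {subset d <= UU k} &
      forall z, z \in d -> I (n - k) z s].

(** The order k recorded in the fact is not imposed on u: an automaton transition with an empty set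
    reads annotations of every order, and the fact has to hold for all of them. *)
Definition fact_sound (t : fact) : Prop := t \in univ /\
  match t.2 with
  | None => I (size t.1.2) (stv t.1) (SEmpty (n - size t.1.2))
  | Some (a, (k, X)) => forall u, 0 < order u -> stack_wf n Sigma u ->
      (forall z, z \in X -> z \in UU (order u) /\ I (n - order u) z u) ->
      I n (stv t.1) (SChar a u)
  end.

(** * Soundness of the saturation *)

Section Soundness.
Variable Th : seq fact.
Hypothesis Th_sound : forall t, t \in Th -> fact_sound t.

Lemma sound_chr a k u d : a \in Sigma -> 0 < k <= n -> sound_at k u d ->
  sound_at 0 (SChar a u) (achar Th a d).
Proof.
move=> Ha Hk [Eu Wu Du Iu]; have Hk0 : 0 < k by case/andP: Hk.
split=> //=; first by rewrite Ha Eu Hk0.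
move=> z /mem_achar_of[X [/mem_chars[Hc|[v [j [Hf ->]]]] HX]]; rewrite subn0.
  have [/= Hb _ [j [Hj HXj]]] := bCU Hc; apply/I_base => //=.
  apply/mem_achar_of; exists X; split=> // w Hw; apply/(I_base (n - k)); first exact: bUb (HXj _ Hw).
  exact: Iu (HX _ Hw).
have [Hu /= H] := Th_sound Hf; apply: H; rewrite ?Eu // => w Hw; split; last by apply: Iu (HX _ Hw).
by apply: Du (HX _ Hw).
Qed.

Lemma sound_emp k : 0 < k <= n -> sound_at k (SEmpty k) (fin Th k).
Proof.
move=> Hk; split=> // [_|] z /mem_fin[Hb|[v [Hf Ev ->]]].
- by rewrite mem_cat (bFU Hk Hb).
- have [] := Th_sound Hf; rewrite mem_univ_None => /andP[_ Hv] _.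
  by rewrite mem_cat -Ev map_f ?orbT.
- by apply/I_base => //; apply: bUb (bFU Hk Hb).
have [_ /=] := Th_sound Hf; rewrite Ev.
by have -> : n - (n - k) = k by lia.
Qed.

Lemma sound_cns k v d v' d' : k < n -> sound_at k v d -> sound_at k.+1 v' d' ->
  sound_at k.+1 (SCons v v') (acons k.+1 d d').
Proof.
move=> Hk [Ev Wv Dv Iv] [Ev' Wv' Dv' Iv'].
have Hk1 : 0 < k.+1 <= n by [].
have HU t := @delta_U k.+1 t Hk1.
split=> //=; first by rewrite Ev Ev' eqxx Wv.
  by move=> _ z /mem_acons_of[r1 [X [/HU[]]]].
move=> z /mem_acons_of[r1 [X [/(mem_delta _ Hk1)[Hb|[x [e [l [Hv He [-> Er EX]]]]]] H1 H2]]].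
  have [/= Hz Hr _ HX] := bDU Hk1 Hb; apply/I_base; first exact: bUb Hz.
  rewrite /= Ev'; apply/mem_acons_of; exists r1, X; split=> // [|w Hw].
    by apply/I_base => //; apply: Iv.
  by apply/(I_base (n - k.+1)); [exact: bUb (HX _ Hw) | exact: Iv' (H2 _ Hw)].
(* The state read on v is the quotient extended by e; its meaning, applied to v', is membership of
   the longer stack in the shorter quotient. *)
have := Iv _ H1; have -> : n - k = (n - k.+1).+1 by lia.
rewrite Er; case=> [[]|[x' [e' [l' [E Hall]]]]] //.
have [Ex [Ee El]] := st_inj E; subst x' e' l'; apply: Hall.
  by have -> : n - (n - k.+1) = k.+1 by [lia]; rewrite is_stackE Ev' eqxx.
by rewrite -EX => w Hw; apply: Iv' (H2 _ Hw).
Qed.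

Lemma den_sound s : stack_wf n Sigma s -> sound_at (order s) s (den Th s).
Proof.
elim: s => [a u IH|k|s1 IH1 s2 IH2] /=.
- case/and3P=> Ha Hu Wu; apply: (sound_chr (k := order u)) => //; last exact: IH.
  by rewrite Hu; apply: wf_order Wu.
- exact: sound_emp.
case/and3P=> /eqP Eo W1 W2; rewrite Eo; apply: sound_cns.
- by have := wf_order W2; rewrite Eo.
- exact: IH1.
by rewrite -Eo; apply: IH2.
Qed.

(** Unrolls a quotient: its nested quantifications over one rest at a time amount to one
    quantification over all spines ss that match the chain l, ending in the name x itself. *)
Lemma I_plug f x l H : (x, l) \in V f -> f <= n ->
  (forall ss, rel_list sound_at (n - f) ss l -> sem (st x [::]) (foldl SCons H ss)) ->
  I f (st x l) H.
Proof.
elim: f l H => [|f IH] l H.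
  rewrite mem_V0 => /andP[_ /nilP/= ->] _ Hs; exact: (Hs [::]).
case: l => [/V_size//|d l]; move=> Hv Hf; move: Hv; rewrite mem_VS; last by lia.
case/andP=> Hv Hd Hs /=; right; exists x, d, l; split=> // s2 Hs2 Hw.
apply: IH => //; first by lia.
move=> ss Hss; apply: (Hs (s2 :: ss)) => /=.
have -> : (n - f.+1).+1 = n - f by lia.
split=> //; move: Hs2; rewrite is_stackE => /and3P[H0 /eqP Eo W]; split=> //.
  by move=> _; apply: sublists_sub Hd.
by rewrite subKn; last lia.
Qed.

Lemma op_fun_irrel (V : Type) (chr : nat -> V -> V) cns emp oo a k k' u l :
  (if oo is Some (Collapse _) then False else True) ->
  op_fun chr cns emp n oo (Some (a, (k, u))) l = op_fun chr cns emp n oo (Some (a, (k', u))) l.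
Proof. by case: oo => [[]|]. Qed.

Lemma acons_nil k d : acons k [::] d = [::].
Proof. by rewrite /acons /acons_of (eq_filter (a2 := pred0)) ?filter_pred0 // => t; rewrite in_nil. Qed.

Lemma plug_nil k (l : seq (seq data)) : plug acons k [::] l = [::].
Proof. by elim: l k => // d l IH k; rewrite plug_cons acons_nil IH. Qed.

Lemma op_fun_singleton (V : eqType) (chr : nat -> V -> V) cns emp oo h l D :
  D \in op_fun chr cns emp n oo h l -> op_fun chr cns emp n oo h l = [:: D].
Proof.
by rewrite /op_fun; repeat case: ifP => _; rewrite ?inE => // /eqP->.
Qed.

Lemma sound_levels k ss l : rel_list sound_at k ss l ->
  levels k ss /\ all (stack_wf n Sigma) ss.
Proof.
elim: ss k l => [|s ss IH] k [|d l] //= [[Eo W _ _] /IH[H1 H2]].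
by rewrite levels_cons Eo eqxx W.
Qed.

(** The symbolic stack of the fact is related to every concrete stack matching it, hence by
    parametricity so are the results; the concrete result lies in all members of Y, and the rule of
    [sem] applies. *)
Lemma derivable_sound t : t \in univ -> derivable Th t -> fact_sound t.
Proof.
case: t => -[x l] h Hu /hasP[[x' [oo Y]] Hr /= /andP[/eqP Ex /hasP[D HD /allP HY]]]; subst x'.
have ED := op_fun_singleton HD; clear HD.
(* The symbolic head h' may differ from h in the order of the annotation, which must be that of the
   concrete head h1. *)
have Hmain h1 h' : rel_head n Sigma sound_at (n - size l) h1 h' -> (x, l) \in V (size l) ->
    size l <= n -> op_fun (achar Th) acons (fin Th) n oo h' l = [:: D] ->
    I (size l) (st x l) (hval SChar SEmpty (n - size l) h1).
  move=> Hh Hv Hl ED'.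
  apply: I_plug => // ss Hss.
  have Es := rel_list_size Hss.
  have := op_fun_rel sound_chr (cns1 := cns_stack) sound_cns sound_emp
    (oo := oo) (h1 := h1) (h2 := h') (l1 := ss) (l2 := l).
  rewrite Es; case=> //.
  - by case: oo Hr {ED ED'} => // o /rules_ok[].
  - by case=> _; rewrite ED'.
  move=> [s' [D' [E1]]]; rewrite ED' => -[<-] [_ _ _ Hs'].
  have Hview : view n Sigma h1 ss (foldl SCons (hval SChar SEmpty (n - size l) h1) ss).
    have [H1 H2] := sound_levels Hss; rewrite /view Es; split=> //.
    case: h1 h' Hh {E1 ED'} => [[a [k u]]|] [[a' [k' X]]|] //= [-> _ -> _ [Hk [Eu Wu _ _]]].
    by rewrite is_stackE Eu Wu !eqxx; case/andP: Hk => ->.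
  have Hwf := view_wf n_gt0 Hview.
  apply: (sem_rule Hwf (V_names Hv) Hr (s' := s')); last first.
    by move=> y /HY/Hs'; rewrite subnn.
  case: oo Hr E1 {ED ED'} => [o|] Hr E1 /=; last first.
    by move: E1; rewrite /op_fun /= plug_stack Es => -[].
  by apply: view_op_sem Hview E1 => //; have [] := rules_ok Hr.
split=> //=; case: h Hu ED => [[a [k X]]|]; last first.
  rewrite mem_univ_None => /andP[/= Hl Hv] ED.
  by apply: (Hmain None None) => //=; lia.
rewrite mem_univ_Some => /and4P[Hv Ha Hk HX] ED u Hu Wu HI.
have Sl : size l = n := V_size Hv.
have := Hmain (Some (a, (order u, u))) (Some (a, (order u, X))); rewrite Sl subnn; apply=> //.
- have Hun := wf_order Wu.
  split=> //; split; first by rewrite Hu.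
  by split=> // [_ z|z] /HI[].
(* An empty X leaves the order of the annotation open. All operations but collapse ignore that
   order, and collapse would produce the empty set, which cannot contain the nonempty Y. A nonempty
   X fixes the order, since states of distinct orders are distinct. *)
case: X HX HI ED => [|z X] HX HI ED.
  clear Hmain; rewrite (op_fun_irrel _ _ _ _ _ k) //; case: oo Hr ED => [[]|] // j /rules_ok[_ HY0].
  rewrite /op_fun /=; case: eqP => // Ej [ED]; move: HY0 HY; rewrite -ED plug_nil.
  by case: (Y) => // y Y' _ /(_ y); rewrite mem_head in_nil => /(_ isT).
have [Hz _] := HI _ (mem_head _ _).
have <- // : k = order u.
apply: (@UU_disj _ _ z) => //; first by rewrite Hu; apply: wf_order Wu.
by apply: (sublists_sub HX); apply: mem_head.
Qed.

End Soundness.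

Lemma sat_sound t : t \in sat -> fact_sound t.
Proof.
rewrite /sat; elim: (size univ) t => //= m IH t.
rewrite mem_filter => /andP[/orP[/IH//|Hd] Hu].
by apply: derivable_sound Hd.
Qed.

Lemma sat_closed t : t \in univ -> derivable sat t -> t \in sat.
Proof.
move=> Hu Hd; rewrite /sat -iter_filter_fix mem_filter Hu andbT; apply/orP; right; exact: Hd.
Qed.

(** * Completeness of the saturation *)

Lemma bden_den Th s : {subset bden s <= den Th s}.
Proof.
elim: s => [a u IH|k|s1 IH1 s2 IH2] z /=.
- case/mem_achar_of=> X [Hc HX]; apply/mem_achar_of; exists X.
  by split=> [|w /HX/IH//]; rewrite mem_cat Hc.
- by rewrite mem_cat => ->.
case/mem_acons_of=> r1 [X [Hd H1 HX]]; apply/mem_acons_of; exists r1, X.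
by split=> [||w /HX/IH2//]; [rewrite mem_cat Hd | apply: IH1].
Qed.

(* Taking for d_i all the states that accept s_i makes the operation on sets
   of states yield at least the states accepting the resulting stack. *)
Fixpoint dens (Th : seq fact) k (ss : seq stack) : seq (seq data) :=
  if ss is s :: ss' then [seq z <- UU k.+1 | z \in den Th s] :: dens Th k.+1 ss' else [::].

Lemma size_dens Th k ss : size (dens Th k ss) = size ss.
Proof. by elim: ss k => //= s ss IH k; rewrite IH. Qed.

Lemma dens_V Th x ss : x \in names -> size ss <= n ->
  (x, dens Th (n - size ss) ss) \in V (size ss).
Proof.
move=> Hx; elim: ss => [|s ss IH] /= Hs; first by rewrite mem_V0 Hx.
have E : (n - (size ss).+1).+1 = n - size ss by lia.
by rewrite mem_VS ?E ?IH ?filter_sublists //; lia.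
Qed.

Lemma den_U Th s : (forall t, t \in Th -> fact_sound t) -> stack_wf n Sigma s -> 0 < order s ->
  {subset den Th s <= UU (order s)}.
Proof. by move=> HT Hs Hk; have [_ _ H _] := den_sound HT Hs; apply: H. Qed.

Lemma rel_dens Th k ss : (forall t, t \in Th -> fact_sound t) ->
  levels k ss -> all (stack_wf n Sigma) ss ->
  rel_list (fun k s d => order s = k /\ {subset den Th s <= d}) k ss (dens Th k ss).
Proof.
move=> HT; elim: ss k => //= s ss IH k; rewrite levels_cons => /andP[/eqP Eo Hl] /andP[W Hw].
split; last exact: IH.
by split=> // z Hz; rewrite mem_filter Hz -Eo (den_U HT) // Eo.
Qed.

Lemma den_foldl Th x H ss : x \in names -> size ss <= n ->
  st x (dens Th (n - size ss) ss) \in den Th H -> levels (n - size ss) ss ->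
  st x [::] \in den Th (foldl SCons H ss).
Proof.
move=> Hx; elim: ss H => [|s ss IH] H //= Hs.
have E : (n - (size ss).+1).+1 = n - size ss by lia.
rewrite levels_cons E => Hst /andP[/eqP Eo Hl]; apply: IH => //=; first by lia.
apply/mem_acons_of; exists (st x ([seq z <- UU (n - size ss) | z \in den Th s] :: dens Th (n - size ss) ss)), [seq z <- UU (n - size ss) | z \in den Th s].
split=> //; last by move=> z; rewrite mem_filter => /andP[].
rewrite Eo; apply/mem_delta; first by lia.
right; exists x, [seq z <- UU (n - size ss) | z \in den Th s], (dens Th (n - size ss) ss).
by split=> //; [rewrite subKn ?dens_V //; lia | apply: filter_sublists].
Qed.

(** The second logical relation, [den sat s] contained in d, is respected by the algebra of sets.
    Run on the exact sets of the components of s, the operation yields a set containing [den sat s']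
    and thus Y, so the fact about the head of s is derivable and by closure present; the fixed
    transitions read the rest of s. *)
Lemma den_complete x oo Y s s' : x \in names -> (x, (oo, Y)) \in rules -> is_stack n Sigma n s ->
  opsem oo s s' -> {subset Y <= den sat s'} -> st x [::] \in den sat s.
Proof.
move=> Hx Hr Hs Ho HY; have HT := sat_sound.
have [h [ss [Hview Eop]]] : exists h ss, view n Sigma h ss s /\
    op_fun SChar cns_stack SEmpty n oo h ss = [:: s'].
  case: oo Hr Ho => [o /rules_ok[Hin _] | _ /= ->]; first exact: op_sem_view.
  have [h [ss Hv]] := view_exists Hs; exists h, ss; split=> //.
  by case: Hv => _ _ _ _ E; rewrite /op_fun /= plug_stack -E.
case: (Hview) => Hsz Hh Hlv Hw Es.
set l := dens sat (n - size ss) ss.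
pose h' : option (nat * (nat * seq data)) := if h is Some (a, (k, u)) then
  Some (a, (k, [seq z <- UU k | z \in den sat u])) else None.
have [] := @op_fun_rel n Sigma _ SChar cns_stack SEmpty _ (achar sat) acons (fin sat)
  (fun k s d => order s = k /\ {subset den sat s <= d}) _ _ _ oo h h' ss l.
- move=> a k u d _ _ [Eu Hu]; split=> // z /= /mem_achar_of[X [Hc HX]].
  by apply/mem_achar_of; exists X; split=> // w /HX/Hu.
- move=> k v d v' d' _ [Ev Hv] [Ev' Hv']; split=> //= z; rewrite Ev' => /mem_acons_of[r1 [X [Hd H1 HX]]].
  by apply/mem_acons_of; exists r1, X; split=> [//||w /HX/Hv'//]; apply: Hv.
- by move=> k Hk; split.
- by case: oo Hr {Ho Eop} => // o /rules_ok[].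
- by [].
- rewrite /h'; case: h Hh {Hview Es Eop h'} => [[a [k u]]|] //=.
  case/and3P=> /eqP-> Ha; rewrite is_stackE => /and3P[Hk /eqP Eu Wu].
  split=> //; split; first by rewrite Hk -Eu (wf_order Wu).
  by split=> // z Hz; rewrite mem_filter Hz -Eu (den_U HT) // Eu.
- exact: rel_dens.
- by case; rewrite Eop.
case=> s1 [D [E1 E2 [_ HD]]]; have E : s1 = s' by move: E1; rewrite Eop => -[].
subst s1.
have Hd : derivable sat (x, l, h').
  apply/hasP; exists (x, (oo, Y)) => //=; rewrite eqxx E2 /= orbF.
  by apply/allP => y /HY/HD.
have Hu : (x, l, h') \in univ.
  have HV : (x, l) \in V (size ss) := dens_V sat Hx Hsz; have Sl : size l = size ss := size_dens _ _ _.
  rewrite /h'; case: h Hh {Hview Es Eop E1 h' E2 Hd} => [[a [k u]]|] /=.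
    case/and3P=> /eqP Ej Ha /and3P[Hk _ _].
    have En : size ss = n by lia.
    by rewrite mem_univ_Some Ha Hk filter_sublists -[X in V X]En HV.
  by rewrite mem_univ_None /= Sl HV andbT; lia.
have Hin := sat_closed Hu Hd.
rewrite Es; apply: den_foldl => //.
have Sl : size l = size ss := size_dens _ _ _.
move: Hin; rewrite /h'; case: h Hh {Hview Es Eop E1 h' E2 Hd Hu} => [[a [k u]]|] /= Hh Hin.
  apply/mem_achar_of; exists [seq z <- UU k | z \in den sat u].
  split; last by move=> z; rewrite mem_filter => /andP[].
  by apply/mem_chars; right; exists (x, l), k.
by apply/mem_fin; right; exists (x, l); split=> //=; rewrite Sl; lia.
Qed.

Theorem den_sem z s : is_stack n Sigma n s -> (z \in den sat s) <-> sem z s.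
Proof.
move=> Hs; split=> [Hz|H].
  move: (Hs); rewrite is_stackE => /and3P[_ /eqP Eo W].
  by have [_ _ _ HI] := den_sound sat_sound W; have := HI _ Hz; rewrite Eo subnn.
elim: H Hs => {z s} [z s _ Hz _|x oo Y s s' Hs Hx Hr Ho _ IH _]; first exact: bden_den.
apply: (den_complete Hx Hr Hs Ho) => y Hy; apply: IH => //.
by case: oo Hr Ho => [o /rules_ok[Hin _] Ho|_ /= -> //]; apply: op_sem_wf Hin Hs Ho.
Qed.

End Engine.

(** * Automata as data *)

(* Nested pairs ending in [unit], laid out so that the generic encoding agrees
   with [enc_automaton]. *)
Definition caut : Type :=
  (seq nat * (seq nat * (seq (seq nat) * (seq (seq nat) *
  (seq (nat * (nat * (nat * (nat * (nat * unit))))) *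
  (seq (seq (nat * (nat * (seq nat * unit)))) *
  (seq (nat * (nat * (seq nat * (seq nat * unit)))) * unit)))))))%type.

Definition cQ (c : caut) := c.1.
Definition cF (c : caut) := c.2.1.
(** The lists indexed by the order start at order 1, the one read by [cDK] at order 2; hence the
    shifts. *)
Definition cR (c : caut) k := nth [::] c.2.2.1 k.-1.
Definition cFK (c : caut) k := nth [::] c.2.2.2.1 k.-1.
Definition cD (c : caut) := c.2.2.2.2.1.
Definition cDK (c : caut) k := nth [::] c.2.2.2.2.2.1 k.-2.
Definition cD1 (c : caut) := c.2.2.2.2.2.2.1.

Definition ofc (c : caut) : automaton :=
  Automaton (cQ c) (cF c) (cR c) (cFK c)
    [seq (t.1, (t.2.1, t.2.2.1), (t.2.2.2.1, t.2.2.2.2.1)) | t <- cD c]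
    (fun k => [seq (t.1, t.2.1, t.2.2.1) | t <- cDK c k])
    [seq (t.1, t.2.1, t.2.2.1, t.2.2.2.1) | t <- cD1 c].

Definition toc (n : nat) (T : automaton) : caut :=
  (QT T, (FT T, ([seq RK T k | k <- iota 1 n], ([seq FK T k | k <- iota 1 n],
   ([seq (t.1.1, (t.1.2.1, (t.1.2.2, (t.2.1, (t.2.2, tt))))) | t <- DeltaT T],
   ([seq [seq (t.1.1, (t.1.2, (t.2, tt))) | t <- DeltaK T k] | k <- iota 2 n.-1],
   ([seq (t.1.1.1, (t.1.1.2, (t.1.2, (t.2, tt)))) | t <- Delta1 T], tt))))))).

Lemma enc_seq_map (A B : Type) (f : B -> data) (g : A -> B) (h : A -> data) l :
  (forall a, f (g a) = h a) -> enc_seq f (map g l) = enc_seq h l.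
Proof. by move=> H; elim: l => //= a l ->; rewrite H. Qed.

Lemma enc_toc n T : enc (toc n T) = enc_automaton n T.
Proof.
have dc a b c d : a = c -> b = d -> dcons a b = dcons c d by move=> -> ->.
rewrite /enc_automaton /enc_tuple /=.
refine (dc _ _ _ _ erefl (dc _ _ _ _ erefl (dc _ _ _ _ _ (dc _ _ _ _ _
  (dc _ _ _ _ _ (dc _ _ _ _ _ (dc _ _ _ _ _ erefl))))))); try by apply: enc_seq_map.
by apply: enc_seq_map => k; apply: enc_seq_map.
Qed.

Lemma map_id_in (T : eqType) (f : T -> T) (s : seq T) : (forall x, f x = x) -> map f s = s.
Proof. by move=> H; rewrite -[RHS]map_id; apply: eq_map. Qed.

Lemma map_nth_iota (A : Type) (d : A) s m k : size s = k ->
  [seq nth d s (j - m) | j <- iota m k] = s.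
Proof.
move=> <-; elim: s m => //= a s IH m; rewrite subnn /=; congr cons.
rewrite -[RHS](IH m.+1); apply/eq_in_map => j; rewrite mem_iota => Hj.
by have -> : j - m = (j - m.+1).+1 by lia.
Qed.

(** Only the length of a list indexed by the order can get lost, as [toc] tabulates exactly the
    orders up to n. The lemma makes a computed value the encoding of an actual automaton. *)
Lemma toc_ofc n c : size c.2.2.1 = n -> size c.2.2.2.1 = n -> size c.2.2.2.2.2.1 = n.-1 ->
  toc n (ofc c) = c.
Proof.
case: c => Q [F [R [FK [D [DK [D1 []]]]]]] /= E1 E2 E3; rewrite /toc /=.
congr (_, (_, (_, (_, (_, (_, (_, _))))))).
- rewrite -[RHS](@map_nth_iota _ [::] R 1 n E1); apply/eq_in_map => k; rewrite mem_iota /cR /= => Hk.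
  by rewrite subn1.
- rewrite -[RHS](@map_nth_iota _ [::] FK 1 n E2); apply/eq_in_map => k; rewrite mem_iota /cFK /= => Hk.
  by rewrite subn1.
- by rewrite -map_comp; apply: map_id_in => -[a [b [c [d [e []]]]]].
- rewrite -[RHS](@map_nth_iota _ [::] DK 2 n.-1 E3); apply/eq_in_map => k; rewrite mem_iota /cDK /= => Hk.
  by rewrite -map_comp map_id_in; [rewrite subn2 | move=> -[a [b [c []]]]].
by rewrite -map_comp; apply: map_id_in => -[a [b [c [d []]]]].
Qed.

Lemma mem_cD c q i m q' r : ((q, (i, m), (q', r)) \in DeltaT (ofc c)) =
  ((q, (i, (m, (q', (r, tt))))) \in cD c).
Proof.
apply/mapP/idP => [[[a [b [d [e [f []]]]]] /= H [-> -> -> -> ->]] //|H]; by exists (q, (i, (m, (q', (r, tt))))).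
Qed.

Lemma mem_cDK c k r r' X : ((r, r', X) \in DeltaK (ofc c) k) = ((r, (r', (X, tt))) \in cDK c k).
Proof.
apply/mapP/idP => [[[a [b [d []]]] /= H [-> -> ->]] //|H]; by exists (r, (r', (X, tt))).
Qed.

Lemma mem_cD1 c r a Y X : ((r, a, Y, X) \in Delta1 (ofc c)) = ((r, (a, (Y, (X, tt)))) \in cD1 c).
Proof.
apply/mapP/idP => [[[p [b [d [e []]]]] /= H [-> -> -> ->]] //|H]; by exists (r, (a, (Y, (X, tt)))).
Qed.

Section OfcToc.
Variables (n : nat) (Sigma P : seq nat) (T : automaton).
Let T' := ofc (toc n T).

Lemma RK_toc k : 0 < k <= n -> RK T' k = RK T k.
Proof.
move=> Hk; rewrite /= /cR /= (nth_map 0) ?size_iota; last by lia.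
by rewrite nth_iota; [congr RK; lia | lia].
Qed.
Lemma FK_toc k : 0 < k <= n -> FK T' k = FK T k.
Proof.
move=> Hk; rewrite /= /cFK /= (nth_map 0) ?size_iota; last by lia.
by rewrite nth_iota; [congr FK; lia | lia].
Qed.
Lemma DK_toc k r r' X : 1 < k <= n -> ((r, r', X) \in DeltaK T' k) = ((r, r', X) \in DeltaK T k).
Proof.
move=> Hk; rewrite mem_cDK /cDK /= (nth_map 0) ?size_iota; last by lia.
rewrite nth_iota; last by lia.
have -> : 2 + k.-2 = k by lia.
apply/mapP/idP => [[[[a b] d] /= H [-> -> ->]] //|H]; by exists (r, r', X).
Qed.
Lemma DT_toc : DeltaT T' = DeltaT T.
Proof. by rewrite /= -map_comp; apply: map_id_in => -[[a [b c]] [d e]]. Qed.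
Lemma D1_toc : Delta1 T' = Delta1 T.
Proof. by rewrite /= -map_comp; apply: map_id_in => -[[[a b] c] d]. Qed.

Lemma automaton_wf_toc : 0 < n -> automaton_wf n Sigma P T -> automaton_wf n Sigma P T'.
Proof.
move=> Hn [H1 H2 H3 H4 H5 H6 H7]; split=> //.
- by move=> j k x Hj Hk; rewrite !RK_toc //; apply: H3.
- by move=> k Hk; rewrite RK_toc // FK_toc //; apply: H4.
- move=> q i m q' r; rewrite DT_toc => H; have [Hq Hi Hq' Hf Hr] := H5 _ _ _ _ _ H.
  by split=> //; rewrite RK_toc ?Hn /=.
- move=> k r r' X Hk; rewrite DK_toc // => /(H6 _ _ _ _ Hk)[Hr Hr' HX].
  by split=> //; rewrite RK_toc //; lia.
- move=> r a Y X; rewrite D1_toc => /H7[Hr Ha HX [k [Hk HY]]].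
  split=> //; try (rewrite RK_toc //; lia).
  by exists k; rewrite RK_toc.
Qed.
End OfcToc.

(** * Unions of automata as base automata *)

Definition c0 : caut := ([::], ([::], ([::], ([::], ([::], ([::], ([::], tt))))))).
(** The index i of the automaton makes the union disjoint, and the leading [dnil] is the tag of base
    states. *)
Definition bs (i r : nat) : data := dcons dnil (enc (i, r)).
(* A transition of order 1 doubles as the state of order 0 that reads its
   annotated character. *)
Definition bt (i : nat) (t : nat * (nat * (seq nat * (seq nat * unit)))) : data :=
  dcons dnil (enc (i, t)).

Lemma bs_inj i r i' r' : bs i r = bs i' r' -> i = i' /\ r = r'.
Proof. by case=> /enc_nat_inj-> /enc_nat_inj->. Qed.
Lemma bt_inj i t i' t' : bt i t = bt i' t' -> i = i' /\ t = t'.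
Proof. by move/(congr1 dsnd) => E; have [-> ->] := @enc_inj _ _ (i, t) (i', t') E. Qed.

Lemma mem_flatten_iota (A B : eqType) (m : nat) (l : nat -> seq A) (f : nat -> A -> B) y :
  reflect (exists i a, [/\ i < m, a \in l i & y = f i a])
    (y \in flatten [seq [seq f i a | a <- l i] | i <- iota 0 m]).
Proof.
apply: (iffP flatten_mapP) => [[i Hi /mapP[a Ha ->]]|[i [a [Hi Ha ->]]]].
  by exists i, a; split => //; move: Hi; rewrite mem_iota.
by exists i; [rewrite mem_iota | apply: map_f].
Qed.

Section Base.
Variable (Ts : seq caut).
Definition bU k := flatten [seq [seq bs i r | r <- cR (nth c0 Ts i) k] | i <- iota 0 (size Ts)].
Definition bF k := flatten [seq [seq bs i r | r <- cFK (nth c0 Ts i) k] | i <- iota 0 (size Ts)].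
Definition bD k : seq (data * (data * seq data)) :=
  if k == 1 then
    flatten [seq [seq (bs i t.1, (bt i t, [seq bs i x | x <- t.2.2.2.1])) | t <- cD1 (nth c0 Ts i)]
            | i <- iota 0 (size Ts)]
  else
    flatten [seq [seq (bs i t.1, (bs i t.2.1, [seq bs i x | x <- t.2.2.1])) | t <- cDK (nth c0 Ts i) k]
            | i <- iota 0 (size Ts)].
Definition bC : seq (data * (nat * seq data)) :=
  flatten [seq [seq (bt i t, (t.2.1, [seq bs i x | x <- t.2.2.1])) | t <- cD1 (nth c0 Ts i)]
          | i <- iota 0 (size Ts)].

Variables (n : nat) (Sigma P : seq nat).
Hypothesis Hn : 0 < n.
Hypothesis Twf : forall i, i < size Ts -> automaton_wf n Sigma P (ofc (nth c0 Ts i)).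

Lemma bU_isb k z : z \in bU k -> isb z.
Proof. by case/mem_flatten_iota=> i [r [_ _ ->]]. Qed.
Lemma bU_disj j k z : 0 < j <= n -> 0 < k <= n -> z \in bU j -> z \in bU k -> j = k.
Proof.
move=> Hj Hk /mem_flatten_iota[i [r [Hi Hr ->]]] /mem_flatten_iota[i' [r' [_ Hr' /bs_inj[Ei Er]]]]; subst i' r'.
exact: wf_R (Twf Hi) _ _ _ Hj Hk Hr Hr'.
Qed.
Lemma bF_bU k : 0 < k <= n -> {subset bF k <= bU k}.
Proof.
move=> Hk z /mem_flatten_iota[i [r [Hi Hr ->]]]; apply/mem_flatten_iota; exists i, r; split => //.
exact: (wf_FR (Twf Hi) Hk Hr).
Qed.
Lemma bs_sub i k X : i < size Ts -> {subset X <= cR (nth c0 Ts i) k} ->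
  {subset [seq bs i x | x <- X] <= bU k}.
Proof. by move=> Hi HX z /mapP[x Hx ->]; apply/mem_flatten_iota; exists i, x; split => //; apply: HX. Qed.
Lemma bD_bU k t : 0 < k <= n -> t \in bD k ->
  [/\ t.1 \in bU k, isb t.2.1, 1 < k -> t.2.1 \in bU k.-1 & {subset t.2.2 <= bU k}].
Proof.
move=> Hk; case: (eqVneq k 1) => [->|Hk1].
  rewrite /bD /= => /mem_flatten_iota[i [[r [a [Y [X []]]]] [Hi Ht ->]]] /=.
  rewrite -mem_cD1 in Ht; have [/= Hr _ HX _] := wf_Delta1 (Twf Hi) Ht.
  by split=> //; [apply/mem_flatten_iota; exists i, r | apply: bs_sub].
rewrite /bD (negPf Hk1) => /mem_flatten_iota[i [[r [r' [X []]]] [Hi Ht ->]]] /=.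
rewrite -mem_cDK in Ht; have Hk2 : 1 < k <= n by lia.
have [/= Hr Hr' HX] := wf_DeltaK (Twf Hi) Hk2 Ht.
split=> //; last exact: bs_sub.
  by apply/mem_flatten_iota; exists i, r.
by move=> _; apply/mem_flatten_iota; exists i, r'.
Qed.
Lemma bC_bU c : c \in bC ->
  [/\ isb c.1, c.2.1 \in Sigma & exists k, 0 < k <= n /\ {subset c.2.2 <= bU k}].
Proof.
case/mem_flatten_iota=> i [[r [a [Y [X []]]]] [Hi Ht ->]] /=.
rewrite -mem_cD1 in Ht; have [/= Hr Ha HX [k [Hk HY]]] := wf_Delta1 (Twf Hi) Ht.
by split=> //; exists k; split=> //; apply: bs_sub.
Qed.

Lemma mem_bs_map i x (X : seq nat) : (bs i x \in [seq bs i x | x <- X]) = (x \in X).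
Proof. by apply: mem_map => y z /bs_inj[]. Qed.

(* An annotated character occurs only below an order-1 stack, so its induction
   hypothesis is that of its annotation. *)
Lemma wf_stack_ind (Q : stack -> Prop) :
  (forall k, 0 < k <= n -> Q (SEmpty k)) ->
  (forall a u s, order s = 1 -> stack_wf n Sigma s -> 0 < order u -> stack_wf n Sigma u ->
     Q u -> Q s -> Q (SCons (SChar a u) s)) ->
  (forall s1 s, 0 < order s1 -> order s = (order s1).+1 -> stack_wf n Sigma s ->
     Q s1 -> Q s -> Q (SCons s1 s)) ->
  forall s, 0 < order s -> stack_wf n Sigma s -> Q s.
Proof.
move=> H1 H2 H3.
suff H s : stack_wf n Sigma s -> if s is SChar _ u then 0 < order u -> Q u else Q s.
  by case=> [a u|k|s1 s2] // _; apply: H.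
elim: s => [a u IH|k|s1 IH1 s2 IH2] /=.
- by case/and3P=> _ Hu Wu; case: (u) Hu (IH Wu).
- exact: H1.
case/and3P=> /eqP Eo W1 W2.
have Q2 : Q s2 by move: (IH2 W2); case: (s2) Eo.
move: W1 Eo (IH1 W1); case: (s1) => [a u|k|s s'] W1 Eo HQ.
- by case/and3P: W1 => _ Hu Wu; apply: H2 => //; apply: HQ.
- by apply: H3 => //; case/andP: W1.
by apply: H3 => //=; case/and3P: W1 => /eqP->.
Qed.

Lemma accepted_cons T s1 s r : 0 < order s1 ->
  stack_accepted T (SCons s1 s) r <-> exists r1 X, [/\ (r, r1, X) \in DeltaK T (order s),
    stack_accepted T s1 r1 & forall x, x \in X -> stack_accepted T s x].
Proof. by case: s1. Qed.

(** At order 1 the intermediate state [bt i t] carries the whole transition t, so the annotation and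
    the rest of the stack are read by one and the same transition. *)
Lemma bden_accepted i : i < size Ts -> forall s, 0 < order s -> stack_wf n Sigma s ->
  forall r, (bs i r \in bden bD bF bC s) <-> stack_accepted (ofc (nth c0 Ts i)) s r.
Proof.
move=> Hi; apply: wf_stack_ind => [k _|a u s Eo Ws Hu Wu IHu IHs|s1 s H1 Eo Ws IH1 IHs] r.
- split=> [/mem_flatten_iota[i' [r' [_ Hr /bs_inj[-> ->]]]] //|Hr].
  by apply/mem_flatten_iota; exists i, r.
- rewrite /= Eo; split.
    case/mem_acons_of=> r1 [X [/mem_flatten_iota[i1 [[r2 [b [Y1 [X1 []]]]] [Hi1 Ht1 E]]]]].
    have /= [Ei Er'] := bs_inj (congr1 fst E).
    have /= Er1 := congr1 (fun t => t.2.1) E; have /= EX := congr1 (fun t => t.2.2) E.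
    subst i1 r2 r1 X => {E}.
    case/mem_achar_of=> Y [/mem_flatten_iota[i2 [t2 [_ Ht2 E]]] HY] HX.
    have /= [Ei2 Et2] := bt_inj (congr1 fst E).
    have /= Ea := congr1 (fun t => t.2.1) E; have /= EY := congr1 (fun t => t.2.2) E.
    subst t2 i2 Y; move: Ea => /= Ea; subst a => {E}.
    exists Y1, X1; rewrite mem_cD1; split=> // x Hx.
      by apply/IHu; apply: HY; rewrite mem_bs_map.
    by apply/IHs; apply: HX; rewrite mem_bs_map.
  case=> Y [X]; rewrite mem_cD1 => -[Ht HY HX].
  apply/mem_acons_of; exists (bt i (r, (a, (Y, (X, tt))))), [seq bs i x | x <- X]; split.
  + by apply/mem_flatten_iota; exists i, (r, (a, (Y, (X, tt)))).
  + apply/mem_achar_of; exists [seq bs i x | x <- Y]; split.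
      by apply/mem_flatten_iota; exists i, (r, (a, (Y, (X, tt)))).
    by move=> z /mapP[x Hx ->]; apply/IHu; apply: HY.
  by move=> z /mapP[x Hx ->]; apply/IHs; apply: HX.
apply: (iff_trans _ (iff_sym (accepted_cons _ _ _ H1))).
have Hk : (order s == 1) = false by rewrite Eo; case: (order s1) H1.
split.
  case/mem_acons_of=> r1 [X []]; rewrite /bD Hk.
  case/mem_flatten_iota=> i1 [[r2 [r3 [X1 []]]] [Hi1 Ht1 E]] Hr1 HX.
  have /= [Ei Er'] := bs_inj (congr1 fst E).
  have /= Er1 := congr1 (fun t => t.2.1) E; have /= EX := congr1 (fun t => t.2.2) E.
  subst i1 r2 r1 X => {E}.
  exists r3, X1; rewrite mem_cDK; split=> // [|x Hx]; first exact/IH1.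
  by apply/IHs; apply: HX; rewrite mem_bs_map.
case=> r1 [X]; rewrite mem_cDK => -[Ht Hr1 HX].
apply/mem_acons_of; exists (bs i r1), [seq bs i x | x <- X]; split.
- by rewrite /bD Hk; apply/mem_flatten_iota; exists i, (r, (r1, (X, tt))).
- exact/IH1.
by move=> z /mapP[x Hx ->]; apply/IHs; apply: HX.
Qed.

End Base.

(** * Tree acceptance *)

Definition t0 : tree := Leaf 0 (SEmpty 0).

Lemma tree_ind' (Pr : tree -> Prop) :
  (forall p s, Pr (Leaf p s)) ->
  (forall s ts, (forall j, j < size ts -> Pr (nth t0 ts j)) -> Pr (Node s ts)) ->
  forall t, Pr t.
Proof.
move=> HL HN; fix IH 1 => -[p s|s ts]; first exact: HL.
(* In the vacuous cases [IH] is cleared so that [by] cannot close the goal by an unguarded recursive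
   call. *)
apply: HN; elim: ts => [|t ts IHts] [|j]; [by clear IH | by clear IH | move=> _; exact: (IH t) | exact: IHts].
Qed.

Section Tacc.
Variables (Q X : Type) (tr : Q -> nat -> nat -> Q -> X -> Prop) (ctl : nat -> Q)
  (acc : X -> stack -> Prop).

(* [tacc t q i m]: t is accepted as the i-th of the m children of a node in
   state q, the transition reading the root of t included. *)
Inductive tacc : tree -> Q -> nat -> nat -> Prop :=
| tacc_leaf p s q i m x : tr q i m (ctl p) x -> acc x s -> tacc (Leaf p s) q i m
| tacc_node s ts q i m q' x : tr q i m q' x -> acc x s ->
    (forall j, j < size ts -> tacc (nth t0 ts j) q' j.+1 (size ts)) ->
    tacc (Node s ts) q i m.

Lemma tacc_leafE p s q i m : tacc (Leaf p s) q i m <-> exists x, tr q i m (ctl p) x /\ acc x s.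
Proof.
split=> [H|[x [H1 H2]]]; last exact: tacc_leaf H1 H2.
by inversion H; subst; exists x.
Qed.
Lemma tacc_nodeE s ts q i m : tacc (Node s ts) q i m <-> exists q' x,
  [/\ tr q i m q' x, acc x s & forall j, j < size ts -> tacc (nth t0 ts j) q' j.+1 (size ts)].
Proof.
split=> [H|[q' [x [H1 H2 H3]]]]; last exact: tacc_node H1 H2 H3.
by inversion H; subst; exists q', x.
Qed.
End Tacc.

Definition tra T q i m q' r := (q, (i, m), (q', r)) \in DeltaT T.
Definition accs T r s := stack_accepted T s r.
Notation taccT T := (tacc (tra T) id (accs T)).

(** Choice over finitely many indices, by induction and without axioms; it gathers the witnesses
    found for the separate children of a node. *)
Lemma finite_choice (A : Type) (a : A) (Pr : nat -> A -> Prop) m :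
  (forall j, j < m -> exists x, Pr j x) -> exists f, forall j, j < m -> Pr j (f j).
Proof.
elim: m => [|m IH] H; first by exists (fun=> a).
have [f Hf] := IH (fun j Hj => H j (ltnW Hj)); have [x Hx] := H m (ltnSn m).
exists (fun j => if j == m then x else f j) => j Hj.
by case: eqP => [->//|E]; apply: Hf; lia.
Qed.

Section InLang.
Variables (n : nat) (Sigma P : seq nat) (T : automaton).
Hypothesis Twf : automaton_wf n Sigma P T.

Lemma run_tacc t lam : is_run T t lam -> forall q i m r,
  tra T q i m (lam [::]) r -> accs T r (tree_stack t) -> taccT T t q i m.
Proof.
elim/tree_ind': t lam => [p s|s ts IH] lam Hrun q i m r Ht Ha.
  have [_ E] := Hrun [::] _ erefl; apply/tacc_leafE; exists r.
  by rewrite /= -E.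
have [_ Hc] := Hrun [::] _ erefl.
apply/tacc_nodeE; exists (lam [::]), r; split=> // j Hj.
have [|r' [Hr' Ha']] := Hc j.+1; first by rewrite /= Hj.
apply: (IH _ Hj (fun v => lam (j.+1 :: v))) Hr' _; last first.
  by move: Ha'; rewrite /= (set_nth_default t0).
move=> v u Hu; have := Hrun (j.+1 :: v) u; rewrite /= Hj (set_nth_default t0) //.
by apply.
Qed.

Lemma tacc_run t q i m : taccT T t q i m -> exists lam r,
  [/\ is_run T t lam, tra T q i m (lam [::]) r & accs T r (tree_stack t)].
Proof.
elim=> {t q i m} [p s q i m r Ht Ha|s ts q i m q' r Ht Ha _ IH].
  exists (fun=> p), r; split=> // -[|j v] u //= [<-]; split=> //.
  by have [] := wf_Delta Twf Ht.
have [f Hf] := @finite_choice _ (fun=> 0) _ (size ts) IH.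
pose lam v := if v is j :: v' then f j.-1 v' else q'.
exists lam, r; split=> // -[|j v] u /=.
  case=> <-; split=> [|j Hj]; first by have [] := wf_Delta Twf Ht.
  have Hj1 : j.-1 < size ts by lia.
  have [r' [_ Ht' Ha']] := Hf _ Hj1; exists r'.
  rewrite (set_nth_default t0) //; split=> //.
  by have <- : j.-1.+1 = j by lia.
case: ifP => // Hj; have Hj1 : j.-1 < size ts by lia.
have [r' [Hrun _ _]] := Hf _ Hj1.
rewrite (set_nth_default t0) // => Hu; exact: Hrun Hu.
Qed.

(** Acceptance reads the root as the only child of a virtual node in a final state, so a whole tree
    is treated like a subtree. *)
Lemma in_langP t : in_lang T t <-> exists qf, qf \in FT T /\ taccT T t qf 1 1.
Proof.
split=> [[lam [Hrun [qf [r [Hf Ht Ha]]]]]|[qf [Hf /tacc_run[lam [r [Hrun Ht Ha]]]]]].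
  by exists qf; split=> //; apply: run_tacc Ht Ha.
by exists lam; split=> //; exists qf, r.
Qed.
End InLang.

(** * Plain automata from names *)

Definition ctl (p : nat) : seq nat := [:: 0; p].
Definition okq (P : seq nat) (q : seq nat) : bool :=
  (nth 1 q 0 != 0) || ((q == ctl (nth 0 q 1)) && (nth 0 q 1 \in P)).
(** A control state keeps its number, because it labels leaves and must itself be a state; all other
    states are moved above [sumn P], which bounds P. States are sequences told apart by their first
    entry, 0 being reserved for control states. *)
Definition numq (P : seq nat) (q : seq nat) : nat :=
  if nth 1 q 0 == 0 then nth 0 q 1 else (sumn P).+1 + num (enc q).

Lemma sumn_mem (P : seq nat) p : p \in P -> p <= sumn P.
Proof. by elim: P => //= a P IH; rewrite inE => /orP[/eqP->|/IH]; lia. Qed.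

Lemma numq_inj P q q' : okq P q -> okq P q' -> numq P q = numq P q' -> q = q'.
Proof.
rewrite /okq /numq; case: (nth 1 q 0 == 0); case: (nth 1 q' 0 == 0) => /=.
- by move=> /andP[/eqP E1 _] /andP[/eqP E2 _] E; rewrite E1 E2 E.
- by move=> /andP[_ /sumn_mem H] _ E; exfalso; move: H; rewrite E; lia.
- by move=> _ /andP[_ /sumn_mem H] E; exfalso; move: H; rewrite -E; lia.
by move=> _ _ /addnI/num_inj/(enc_seq_inj enc_nat_inj).
Qed.

Definition trans_t := (seq nat * ((nat * nat) * (seq nat * data)))%type.

Section Plain.
Variables (n : nat) (Sigma P : seq nat) (Ts : seq caut) (names : seq data)
  (rules : seq (data * (option stack_op * seq data)))
  (trans : seq trans_t) (finals : seq (seq nat)).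

Notation UU := (UU n (bU Ts) names).
Notation delta := (delta n (bU Ts) (bD Ts) names).
Definition facts := sat n Sigma (bU Ts) (bD Ts) (bF Ts) (bC Ts) names rules.
Notation fins k := (fin n (bF Ts) facts k).
Notation chrs := (chars (bC Ts) facts).
Notation semE := (sem n Sigma (bD Ts) (bF Ts) (bC Ts) names rules).
Notation denE := (den n (bU Ts) (bD Ts) (bF Ts) (bC Ts) names facts).

(** The filter makes the automaton well formed by construction. No acceptance is lost: a state of
    order n that accepts some stack lies in [UU n] by [sem_U]. *)
Definition goodtr : seq trans_t :=
  [seq t <- trans | [&& 0 < t.2.1.1, t.2.1.1 <= t.2.1.2 & t.2.2.2 \in UU n]].

(** The states of order 0 disappear here: every transition of order 1 is composed with each reading
    of a character by its intermediate state. *)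
Definition mkplain : caut :=
  (P ++ map (numq P) finals ++ [seq numq P t.1 | t <- goodtr] ++ [seq numq P t.2.2.1 | t <- goodtr],
  (map (numq P) finals,
  ([seq map num (UU k) | k <- iota 1 n],
  ([seq map num (fins k) | k <- iota 1 n],
  ([seq (numq P t.1, (t.2.1.1, (t.2.1.2, (numq P t.2.2.1, (num t.2.2.2, tt))))) | t <- goodtr],
  ([seq [seq (num t.1, (num t.2.1, (map num t.2.2, tt))) | t <- delta k] | k <- iota 2 n.-1],
  (flatten [seq [seq (num t.1, (c.2.1, (map num c.2.2, (map num t.2.2, tt))))
     | c <- [seq c <- chrs | c.1 == t.2.1]] | t <- delta 1], tt))))))).

Definition trE q i m q' z := (q, ((i, m), (q', z))) \in trans.

Hypothesis n_gt0 : 0 < n.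
Hypothesis Twf : forall i, i < size Ts -> automaton_wf n Sigma P (ofc (nth c0 Ts i)).
Hypothesis rules_ok : forall x o Y, (x, (Some o, Y)) \in rules -> in_Ops n Sigma o /\ Y != [::].
Hypothesis trans_ok : forall q i m q' z, trE q i m q' z -> [/\ okq P q, okq P q' & q' \notin finals].
Hypothesis finals_ok : forall q, q \in finals -> okq P q.

Notation T' := (ofc mkplain).

Let bUb := @bU_isb Ts.
Let bUd := bU_disj Twf.
Let bFU := bF_bU Twf.
Let bDU := bD_bU n_gt0 Twf.
Let bCU := bC_bU Twf.

Lemma facts_sound t : t \in facts -> fact_sound n Sigma (bU Ts) (bD Ts) (bF Ts) (bC Ts) names rules t.
Proof. by apply: sat_sound. Qed.

Lemma RK_mkplain k : 0 < k <= n -> RK T' k = map num (UU k).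
Proof.
move=> Hk; rewrite /= /cR /= (nth_map 0) ?size_iota ?nth_iota; try lia.
by have -> : 1 + k.-1 = k by lia.
Qed.
Lemma FK_mkplain k : 0 < k <= n -> FK T' k = map num (fins k).
Proof.
move=> Hk; rewrite /= /cFK /= (nth_map 0) ?size_iota ?nth_iota; try lia.
by have -> : 1 + k.-1 = k by lia.
Qed.
Lemma mem_DK_mkplain k r r' X : 1 < k <= n -> reflect
  (exists t, [/\ t \in delta k, r = num t.1, r' = num t.2.1 & X = map num t.2.2])
  ((r, r', X) \in DeltaK T' k).
Proof.
move=> Hk; rewrite mem_cDK /cDK /= (nth_map 0) ?size_iota ?nth_iota; try lia.
have -> : 2 + k.-2 = k by lia.
by apply: (iffP mapP) => -[t]; [move=> Ht [-> -> ->]; exists t | case=> Ht -> -> ->; exists t].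
Qed.
Lemma mem_D1_mkplain r a Y X : reflect
  (exists t b, [/\ t \in delta 1, (t.2.1, (a, b)) \in chrs, r = num t.1, Y = map num b & X = map num t.2.2])
  ((r, a, Y, X) \in Delta1 T').
Proof.
rewrite mem_cD1; apply: (iffP flatten_mapP).
  case=> t Ht /mapP[[z [b c]]]; rewrite mem_filter => /andP[/eqP/= E Hc] [-> -> -> ->].
  by exists t, c; rewrite -E.
case=> t [b [Ht Hc -> -> ->]]; exists t => //.
by apply/mapP; exists (t.2.1, (a, b)) => //; rewrite mem_filter eqxx.
Qed.
Lemma mem_DT_mkplain q i m q' r : reflect
  (exists t, [/\ t \in goodtr, q = numq P t.1, (i, m) = t.2.1, q' = numq P t.2.2.1 & r = num t.2.2.2])
  ((q, (i, m), (q', r)) \in DeltaT T').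
Proof.
rewrite mem_cD; apply: (iffP mapP) => -[[u [[j l] [u' z]]]].
  by move=> Ht [-> -> -> -> ->]; exists (u, ((j, l), (u', z))).
by case=> Ht -> [-> ->] -> ->; exists (u, ((j, l), (u', z))).
Qed.

Lemma fin_U k : 0 < k <= n -> {subset fins k <= UU k}.
Proof.
by move=> Hk; have [_ _ H _] := sound_emp n_gt0 bUb bFU facts_sound Hk; apply: H; case/andP: Hk.
Qed.

Lemma mkplain_wf : automaton_wf n Sigma P T'.
Proof.
have dU k t := @delta_U n (bU Ts) (bD Ts) names n_gt0 bDU k t.
split.
- by move=> p Hp; rewrite /= /cQ /= mem_cat Hp.
- by move=> q Hq; rewrite /= /cQ /= !mem_cat Hq orbT.
- move=> j k x Hj Hk; rewrite !RK_mkplain // => /mapP[z Hz ->]; rewrite (mem_map num_inj) => Hz'.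
  exact: (UU_disj n_gt0 bUb bUd Hj Hk Hz Hz').
- move=> k Hk x; rewrite RK_mkplain // FK_mkplain // => /mapP[z Hz ->].
  by rewrite (mem_map num_inj); apply: fin_U.
- move=> q i m q' r /mem_DT_mkplain[[u [[j l] [u' z]]] [Ht -> [-> ->] -> ->]].
  move: (Ht); rewrite mem_filter => /andP[/and3P[Hj Hl Hz] Htr]; rewrite /= in Hj Hl Hz.
  have [H1 H2 H3] := trans_ok Htr; rewrite RK_mkplain ?n_gt0 ?leqnn // (mem_map num_inj); split=> //.
  + by rewrite /cQ /= !mem_cat (map_f (fun t : trans_t => numq P t.1) Ht) !orbT.
  + by rewrite Hj.
  + by rewrite /cQ /= !mem_cat (map_f (fun t : trans_t => numq P t.2.2.1) Ht) !orbT.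
  apply/negP => /mapP[f Hf /(numq_inj H2 (finals_ok Hf)) E].
  by move: H3; rewrite E Hf.
- move=> k r r' X Hk /(mem_DK_mkplain _ _ _ Hk)[t [Ht -> -> ->]].
  have Hk0 : 0 < k <= n by lia. have Hk1 : 0 < k.-1 <= n by lia.
  have [H1 H2 H3] := dU _ _ Hk0 Ht.
  rewrite !RK_mkplain // !(mem_map num_inj) H1 H2; last by lia.
  by split=> // x /mapP[z Hz ->]; rewrite (mem_map num_inj); apply: H3.
move=> r a Y X /mem_D1_mkplain[t [b [Ht Hc -> -> ->]]].
have [H1 H2 H3] := dU 1 _ n_gt0 Ht.
rewrite RK_mkplain // (mem_map num_inj); split=> //; last first.
- case/mem_chars: Hc => [/bCU[_ _ [k [Hk HX]]]|[v [k [/facts_sound[Hu _] _]]]].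
    exists k; split=> // x; rewrite RK_mkplain // => /mapP[z Hz ->]; rewrite (mem_map num_inj).
    by rewrite mem_cat HX.
  move: Hu; rewrite (mem_univ_Some _ _ _ n_gt0) => /and4P[_ _ Hk HX]; exists k; split=> // x.
  by rewrite RK_mkplain // => /mapP[z Hz ->]; rewrite (mem_map num_inj); apply: (sublists_sub HX).
- by move=> x /mapP[z Hz ->]; rewrite (mem_map num_inj); apply: H3.
case/mem_chars: Hc => [/bCU[]//|[v [k [/facts_sound[Hu _] _]]]].
by move: Hu; rewrite (mem_univ_Some _ _ _ n_gt0) => /and4P[].
Qed.

Lemma plain_accepted s : 0 < order s -> stack_wf n Sigma s -> forall z,
  stack_accepted T' s (num z) <-> z \in denE s.
Proof.
move: s; apply: wf_stack_ind => [k Hk|a u s Eo Ws Hu Wu IHu IHs|s1 s H1 Eo Ws IH1 IHs] z.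
- by rewrite -[stack_accepted _ _ _]/(is_true (num z \in FK T' k)) FK_mkplain // (mem_map num_inj).
- rewrite /= Eo; split.
    case=> Y [X [/mem_D1_mkplain[t [b [Ht Hc /num_inj-> -> ->]]] HY HX]].
    case: t Ht Hc HX => z' [r1 X'] /= Ht Hc HX.
    apply/mem_acons_of; exists r1, X'; split=> //.
      apply/mem_achar_of; exists b; split=> // y Hy.
      by apply/IHu; apply: HY; apply: map_f.
    by move=> y Hy; apply/IHs; apply: HX; apply: map_f.
  case/mem_acons_of=> r1 [X [Ht /mem_achar_of[b [Hc Hb]] HX]].
  exists (map num b), (map num X); split.
  + by apply/mem_D1_mkplain; exists (z, (r1, X)), b.
  + by move=> x /mapP[y Hy ->]; apply/IHu; apply: Hb.
  by move=> x /mapP[y Hy ->]; apply/IHs; apply: HX.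
have Hk : 1 < order s <= n by rewrite (wf_order Ws) Eo !ltnS H1.
apply: (iff_trans (accepted_cons _ _ _ H1)); split.
  case=> r1 [X [/(mem_DK_mkplain _ _ _ Hk)[[z' [y X']] [Ht /num_inj-> -> ->]] Hr1 HX]].
  apply/mem_acons_of; exists y, X'; split=> //; first exact/IH1.
  by move=> x Hx; apply/IHs; apply: HX; apply: map_f.
case/mem_acons_of=> r1 [X [Ht Hr1 HX]].
exists (num r1), (map num X); split.
- by apply/(mem_DK_mkplain _ _ _ Hk); exists (z, (r1, X)).
- exact/IH1.
by move=> x /mapP[y Hy ->]; apply/IHs; apply: HX.
Qed.

Lemma plain_sem s z : is_stack n Sigma n s -> stack_accepted T' s (num z) <-> semE z s.
Proof.
move=> Hs; have := Hs; rewrite is_stackE => /and3P[_ /eqP Eo W].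
have A : stack_accepted T' s (num z) <-> z \in denE s by apply: plain_accepted; rewrite ?Eo.
have B := @den_sem n Sigma (bU Ts) (bD Ts) (bF Ts) (bC Ts) names rules n_gt0 bUb bUd bFU bDU bCU rules_ok z s Hs.
by split=> [/A/B|/B/A].
Qed.

Lemma sem_U s z : is_stack n Sigma n s -> semE z s -> z \in UU n.
Proof.
move=> Hs /(@den_sem n Sigma (bU Ts) (bD Ts) (bF Ts) (bC Ts) names rules n_gt0 bUb bUd bFU bDU bCU rules_ok _ _ Hs) Hz.
have := Hs; rewrite is_stackE => /and3P[_ /eqP Eo W].
have := den_U n_gt0 bUb bFU bDU bCU facts_sound W; rewrite Eo => H.
exact: H n_gt0 _ Hz.
Qed.

Lemma plain_tacc d t q i m : tree_wf d n Sigma P t -> okq P q -> 0 < i <= m ->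
  taccT T' t (numq P q) i m <-> tacc trE ctl semE t q i m.
Proof.
elim/tree_ind': t q i m => [p s|s ts IH] q i m /= Hwf Hq Hi.
  case/andP: Hwf => Hp Hs; rewrite !tacc_leafE; split=> -[x [Ht Ha]].
    case/mem_DT_mkplain: Ht => -[u [[j l] [u' z]]] [/= Ht Eq [Ei Em] Ep Ex]; subst i m x.
    move: Ht; rewrite mem_filter => /andP[_ Ht]; have [Hu Hu' _] := trans_ok Ht.
    exists z; split; last by apply/plain_sem.
    have -> : ctl p = u' by apply: (@numq_inj P) => //; rewrite /okq /ctl /= eqxx Hp.
    by have -> : q = u by apply: (@numq_inj P).
  exists (num x); split; last by apply/plain_sem.
  apply/mem_DT_mkplain; exists (q, ((i, m), (ctl p, x))); split=> //.
  by rewrite mem_filter /= (sem_U Hs Ha) andbT; case/andP: Hi => -> ->.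
case/and3P: Hwf => Hs Hts Hall; rewrite !tacc_nodeE.
have Hc j : j < size ts -> tree_wf d n Sigma P (nth t0 ts j).
  by move=> Hj; apply: (all_nthP t0 Hall).
split=> -[q' [x [Ht Ha Hch]]].
  case/mem_DT_mkplain: Ht => -[u [[j l] [u' z]]] [/= Ht Eq [Ei Em] Ep Ex]; subst i m x q'.
  move: Ht; rewrite mem_filter => /andP[_ Ht]; have [Hu Hu' _] := trans_ok Ht.
  exists u', z; split; last 1 first.
  - by move=> k Hk; apply/IH => //; [apply: Hc | apply: Hch].
  - by have -> : q = u by apply: (@numq_inj P).
  by apply/plain_sem.
have [_ Hq' _] := trans_ok Ht.
exists (numq P q'), (num x); split; last 1 first.
- by move=> k Hk; apply/IH => //; [apply: Hc | apply: Hch].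
- apply/mem_DT_mkplain; exists (q, ((i, m), (q', x))); split=> //.
  by rewrite mem_filter /= (sem_U Hs Ha) andbT; case/andP: Hi => -> ->.
by apply/plain_sem.
Qed.

(** The interface of the saturation: correctness of a construction can be argued with the least
    solution [sem] of its rules and inductive acceptance of trees, without reference to facts or
    chains. *)
Theorem plain_lang d t : tree_wf d n Sigma P t ->
  in_lang T' t <-> exists qf, qf \in finals /\ tacc trE ctl semE t qf 1 1.
Proof.
move=> Hwf; rewrite (in_langP mkplain_wf); split=> -[qf [Hf Ht]].
  case/mapP: Hf Ht => q Hq -> Ht; exists q; split=> //.
  by apply/(plain_tacc Hwf) => //; apply: finals_ok.
by exists (numq P qf); split; [apply: map_f | apply/(plain_tacc Hwf) => //; apply: finals_ok].
Qed.
End Plain.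

(** * Operations of one kind and lists of leaves *)

Lemma mem_flat_In (A : Type) (B : eqType) (f : A -> seq B) l y :
  y \in flatten (map f l) <-> exists a, List.In a l /\ y \in f a.
Proof.
elim: l => [|a l IH] /=; first by split=> // -[a []].
rewrite mem_cat; split=> [/orP[H|/IH[b [Hb Hy]]]|[b [[<-|Hb] Hy]]].
- by exists a; split; [left|].
- by exists b; split; [right|].
- by rewrite Hy.
by apply/orP; right; apply/IH; exists b.
Qed.

Lemma sel_stackP Th p o p' :
  (p, (o, p')) \in flatten (map sel_stack Th) <-> List.In (OpStack p o p') Th.
Proof.
split=> [/mem_flat_In[[q u q'|q qs|qs q]] [H]|H] //=.
  by rewrite inE => /eqP[-> -> ->].
by apply/mem_flat_In; exists (OpStack p o p'); split=> //=; rewrite inE.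
Qed.
Lemma sel_plusP Th p ps : (p, ps) \in flatten (map sel_plus Th) <-> List.In (OpPlus p ps) Th.
Proof.
split=> [/mem_flat_In[[q u q'|q qs|qs q]] [H]|H] //=.
  by rewrite inE => /eqP[-> ->].
by apply/mem_flat_In; exists (OpPlus p ps); split=> //=; rewrite inE.
Qed.
Lemma sel_minusP Th p ps : (ps, p) \in flatten (map sel_minus Th) <-> List.In (OpMinus ps p) Th.
Proof.
split=> [/mem_flat_In[[q u q'|q qs|qs q]] [H]|H] //=.
  by rewrite inE => /eqP[-> ->].
by apply/mem_flat_In; exists (OpMinus ps p); split=> //=; rewrite inE.
Qed.

Lemma nth_leaves (ps : seq nat) s j : j < size ps ->
  nth t0 [seq Leaf q s | q <- ps] j = Leaf (nth 0 ps j) s.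
Proof. by move=> Hj; rewrite (nth_map 0). Qed.

Lemma nth_zip_leaves (ps : seq nat) (ss : seq stack) j : size ss = size ps -> j < size ps ->
  nth t0 [seq Leaf x.1 x.2 | x <- zip ps ss] j = Leaf (nth 0 ps j) (nth (SEmpty 0) ss j).
Proof.
move=> E Hj; rewrite (nth_map (0, SEmpty 0)) ?nth_zip //.
by rewrite size_zip E minnn.
Qed.

Lemma size_zip_leaves (ps : seq nat) (ss : seq stack) : size ss = size ps ->
  size [seq Leaf x.1 x.2 | x <- zip ps ss] = size ps.
Proof. by move=> E; rewrite size_map size_zip E minnn. Qed.

(** * Runs within one global state *)

Section Star.
Variables (d n : nat) (Sigma P : seq nat) (Th : seq tree_op).
Notation twf := (tree_wf d n Sigma P).

Inductive star : tree -> tree -> Prop :=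
| star_refl t : star t t
| star_step th t t' t'' : List.In th Th -> twf t -> twf t' -> tree_op_sem n th t t' ->
    star t' t'' -> star t t''.

Lemma star_trans t t' t'' : star t t' -> star t' t'' -> star t t''.
Proof. by elim=> // th a b c H1 H2 H3 H4 _ IH /IH; apply: star_step H1 H2 H3 H4. Qed.

Lemma star_wf t t' : star t t' -> twf t -> twf t'.
Proof. by elim=> // th a b c _ _ Hb _ _ IH _; apply: IH. Qed.

Lemma twf_node s ts : twf (Node s ts) = [&& is_stack n Sigma n s, 0 < size ts <= d & all twf ts].
Proof. by []. Qed.

Lemma star_child s l r t t' : twf (Node s (l ++ t :: r)) -> star t t' ->
  star (Node s (l ++ t :: r)) (Node s (l ++ t' :: r)).
Proof.
move=> Hwf H; elim: H Hwf => [a|th a b c H1 H2 H3 H4 _ IH] Hwf; first exact: star_refl.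
have Hwf' : twf (Node s (l ++ b :: r)).
  by move: Hwf; rewrite !twf_node !size_cat !all_cat /= H3 => /and3P[-> -> /and3P[-> _ ->]].
by apply: star_step H1 Hwf Hwf' _ (IH Hwf'); apply: SemChild.
Qed.

Lemma star_children s ts ts' : twf (Node s ts) -> size ts' = size ts ->
  (forall j, j < size ts -> star (nth t0 ts j) (nth t0 ts' j)) -> star (Node s ts) (Node s ts').
Proof.
(* The children are rewritten from left to right; the induction is over the remaining ones, below an
   arbitrary prefix of finished ones. *)
move=> Hwf Hs H; rewrite -[ts]/([::] ++ ts) -[ts']/([::] ++ ts').
rewrite -[ts]/([::] ++ ts) in Hwf; elim: ts ts' [::] Hs H Hwf => [|t ts IH] [|t' ts'] l //=.
  by move=> *; apply: star_refl.
move=> [Hs] H Hwf; have H1 := star_child Hwf (H 0 isT).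
apply: star_trans H1 _; rewrite -!cat_rcons; apply: IH => //.
  by move=> j Hj; apply: (H j.+1).
by have := star_wf (star_child Hwf (H 0 isT)) Hwf; rewrite -cat_rcons.
Qed.

(** * The predecessors of a regular language under [star] *)

Variable T : caut.

Definition minus := flatten (map sel_minus Th).
Definition tQ (q : nat) : seq nat := [:: 1; q].
(* After the operation (p_1, ..., p_m) -- - --> p, read backwards, a node is in
   the state [tRho [:: p_1; ...; p_m]]: its children reduce to leaves p_i. *)
Definition tRho (ps : seq nat) : seq nat := 2 :: ps.
(* A hole (q, (i, m)) is the position of the i-th of m children under q, and
   [nm q i m p] names the set of stacks s such that the leaf (p, s) can be
   rewritten into a tree fitting that hole. *)
Definition nm (q : seq nat) (i m p : nat) : data := enc (p :: i :: m :: q).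
Definition nmz (q : seq nat) (i m p : nat) : data := st (nm q i m p) [::].

(** The number m of siblings ranges up to d + 1, so that the hole (1, 1) of the root exists for d =
    0 too. *)
Definition holes : seq (seq nat * (nat * nat)) :=
  flatten [seq flatten [seq [seq (q, (i, m)) | i <- iota 1 m] | m <- iota 0 d.+2]
          | q <- [seq tQ q | q <- cQ T] ++ [seq tRho x.1 | x <- minus]].
(** A node that stays is read by a transition of T. A node that some (p_1, ..., p_m) -- - --> p
    removes the children of becomes the leaf (p, s) in the same hole, so its stack must satisfy the
    name of that leaf. *)
Definition ntr : seq trans_t :=
  [seq (tQ t.1, ((t.2.1, t.2.2.1), (tQ t.2.2.2.1, bs 0 t.2.2.2.2.1))) | t <- cD T] ++
  flatten [seq [seq (h.1, (h.2, (tRho x.1, nmz h.1 h.2.1 h.2.2 x.2))) | x <- minus] | h <- holes].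
Definition ltr : seq trans_t :=
  flatten [seq [seq (h.1, (h.2, (ctl p, nmz h.1 h.2.1 h.2.2 p))) | p <- P] | h <- holes].
Definition snames : seq data :=
  flatten [seq [seq nm h.1 h.2.1 h.2.2 p | p <- P] | h <- holes].
Definition srule := (data * (option stack_op * seq data))%type.
(** In turn: the leaf is read by T; it is a child about to be removed, with any stack; a stack
    operation is applied; or a [+] operation is applied. In the last case the reading of the new
    node and the names of all its children are demanded of the same s. As the node is read by a
    member of [ntr], it may be contracted again later. *)
Definition srules : seq srule :=
  [seq (nm (tQ t.1) t.2.1 t.2.2.1 t.2.2.2.1, (None, [:: bs 0 t.2.2.2.2.1])) | t <- cD T] ++
  flatten [seq [seq (nm (tRho x.1) k.+1 (size x.1) (nth 0 x.1 k), (None, [::]))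
               | k <- iota 0 (size x.1)] | x <- minus] ++
  flatten [seq [seq (nm h.1 h.2.1 h.2.2 x.1, (Some x.2.1, [:: nmz h.1 h.2.1 h.2.2 x.2.2]))
               | h <- holes] | x <- flatten (map sel_stack Th)] ++
  flatten [seq [seq (nm t.1 t.2.1.1 t.2.1.2 x.1, (None, t.2.2.2 ::
                  [seq nmz t.2.2.1 k.+1 (size x.2) (nth 0 x.2 k) | k <- iota 0 (size x.2)]))
               | t <- ntr] | x <- [seq x <- flatten (map sel_plus Th) | size x.2 <= d]].

Definition prestar : caut :=
  mkplain n Sigma P [:: T] snames srules (ntr ++ ltr) [seq tQ q | q <- cF T].

Hypothesis n_gt0 : 0 < n.
Hypothesis Twf : automaton_wf n Sigma P (ofc T).
Hypothesis Thwf : forall th, List.In th Th -> tree_op_wf n Sigma P th.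

Lemma nm_inj q i m p q' i' m' p' : nm q i m p = nm q' i' m' p' ->
  [/\ q = q', i = i', m = m' & p = p'].
Proof. by move/(enc_seq_inj enc_nat_inj) => [-> -> -> ->]. Qed.
Lemma mem_holes q i m : (q, (i, m)) \in holes <->
  [/\ (exists q0, q0 \in cQ T /\ q = tQ q0) \/ (exists x, x \in minus /\ q = tRho x.1),
      0 < i <= m & m <= d.+1].
Proof.
split=> [/flatten_mapP[q1 Hq /flatten_mapP[m1 Hm /mapP[i1 Hi [-> -> ->]]]]|[Hq Hi Hm]].
  rewrite !mem_iota in Hm Hi; split; [|lia|lia].
  by move: Hq; rewrite mem_cat => /orP[/mapP[x Hx ->]|/mapP[x Hx ->]]; [left|right]; exists x.
apply/flatten_mapP; exists q.
  by rewrite mem_cat; case: Hq => -[x [Hx ->]]; apply/orP; [left|right]; apply/mapP; exists x.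
apply/flatten_mapP; exists m; first by rewrite mem_iota; lia.
by apply/mapP; exists i => //; rewrite mem_iota; lia.
Qed.

Lemma mem_ntr q i m q' z : (q, ((i, m), (q', z))) \in ntr <->
  (exists q0 q1 r, [/\ q = tQ q0, q' = tQ q1, z = bs 0 r & (q0, (i, m), (q1, r)) \in DeltaT (ofc T)]) \/
  (exists ps p, [/\ (ps, p) \in minus, q' = tRho ps, z = nmz q i m p & (q, (i, m)) \in holes]).
Proof.
rewrite mem_cat; split=> [/orP[/mapP[[a [b [c [e [f []]]]]] Ht [-> -> -> -> ->]]|]|].
- by left; exists a, e, f; rewrite mem_cD.
- case/flatten_mapP=> -[q1 [i1 m1]] Hh /mapP[[ps p] Hx [-> -> -> -> ->]].
  by right; exists ps, p.
case=> [[q0 [q1 [r [-> -> ->]]]]|[ps [p [Hx -> -> Hh]]]].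
  rewrite mem_cD => Ht; apply/orP; left; apply/mapP.
  by exists (q0, (i, (m, (q1, (r, tt))))).
apply/orP; right; apply/flatten_mapP; exists (q, (i, m)) => //.
by apply/mapP; exists (ps, p).
Qed.

Lemma mem_ltr q i m q' z : (q, ((i, m), (q', z))) \in ltr <->
  exists p, [/\ p \in P, q' = ctl p, z = nmz q i m p & (q, (i, m)) \in holes].
Proof.
split=> [/flatten_mapP[[q1 [i1 m1]] Hh /mapP[p Hp [-> -> -> -> ->]]]|[p [Hp -> -> Hh]]].
  by exists p.
by apply/flatten_mapP; exists (q, (i, m)) => //; apply/mapP; exists p.
Qed.

Lemma mem_snames q i m p : (q, (i, m)) \in holes -> p \in P -> nm q i m p \in snames.
Proof. by move=> Hh Hp; apply/flatten_mapP; exists (q, (i, m)) => //; apply/mapP; exists p. Qed.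

Definition srule_spec q i m p (oo : option stack_op) (Y : seq data) : Prop :=
  [\/ exists q0 r, [/\ q = tQ q0, oo = None, Y = [:: bs 0 r] & (q0, (i, m), (p, r)) \in DeltaT (ofc T)],
      exists ps p1 k, [/\ (ps, p1) \in minus, q = tRho ps, (i, m, p) = (k.+1, size ps, nth 0 ps k),
                      oo = None & Y = [::] /\ k < size ps],
      exists o p', [/\ List.In (OpStack p o p') Th, oo = Some o, Y = [:: nmz q i m p'] & (q, (i, m)) \in holes] |
      exists ps q' z, [/\ List.In (OpPlus p ps) Th, size ps <= d, oo = None,
                      (q, ((i, m), (q', z))) \in ntr &
                      Y = z :: [seq nmz q' k.+1 (size ps) (nth 0 ps k) | k <- iota 0 (size ps)]]].

Lemma srules_spec x oo Y : (x, (oo, Y)) \in srules ->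
  exists q i m p, x = nm q i m p /\ srule_spec q i m p oo Y.
Proof.
rewrite !mem_cat => /or4P[/mapP[[a [b [c [e [f []]]]]] Ht [-> -> ->]]|||].
- by exists (tQ a), b, c, e; split=> //; apply: Or41; exists a, f; rewrite mem_cD.
- case/flatten_mapP=> -[ps p1] Hx /mapP[k Hk [-> -> ->]].
  do 4 eexists; split=> //.
  by apply: Or42; exists ps, p1, k; split=> //; move: Hk; rewrite mem_iota.
- case/flatten_mapP=> -[p1 [o p']] Hx /mapP[[q1 [i1 m1]] Hh [-> -> ->]].
  do 4 eexists; split=> //.
  by apply: Or43; exists o, p'; split=> //; apply/sel_stackP.
case/flatten_mapP=> -[p1 ps]; rewrite mem_filter => /andP[Hs Hx].
case/mapP=> -[q1 [[i1 m1] [q' z]]] Ht [-> -> ->].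
do 4 eexists; split=> //.
by apply: Or44; exists ps, q', z; split=> //; apply/sel_plusP.
Qed.

Lemma mem_srules q i m p oo Y : srule_spec q i m p oo Y -> (nm q i m p, (oo, Y)) \in srules.
Proof.
rewrite !mem_cat; case.
- move=> [q0 [r [-> -> ->]]]; rewrite mem_cD => Ht; apply/or4P; apply: Or41.
  by apply/mapP; exists (q0, (i, (m, (p, (r, tt))))).
- move=> [ps [p1 [k [Hx -> [-> -> ->] -> [-> Hk]]]]]; apply/or4P; apply: Or42.
  by apply/flatten_mapP; exists (ps, p1) => //; apply/mapP; exists k; rewrite ?mem_iota.
- move=> [o [p' [/sel_stackP Hx -> -> Hh]]]; apply/or4P; apply: Or43.
  by apply/flatten_mapP; exists (p, (o, p')) => //; apply/mapP; exists (q, (i, m)).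
move=> [ps [q' [z [/sel_plusP Hx Hs -> Ht ->]]]]; apply/or4P; apply: Or44.
apply/flatten_mapP; exists (p, ps); first by rewrite mem_filter Hs.
by apply/mapP; exists (q, ((i, m), (q', z))).
Qed.

Lemma srules_ok x o Y : (x, (Some o, Y)) \in srules -> in_Ops n Sigma o /\ Y != [::].
Proof.
case/srules_spec=> q [i [m [p [_]]]].
case=> [[q0 [r [_ //]]]|[ps [p1 [k [_ _ _ //]]]]|[o' [p' [Hin [->] -> _]]]|[ps [q' [z [_ _ //]]]]].
by have /and3P[] := Thwf Hin.
Qed.

Lemma minusP ps p : (ps, p) \in minus -> [/\ all (mem P) ps, 0 < size ps & p \in P].
Proof. by move/sel_minusP/Thwf/and3P. Qed.

Lemma DT_wf q i m q' r : (q, (i, m), (q', r)) \in DeltaT (ofc T) ->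
  [/\ q \in cQ T, 1 <= i <= m, q' \in cQ T & q' \notin cF T].
Proof. by case/(wf_Delta Twf). Qed.

Lemma strans_ok q i m q' z : trE (ntr ++ ltr) q i m q' z ->
  [/\ okq P q, okq P q' & q' \notin [seq tQ q | q <- cF T]].
Proof.
have Hok q1 h : (q1, h) \in holes -> okq P q1.
  by case: h => i1 m1 /mem_holes[[[q0 [_ ->]]|[x [_ ->]]]].
rewrite /trE mem_cat => /orP[/mem_ntr[[q0 [q1 [r [-> -> _ Ht]]]]|[ps [p [Hx -> _ Hh]]]]|/mem_ltr[p [Hp -> _ Hh]]].
- split=> //; apply/mapP => -[f Hf [E]]; subst q1.
  by have [_ _ _] := DT_wf Ht; rewrite Hf.
- by split=> //; [apply: Hok Hh | apply/mapP => -[]].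
by split; [apply: Hok Hh | rewrite /okq /= eqxx Hp | apply/mapP => -[]].
Qed.

Notation semS := (sem n Sigma (bD [:: T]) (bF [:: T]) (bC [:: T]) snames srules).
Notation taccS := (tacc (trE (ntr ++ ltr)) ctl semS).

Lemma semS_base r s : is_stack n Sigma n s -> semS (bs 0 r) s <-> stack_accepted (ofc T) s r.
Proof.
move=> Hs; have := Hs; rewrite is_stackE => /and3P[H0 /eqP Eo W].
have H := @bden_accepted [:: T] n Sigma 0 isT s _ W r; rewrite Eo in H.
by split=> [/sem_isb-/(_ isT)/(H H0)//|/(H H0) Hb]; apply: sem_base.
Qed.

(* The trees that fit a hole without any further rewriting. *)
Definition fits (q : seq nat) i m t : Prop :=
  (exists q0, q = tQ q0 /\ taccT (ofc T) t q0 i m) \/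
  (exists ps s, [/\ q = tRho ps, m = size ps & t = Leaf (nth 0 ps i.-1) s]).

(** The children are rewritten first; then either the node is read by T, or its children have become
    the expected leaves, [-] applies and the name z takes over. What names mean is an assumption, as
    the lemma is also used inside the induction that proves it. *)
Lemma node_sound s ts q i m q' z : twf (Node s ts) ->
  (q, ((i, m), (q', z))) \in ntr -> semS z s ->
  (forall p, z = nmz q i m p -> p \in P -> exists t', star (Leaf p s) t' /\ fits q i m t') ->
  (forall j, j < size ts -> exists t', star (nth t0 ts j) t' /\ fits q' j.+1 (size ts) t') ->
  exists t', star (Node s ts) t' /\ fits q i m t'.
Proof.
move=> Hwf Hn Hz Hnm Hts; have := Hwf; rewrite twf_node => /and3P[Hs Hsz Hall].
have [f Hf] := finite_choice t0 Hts.
have Hst : star (Node s ts) (Node s (mkseq f (size ts))).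
  by apply: star_children => //; rewrite ?size_mkseq // => j Hj; rewrite nth_mkseq //; case: (Hf _ Hj).
case/mem_ntr: Hn => [[q0 [q1 [r [Eq Eq' Ez Ht]]]]|[ps [p [Hx Eq' Ez Hh]]]].
  exists (Node s (mkseq f (size ts))); split=> //; left; exists q0; split=> //.
  apply/tacc_nodeE; exists q1, r; split=> //.
    by apply/semS_base => //; rewrite -Ez.
  move=> j; rewrite size_mkseq => Hj; rewrite nth_mkseq //.
  have [_ [[q2 [E Hacc]]|[ps [s1 [E _ _]]]]] := Hf _ Hj; last by move: E; rewrite Eq'.
  by move: E; rewrite Eq' => -[->].
have [Hps Hps0 Hp] := minusP Hx.
have Hleaf j : j < size ts -> size ts = size ps /\ exists s', f j = Leaf (nth 0 ps j) s'.
  move=> Hj; have [_ [[q2 [E _]]|[ps' [s1 [E Em Ef]]]]] := Hf _ Hj; first by move: E; rewrite Eq'.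
  by move: E; rewrite Eq' => -[E]; subst ps'; split=> //; exists s1.
have [Esz _] : size ts = size ps /\ exists s', f 0 = Leaf (nth 0 ps 0) s'.
  by apply: Hleaf; case/andP: Hsz.
have [g Hg] := finite_choice (SEmpty 0) (fun j Hj => (Hleaf j Hj).2).
have Emk : mkseq f (size ts) = [seq Leaf x.1 x.2 | x <- zip ps (mkseq g (size ps))].
  apply: (@eq_from_nth _ t0); first by rewrite size_mkseq size_zip_leaves ?size_mkseq.
  move=> j; rewrite size_mkseq => Hj; rewrite nth_mkseq // Hg // nth_zip_leaves ?size_mkseq -?Esz //.
  by rewrite nth_mkseq.
have [t' [Ht' Hfit]] := Hnm p Ez Hp.
exists t'; split=> //; apply: (star_trans Hst).
have Hwf' := star_wf Hst Hwf.
apply: star_step _ (star_wf Hst Hwf) _ _ Ht'.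
- by apply/sel_minusP; apply: Hx.
- by rewrite /= Hp Hs.
by rewrite Emk; apply: SemMinus; rewrite size_mkseq.
Qed.

(** Here leastness is used: the finite derivation of membership in a name unfolds into a finite
    rewriting sequence. *)
Lemma name_sound z s : semS z s -> is_stack n Sigma n s ->
  forall q i m p, z = nmz q i m p -> p \in P -> exists t', star (Leaf p s) t' /\ fits q i m t'.
Proof.
elim=> {z s} [z s Hz _ _ q i m p Ez|x oo Y s s' Hs _ Hr Ho HY IH _ q i m p Ex Hp].
  by move: Hz; rewrite Ez.
have [{}Ex _] := st_inj Ex; subst x.
have [q1 [i1 [m1 [p1 [/nm_inj[<- <- <- <-] {Hr q1 i1 m1 p1} Hr]]]]] := srules_spec Hr.
have Hwf : twf (Leaf p s) by rewrite /= Hp Hs.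
case: Hr => [[q0 [r [Eq Eo EY Ht]]]|[ps [p1 [k [Hx Eq [Ei Em Ep] Eo [EY Hk]]]]]
    |[o [p' [Hin Eo EY Hh]]]|[ps [q' [z [Hin Hsz Eo Hn EY]]]]]; subst oo Y.
- exists (Leaf p s); split; first exact: star_refl.
  left; exists q0; split=> //; apply/tacc_leafE; exists r; split=> //.
  by apply/semS_base => //; rewrite -Ho; apply: HY; rewrite mem_head.
- exists (Leaf p s); split; first exact: star_refl.
  by right; exists ps, s; rewrite Ep Ei.
- have /and3P[_ Hop Hp'] := Thwf Hin.
  have Hs' := op_sem_wf Hop Hs Ho.
  have [t' [Ht' Hf]] := IH _ (mem_head _ _) Hs' q i m p' erefl Hp'.
  exists t'; split=> //; apply: star_step Hin Hwf _ (SemStack _ _ Ho) Ht'.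
  by rewrite /= Hp' Hs'.
move: Ho => /= Es; subst s'.
have /and3P[_ Hps0 Hps] := Thwf Hin.
have Hwf' : twf (Node s [seq Leaf q s | q <- ps]).
  rewrite twf_node size_map Hs Hsz Hps0 /= all_map; apply: sub_all Hps => y /= Hy.
  by rewrite Hs andbT.
have [t' [Ht' Hf]] : exists t', star (Node s [seq Leaf q s | q <- ps]) t' /\ fits q i m t'.
  apply: (node_sound Hwf' Hn); first by apply: HY; rewrite mem_head.
    by move=> p1 Ez Hp1; apply: IH Hs _ _ _ _ Ez Hp1; rewrite mem_head.
  rewrite size_map => j Hj; rewrite nth_leaves //.
  apply: (IH (nmz q' j.+1 (size ps) (nth 0 ps j))) => //.
    by rewrite inE; apply/orP; right; apply/mapP; exists j; rewrite ?mem_iota.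
  exact: (allP Hps) (mem_nth _ Hj).
by exists t'; split=> //; apply: star_step Hin Hwf Hwf' (SemPlus _ _ _ _) Ht'.
Qed.

Lemma tacc_sound t q i m : taccS t q i m -> twf t -> exists t', star t t' /\ fits q i m t'.
Proof.
elim=> {t q i m} [p s q i m x Ht Ha /= /andP[Hp Hs]|s ts q i m q' x Ht Ha _ IH Hwf].
  move: Ht; rewrite /trE mem_cat => /orP[/mem_ntr[[q0 [q1 [r [_ //]]]]|[ps [p1 [_ //]]]]|].
  by case/mem_ltr=> p1 [Hp1 [E] Ex _]; subst p1; apply: name_sound Ha Hs _ _ _ _ Ex Hp.
have := Hwf; rewrite twf_node => /and3P[Hs Hsz Hall].
have Hch j : j < size ts -> exists t', star (nth t0 ts j) t' /\ fits q' j.+1 (size ts) t'.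
  by move=> Hj; apply: IH => //; apply: (all_nthP t0 Hall).
move: Ht; rewrite /trE mem_cat => /orP[Hn|/mem_ltr[p [_ Eq' _ _]]].
  apply: (node_sound Hwf Hn Ha) => // p Ez Hp.
  by apply: name_sound Ha Hs _ _ _ _ Ez Hp.
(* A leaf transition at an inner node leads to a control state, which no tree fits; yet the node has
   a child. *)
have [|t' [_ [[q2 [E _]]|[ps [s1 [E _ _]]]]]] := Hch 0; first by case/andP: Hsz.
  by move: E; rewrite Eq'.
by move: E; rewrite Eq'.
Qed.

(** No transition starts in a control state, so an accepted child lies below a state of T or a state
    [tRho], that is, in a hole. *)
Lemma hole_child q i m q' z s ts j :
  trE (ntr ++ ltr) q i m q' z -> twf (Node s ts) -> j < size ts ->
  taccS (nth t0 ts j) q' j.+1 (size ts) -> (q', (j.+1, size ts)) \in holes.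
Proof.
move=> Ht Hwf Hj Hc; have := Hwf; rewrite twf_node => /and3P[_ Hsz _].
have Hn x h : (ctl x, h) \in ntr ++ ltr -> False.
  case: h => -[i1 m1] [q1 z1]; rewrite mem_cat.
  have Hh : (ctl x, (i1, m1)) \in holes -> False by case/mem_holes=> -[[q0 [_ //]]|[x1 [_ //]]].
  by case/orP=> [/mem_ntr[[q0 [q2 [r [//]]]]|[ps [p1 [_ _ _]]]]|/mem_ltr[p1 [_ _ _]]].
apply/mem_holes; split; [|lia|lia].
move: Ht; rewrite /trE mem_cat => /orP[/mem_ntr[[q0 [q1 [r [_ -> _ Ht]]]]|[ps [p [Hx -> _ _]]]]|].
- by left; exists q1; split=> //; have [] := DT_wf Ht.
- by right; exists (ps, p).
case/mem_ltr=> p [_ Eq _ _]; subst q'; exfalso; move: Hc; case: (nth t0 ts j) => [p1 s1|s1 ts1].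
  by case/tacc_leafE=> x [Ht _]; apply: Hn Ht.
by case/tacc_nodeE=> q1 [x [Ht _ _]]; apply: Hn Ht.
Qed.

Lemma leaf_sem p s q i m : taccS (Leaf p s) q i m -> semS (nmz q i m p) s.
Proof.
case/tacc_leafE=> x []; rewrite /trE mem_cat => /orP[/mem_ntr[[q0 [q1 [r [_ //]]]]|[ps [p1 [_ //]]]]|].
by case/mem_ltr=> p1 [_ [->] -> _].
Qed.

Lemma tacc_leaf_intro p s q i m : p \in P -> (q, (i, m)) \in holes ->
  semS (nmz q i m p) s -> taccS (Leaf p s) q i m.
Proof.
move=> Hp Hh Hs; apply/tacc_leafE; exists (nmz q i m p); split=> //.
by rewrite /trE mem_cat; apply/orP; right; apply/mem_ltr; exists p.
Qed.

(** Closure under one backward step, by induction on the position: at the rewritten place one of the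
    rules of [srules] or the contracting transition of [ntr] applies, and above it the accepting
    transitions stay the same. *)
Lemma tacc_step th t t' : List.In th Th -> tree_op_sem n th t t' -> twf t -> twf t' ->
  forall q i m, (q, (i, m)) \in holes -> taccS t' q i m -> taccS t q i m.
Proof.
move=> Hin Hth; elim: Hth Hin => {th t t'}.
- move=> p o p' s s' Ho Hin /= /andP[Hp Hs] /andP[Hp' Hs'] q i m Hh /leaf_sem Hsem.
  apply: tacc_leaf_intro => //; apply: (sem_rule Hs (mem_snames Hh Hp) (oo := Some o) (Y := [:: nmz q i m p']) _ Ho).
    by apply: mem_srules; apply: Or43; exists o, p'.
  by move=> y; rewrite inE => /eqP->.
- move=> p ps s Hin /= /andP[Hp Hs] /and3P[_ Hsz Hall] q i m Hh /tacc_nodeE[q' [x [Ht Hx Hc]]].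
  rewrite size_map in Hsz Hc.
  (* The new node has accepted children, so q' is not a control state and its transition is not a
     leaf transition. *)
  have Hntr : (q, ((i, m), (q', x))) \in ntr.
    have [Hs0 _] := andP Hsz.
    have Hwf : twf (Node s [seq Leaf q s | q <- ps]) by rewrite twf_node Hs size_map Hsz.
    have := @hole_child q i m q' x s [seq Leaf q s | q <- ps] 0 Ht Hwf; rewrite size_map.
    move=> /(_ Hs0 (Hc 0 Hs0))/mem_holes[Hq' _ _].
    move: Ht; rewrite /trE mem_cat => /orP[//|/mem_ltr[p1 [_ E _ _]]].
    by move: Hq'; rewrite E => -[[q0 [_ //]]|[y [_ //]]].
  apply: tacc_leaf_intro => //; apply: (sem_rule Hs (mem_snames Hh Hp) (oo := None)
    (Y := x :: [seq nmz q' k.+1 (size ps) (nth 0 ps k) | k <- iota 0 (size ps)])) => //.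
    by apply: mem_srules; apply: Or44; exists ps, q', x; split=> //; case/andP: Hsz.
  move=> y; rewrite inE => /orP[/eqP-> //|/mapP[k]]; rewrite mem_iota => /= Hk ->.
  by apply: leaf_sem; have := Hc _ Hk; rewrite nth_leaves.
- move=> ps p s ss Esz Hin Hwf /= /andP[Hp Hs] q i m Hh /leaf_sem Hsem.
  have := Hwf; rewrite twf_node size_zip_leaves // => /and3P[_ Hsz Hall].
  have Hx : (ps, p) \in minus by apply/sel_minusP.
  have Hps := (allP (proj1 (andP (Thwf Hin)))).
  apply/tacc_nodeE; exists (tRho ps), (nmz q i m p); split=> //.
    by rewrite /trE mem_cat; apply/orP; left; apply/mem_ntr; right; exists ps, p.
  rewrite size_zip_leaves // => j Hj; rewrite nth_zip_leaves //.
  have Hpj : nth 0 ps j \in P by apply: Hps; apply: mem_nth.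
  have Hhj : (tRho ps, (j.+1, size ps)) \in holes.
    by apply/mem_holes; split; [right; exists (ps, p) | lia | lia].
  have /= := all_nthP t0 Hall j; rewrite size_zip_leaves // nth_zip_leaves // => /(_ Hj)/andP[_ Hsj].
  apply: tacc_leaf_intro => //; apply: (sem_rule Hsj (mem_snames Hhj Hpj) (oo := None) (Y := [::])) => //.
  by apply: mem_srules; apply: Or42; exists ps, p, j.
move=> th s l t t' r _ IH Hin Hwf Hwf' q i m Hh /tacc_nodeE[q' [x [Ht Hx Hc]]].
have Esz : size (l ++ t :: r) = size (l ++ t' :: r) by rewrite !size_cat.
apply/tacc_nodeE; exists q', x; split=> // j Hj; rewrite Esz in Hj *.
have := Hc j Hj; rewrite !nth_cat; case: ltnP => // Hlj.
case Ej: (j - size l) => [|k] //= Hc'.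
have [Ht1 Ht1'] : twf t /\ twf t'.
  by move: Hwf Hwf'; rewrite !twf_node !all_cat /= => /and3P[_ _ /and3P[_ -> _]] /and3P[_ _ /and3P[_ -> _]].
apply: IH => //; apply: (hole_child Ht Hwf' Hj); apply: Hc => //.
Qed.

Lemma tacc_init t q0 i m : taccT (ofc T) t q0 i m -> twf t -> m <= d.+1 -> taccS t (tQ q0) i m.
Proof.
elim=> {t q0 i m} [p s q i m r Ht Ha /= /andP[Hp Hs] Hm|s ts q i m q' r Ht Ha _ IH Hwf Hm].
  have [Hq Hi _ _] := DT_wf Ht.
  have Hh : (tQ q, (i, m)) \in holes by apply/mem_holes; split=> //; left; exists q.
  apply: tacc_leaf_intro => //; apply: (sem_rule Hs (mem_snames Hh Hp) (oo := None) (Y := [:: bs 0 r])) => //.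
    by apply: mem_srules; apply: Or41; exists q, r.
  by move=> y; rewrite inE => /eqP->; apply/semS_base.
have := Hwf; rewrite twf_node => /and3P[Hs Hsz Hall].
apply/tacc_nodeE; exists (tQ q'), (bs 0 r); split.
- by rewrite /trE mem_cat; apply/orP; left; apply/mem_ntr; left; exists q, q', r.
- exact/semS_base.
move=> j Hj; apply: IH => //; first by apply: (all_nthP t0 Hall).
by lia.
Qed.

Lemma Ts_wf i : i < size [:: T] -> automaton_wf n Sigma P (ofc (nth c0 [:: T] i)).
Proof. by case: i. Qed.

Lemma tQ_ok q : q \in [seq tQ q | q <- cF T] -> okq P q.
Proof. by case/mapP=> q0 _ ->. Qed.

Theorem prestar_wf : automaton_wf n Sigma P (ofc prestar).
Proof. by apply: mkplain_wf; [exact: n_gt0 | exact: Ts_wf | exact: srules_ok | exact: strans_ok | exact: tQ_ok]. Qed.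

Theorem prestar_lang t : twf t ->
  in_lang (ofc prestar) t <-> exists t', star t t' /\ in_lang (ofc T) t'.
Proof.
move=> Hwf; have Hlang : in_lang (ofc prestar) t <->
    exists qf, qf \in [seq tQ q | q <- cF T] /\ taccS t qf 1 1.
  by apply: plain_lang Hwf; [exact: n_gt0 | exact: Ts_wf | exact: srules_ok | exact: strans_ok | exact: tQ_ok].
split=> [/Hlang[qf [/mapP[q Hq ->]] /tacc_sound-/(_ Hwf)[t' [Hst Hf]]]|[t' [Hst /(in_langP Twf)[qf [Hqf Ht]]]]].
  exists t'; split=> //; apply/(in_langP Twf); exists q; split=> //.
  by case: Hf => [[q0 [[<-]]]|[ps [s [//]]]].
apply/Hlang; exists (tQ qf); split; first exact: map_f.
have Hh : (tQ qf, (1, 1)) \in holes.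
  by apply/mem_holes; split=> //; left; exists qf; split=> //; apply: (wf_F Twf).
elim: Hst Hwf Ht => [a Ha Hacc|th a b c H1 H2 H3 H4 _ IH _ Hacc].
  exact: tacc_init.
by apply: (tacc_step H1 H4 H2 H3 Hh); apply: IH.
Qed.

End Star.

(** * Unions of languages and of their one-step predecessors *)

Section OneStep.
Variables (d n : nat) (Sigma P : seq nat) (L : seq (seq tree_op * caut)).
Notation twf := (tree_wf d n Sigma P).

Definition ops k : seq tree_op := (nth ([::], c0) L k).1.
Definition aut k : caut := (nth ([::], c0) L k).2.

(* In [q0s k q] the tree is read as by the k-th automaton; in [q1s k q j] an
   operation remains to be applied inside the j-th child, and nowhere else. *)
Definition q0s (k q : nat) : seq nat := [:: 1; k; q].
Definition q1s (k q j : nat) : seq nat := [:: 2; k; q; j].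
Definition rhos (ps : seq nat) : seq nat := 3 :: ps.

(** At the i-th child, the guess j in [q1s] is compared with i. For j different from i the child is
    read unchanged. For j = i the operation lies strictly below this child, whence a new guess, or
    it is a [-] at this child, whence [rhos]; an operation at a leaf is left to the rules for
    names. *)
Definition dntr : seq trans_t := flatten [seq flatten [seq
    (q0s k t.1, ((t.2.1, t.2.2.1), (q0s k t.2.2.2.1, bs k t.2.2.2.2.1))) ::
    [seq (q1s k t.1 j, ((t.2.1, t.2.2.1), (q0s k t.2.2.2.1, bs k t.2.2.2.2.1)))
      | j <- [seq j <- iota 1 t.2.2.1 | j != t.2.1]] ++
    [seq (q1s k t.1 t.2.1, ((t.2.1, t.2.2.1), (q1s k t.2.2.2.1 j, bs k t.2.2.2.2.1))) | j <- iota 1 d] ++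
    [seq (q1s k t.1 t.2.1, ((t.2.1, t.2.2.1), (rhos x.1, bs k t.2.2.2.2.1)))
      | x <- [seq x <- flatten (map sel_minus (ops k)) | x.2 == t.2.2.2.1]]
  | t <- cD (aut k)] | k <- iota 0 (size L)].

Definition lrule := (seq nat * ((nat * nat) * (nat * (option stack_op * seq data))))%type.

(** The demands are not circular: rules for [q1s] refer only to base states and to names below
    [q0s], whose rules refer to base states alone. This is what limits the number of operations to
    one. *)
Definition lrules0 : seq lrule := flatten [seq
  flatten [seq
    (q0s k t.1, ((t.2.1, t.2.2.1), (t.2.2.2.1, (None, [:: bs k t.2.2.2.2.1])))) ::
    [seq (q1s k t.1 j, ((t.2.1, t.2.2.1), (t.2.2.2.1, (None, [:: bs k t.2.2.2.2.1]))))
      | j <- [seq j <- iota 1 t.2.2.1 | j != t.2.1]] ++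
    [seq (q1s k t.1 t.2.1, ((t.2.1, t.2.2.1), (x.1, (Some x.2.1, [:: bs k t.2.2.2.2.1]))))
      | x <- [seq x <- flatten (map sel_stack (ops k)) | x.2.2 == t.2.2.2.1]] ++
    [seq (q1s k t.1 t.2.1, ((t.2.1, t.2.2.1), (x.1, (None, bs k t.2.2.2.2.1 ::
         [seq nmz (q0s k t.2.2.2.1) l.+1 (size x.2) (nth 0 x.2 l) | l <- iota 0 (size x.2)]))))
      | x <- [seq x <- flatten (map sel_plus (ops k)) | size x.2 <= d]]
  | t <- cD (aut k)] ++
  flatten [seq [seq (rhos x.1, ((l.+1, size x.1), (nth 0 x.1 l, (None, [::])))) | l <- iota 0 (size x.1)]
    | x <- flatten (map sel_minus (ops k))]
  | k <- iota 0 (size L)].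
(** Transitions of the automata may lead to any state, but only control states label leaves. *)
Definition lrules : seq lrule := [seq x <- lrules0 | x.2.2.1 \in P].

Definition dnames : seq data := [seq nm x.1 x.2.1.1 x.2.1.2 x.2.2.1 | x <- lrules].
Definition drules : seq srule := [seq (nm x.1 x.2.1.1 x.2.1.2 x.2.2.1, x.2.2.2) | x <- lrules].
Definition dltr : seq trans_t :=
  [seq (x.1, (x.2.1, (ctl x.2.2.1, nmz x.1 x.2.1.1 x.2.1.2 x.2.2.1))) | x <- lrules].
(** An entry without operations contributes the language of its automaton rather than an empty set
    of predecessors, so it starts in [q0s], with no operation pending. Otherwise the guess 1 stands
    for the root as the only child. *)
Definition dfinals : seq (seq nat) := flatten [seq
  if nilp (ops k) then [seq q0s k q | q <- cF (aut k)] else [seq q1s k q 1 | q <- cF (aut k)]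
  | k <- iota 0 (size L)].

Definition onestep : caut := mkplain n Sigma P [seq x.2 | x <- L] dnames drules (dntr ++ dltr) dfinals.

Hypothesis n_gt0 : 0 < n.
Hypothesis Lwf : forall k, k < size L -> automaton_wf n Sigma P (ofc (aut k)) /\
  forall th, List.In th (ops k) -> tree_op_wf n Sigma P th.

Definition dntr_spec q i m q' z : Prop := exists k q0 q1 r, [/\ k < size L,
  (q0, (i, m), (q1, r)) \in DeltaT (ofc (aut k)), z = bs k r &
  [\/ q = q0s k q0 /\ q' = q0s k q1,
      exists j, [/\ q = q1s k q0 j, 0 < j <= m, j != i & q' = q0s k q1],
      exists j, [/\ q = q1s k q0 i, 0 < j <= d & q' = q1s k q1 j] |
      exists ps, [/\ q = q1s k q0 i, List.In (OpMinus ps q1) (ops k) & q' = rhos ps]]].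

Lemma mem_dntr q i m q' z : (q, ((i, m), (q', z))) \in dntr <-> dntr_spec q i m q' z.
Proof.
split.
  case/flatten_mapP=> k; rewrite mem_iota => /= Hk /flatten_mapP[[a [b [c [e [f []]]]]]].
  rewrite -mem_cD /= => Ht; rewrite inE !mem_cat => /or4P[/eqP[-> -> -> -> ->]|||].
  - by exists k, a, e, f; split=> //; apply: Or41.
  - case/mapP=> j; rewrite mem_filter mem_iota => /andP[Hj1 Hj] [-> -> -> -> ->].
    by exists k, a, e, f; split=> //; apply: Or42; exists j; split=> //; lia.
  - case/mapP=> j; rewrite mem_iota => Hj [-> -> -> -> ->].
    by exists k, a, e, f; split=> //; apply: Or43; exists j; split=> //; lia.
  case/mapP=> -[ps p]; rewrite mem_filter => /andP[/= /eqP-> /sel_minusP Hx] [-> -> -> -> ->].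
  by exists k, a, e, f; split=> //; apply: Or44; exists ps.
move=> [k [q0 [q1 [r [Hk Ht -> H]]]]]; apply/flatten_mapP; exists k; first by rewrite mem_iota.
rewrite mem_cD in Ht; apply/flatten_mapP; exists (q0, (i, (m, (q1, (r, tt))))) => //=.
rewrite inE !mem_cat; apply/or4P; case: H => [[-> ->]|[j [-> Hj Hji ->]]|[j [-> Hj ->]]|[ps [-> Hx ->]]].
- by apply: Or41; apply/eqP.
- by apply: Or42; apply/mapP; exists j => //; rewrite mem_filter Hji mem_iota; lia.
- by apply: Or43; apply/mapP; exists j => //; rewrite mem_iota; lia.
by apply: Or44; apply/mapP; exists (ps, q1) => //; rewrite mem_filter eqxx; apply/sel_minusP.
Qed.

Definition lrule_spec q i m p (oo : option stack_op) (Y : seq data) : Prop :=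
  exists k, k < size L /\ ((exists q0 q1 r,
   (q0, (i, m), (q1, r)) \in DeltaT (ofc (aut k)) /\
   [\/ [/\ q = q0s k q0, p = q1, oo = None & Y = [:: bs k r]],
       exists j, [/\ q = q1s k q0 j, 0 < j <= m, j != i, p = q1 & oo = None /\ Y = [:: bs k r]],
       exists o, [/\ q = q1s k q0 i, List.In (OpStack p o q1) (ops k), oo = Some o & Y = [:: bs k r]] |
       exists ps, [/\ q = q1s k q0 i, List.In (OpPlus p ps) (ops k), size ps <= d, oo = None &
         Y = bs k r :: [seq nmz (q0s k q1) l.+1 (size ps) (nth 0 ps l) | l <- iota 0 (size ps)]]]) \/
   exists ps p1 l, [/\ q = rhos ps, List.In (OpMinus ps p1) (ops k), l < size ps,
       (i, m, p) = (l.+1, size ps, nth 0 ps l) & oo = None /\ Y = [::]]).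

Lemma mem_lrules q i m p oo Y : (q, ((i, m), (p, (oo, Y)))) \in lrules <->
  p \in P /\ lrule_spec q i m p oo Y.
Proof.
rewrite mem_filter; split.
  case/andP=> /= Hp H; split; first exact: Hp.
  case/flatten_mapP: H {Hp} => k; rewrite mem_iota => /= Hk; rewrite mem_cat => /orP[|]; last first.
    case/flatten_mapP=> -[ps p1] /sel_minusP Hx /mapP[l]; rewrite mem_iota => Hl [-> -> -> -> -> ->].
    by exists k; split=> //; right; exists ps, p1, l.
  case/flatten_mapP=> -[a [b [c [e [f []]]]]]; rewrite -mem_cD /= => Ht.
  rewrite inE !mem_cat => H; exists k; split=> //; left; exists a, e, f.
  case/or4P: H => [/eqP[-> -> -> -> -> ->]|||].
  - by split=> //; apply: Or41.
  - case/mapP=> j; rewrite mem_filter mem_iota => /andP[Hj1 Hj] [-> -> -> -> -> ->].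
    by split=> //; apply: Or42; exists j; split=> //; lia.
  - case/mapP=> -[p1 [o p2]]; rewrite mem_filter => /andP[/= /eqP-> /sel_stackP Hx] [-> -> -> -> -> ->].
    by split=> //; apply: Or43; exists o.
  case/mapP=> -[p1 ps]; rewrite mem_filter => /andP[/= Hs /sel_plusP Hx] [-> -> -> -> -> ->].
  by split=> //; apply: Or44; exists ps.
move=> [Hp [k [Hk H]]]; rewrite /= Hp; apply/flatten_mapP; exists k; first by rewrite mem_iota.
rewrite mem_cat; apply/orP; case: H => [[q0 [q1 [r [Ht H]]]]|[ps [p1 [l [-> Hx Hl [-> -> ->] [-> ->]]]]]].
  left; rewrite mem_cD in Ht; apply/flatten_mapP; exists (q0, (i, (m, (q1, (r, tt))))) => //=.
  rewrite inE !mem_cat; apply/or4P.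
  case: H => [[-> -> -> ->]|[j [-> Hj Hji -> [-> ->]]]|[o [-> Hx -> ->]]|[ps [-> Hx Hs -> ->]]].
  - by apply: Or41; apply/eqP.
  - by apply: Or42; apply/mapP; exists j => //; rewrite mem_filter Hji mem_iota; lia.
  - apply: Or43; apply/mapP; exists (p, (o, q1)) => //; rewrite mem_filter eqxx; exact/sel_stackP.
  apply: Or44; apply/mapP; exists (p, ps) => //; rewrite mem_filter Hs; exact/sel_plusP.
right; apply/flatten_mapP; exists (ps, p1); first exact/sel_minusP.
by apply/mapP; exists l => //; rewrite mem_iota.
Qed.

Lemma aut_nth k : k < size L -> nth c0 [seq x.2 | x <- L] k = aut k.
Proof. by move=> Hk; rewrite (nth_map ([::], c0)). Qed.

Lemma dTs_wf k : k < size [seq x.2 | x <- L] -> automaton_wf n Sigma P (ofc (nth c0 [seq x.2 | x <- L] k)).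
Proof. by rewrite size_map => Hk; rewrite aut_nth //; case: (Lwf Hk). Qed.

Lemma drules_ok x o Y : (x, (Some o, Y)) \in drules -> in_Ops n Sigma o /\ Y != [::].
Proof.
case/mapP=> -[q [[i m] [p [oo Y']]]] /mem_lrules[_ [k [Hk H]]] [_ Eo EY]; rewrite /= in Eo EY; subst oo Y'.
case: H => [[q0 [q1 [r [_ H]]]]|[ps [p1 [l [_ _ _ _ [//]]]]]].
case: H => [[_ _ //]|[j [_ _ _ _ [//]]]|[o1 [_ Hx [->] ->]]|[ps [_ _ _ //]]].
by have [_ /(_ _ Hx)/and3P[]] := Lwf Hk.
Qed.

Lemma dDT_wf k q i m q' r : k < size L -> (q, (i, m), (q', r)) \in DeltaT (ofc (aut k)) ->
  [/\ 1 <= i <= m, q' \in cQ (aut k) & q' \notin cF (aut k)].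
Proof. by move=> Hk; have [H _] := Lwf Hk; case/(wf_Delta H). Qed.

Lemma mem_dfinals q : q \in dfinals <-> exists k q0, [/\ k < size L, q0 \in cF (aut k) &
  q = if nilp (ops k) then q0s k q0 else q1s k q0 1].
Proof.
split.
  case/flatten_mapP=> k; rewrite mem_iota => Hk; case: ifP => E /mapP[q0 Hq ->];
    by exists k, q0; rewrite E.
case=> k [q0 [Hk Hq ->]]; apply/flatten_mapP; exists k; first by rewrite mem_iota.
by case: ifP => _; apply: map_f.
Qed.

Lemma dtrans_ok q i m q' z : trE (dntr ++ dltr) q i m q' z ->
  [/\ okq P q, okq P q' & q' \notin dfinals].
Proof.
rewrite /trE mem_cat => /orP[/mem_dntr[k [q0 [q1 [r [Hk Ht _ H]]]]]|].
  have [_ _ Hf] := dDT_wf Hk Ht.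
  have H0 : q0s k q1 \notin dfinals.
    apply/negP => /mem_dfinals[k1 [q2 [_ Hq2]]]; case: ifP => // _ [Ek Eq].
    by move: Hf; rewrite Eq Ek Hq2.
  have H1 j : q1s k q1 j \notin dfinals.
    apply/negP => /mem_dfinals[k1 [q2 [_ Hq2]]]; case: ifP => // _ [Ek Eq _].
    by move: Hf; rewrite Eq Ek Hq2.
  have Hr ps : rhos ps \notin dfinals.
    by apply/negP => /mem_dfinals[k1 [q2 [_ Hq2]]]; case: ifP.
  by case: H => [[-> ->]|[j [-> _ _ ->]]|[j [-> _ ->]]|[ps [-> _ ->]]].
case/mapP=> -[q2 [[i2 m2] [p [oo Y]]]] /mem_lrules[Hp [k [Hk H]]] E.
have Eq : q = q2 := congr1 fst E; have Eq' : q' = ctl p := congr1 (fun t : trans_t => t.2.2.1) E; subst q2 q'.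
split; last first.
- by apply/negP => /mem_dfinals[k1 [q3 [_ Hq3]]]; case: ifP.
- by rewrite /okq /= eqxx Hp.
case: H => [[q0 [q1 [r [_ H]]]]|[ps [p1 [l [-> _ _ _ _]]]]] //.
by case: H => [[->]|[j [->]]|[o1 [->]]|[ps [->]]].
Qed.

Lemma dfinals_ok q : q \in dfinals -> okq P q.
Proof. by case/mem_dfinals=> k [q0 [_ _ ->]]; case: ifP. Qed.

Theorem onestep_wf : automaton_wf n Sigma P (ofc onestep).
Proof. by apply: mkplain_wf; [exact: n_gt0 | exact: dTs_wf | exact: drules_ok | exact: dtrans_ok | exact: dfinals_ok]. Qed.

Notation semD := (sem n Sigma (bD [seq x.2 | x <- L]) (bF [seq x.2 | x <- L]) (bC [seq x.2 | x <- L]) dnames drules).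
Notation taccD := (tacc (trE (dntr ++ dltr)) ctl semD).

Lemma semD_base k r s : k < size L -> is_stack n Sigma n s ->
  semD (bs k r) s <-> stack_accepted (ofc (aut k)) s r.
Proof.
move=> Hk Hs; have := Hs; rewrite is_stackE => /and3P[H0 /eqP Eo W].
have Hk' : k < size [seq x.2 | x <- L] by rewrite size_map.
have H := @bden_accepted [seq x.2 | x <- L] n Sigma k Hk' s _ W r; rewrite Eo aut_nth // in H.
by split=> [/sem_isb-/(_ isT)/(H H0)//|/(H H0) Hb]; apply: sem_base.
Qed.

Lemma semD_nm q i m p s : is_stack n Sigma n s -> semD (nmz q i m p) s <->
  exists oo Y s', [/\ (q, ((i, m), (p, (oo, Y)))) \in lrules, opsem n oo s s' &
    forall y, y \in Y -> semD y s'].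
Proof.
move=> Hs; split=> [H|[oo [Y [s' [Hr Ho HY]]]]]; last first.
  apply: (sem_rule Hs _ _ Ho HY).
    by apply/mapP; exists (q, ((i, m), (p, (oo, Y)))).
  by apply/mapP; exists (q, ((i, m), (p, (oo, Y)))).
have [x Ex] : exists x, x = nmz q i m p by exists (nmz q i m p).
rewrite -Ex in H; case: H Ex {Hs} => [z s1 Hz _ Ez|x1 oo Y s1 s' _ _ Hr Ho HY E]; first by rewrite Ez in Hz.
have [Ex _] := st_inj E; subst x1.
case/mapP: Hr => -[q1 [[i1 m1] [p1 [oo1 Y1]]]] Hl E1.
have /= [Eq Ei Em Ep] := nm_inj (congr1 fst E1).
have Eo : oo = oo1 := congr1 (fun t : srule => t.2.1) E1.
have EY : Y = Y1 := congr1 (fun t : srule => t.2.2) E1.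
by subst; exists oo1, Y1, s'.
Qed.

Lemma ntr_ctl q i m p z : (q, ((i, m), (ctl p, z))) \in dntr -> False.
Proof.
by case/mem_dntr=> k [q0 [q1 [r [_ _ _ [[_ //]|[j [_ _ _ //]]|[j [_ _ //]]|[ps [_ _ //]]]]]]].
Qed.

Lemma taccD_leaf p s q i m : is_stack n Sigma n s -> taccD (Leaf p s) q i m <->
  exists oo Y s', [/\ (q, ((i, m), (p, (oo, Y)))) \in lrules, opsem n oo s s' &
    forall y, y \in Y -> semD y s'].
Proof.
move=> Hs; rewrite tacc_leafE; split.
  move=> [x []]; rewrite /trE mem_cat => /orP[/ntr_ctl//|/mapP[[q1 [[i1 m1] [p1 [oo Y]]]] Hl E]] Hx.
  have Ex : x = nmz q1 i1 m1 p1 := congr1 (fun t : trans_t => t.2.2.2) E; subst x.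
  move: E => [-> -> -> ->].
  by have [oo' [Y' [s' H]]] := (semD_nm q1 i1 m1 p1 Hs).1 Hx; exists oo', Y', s'.
move=> H; exists (nmz q i m p); split; last exact/semD_nm.
case: H => oo [Y [s' [Hl _ _]]]; rewrite /trE mem_cat; apply/orP; right; apply/mapP.
by exists (q, ((i, m), (p, (oo, Y)))).
Qed.

Lemma taccD_ctl t p i m : twf t -> taccD t (ctl p) i m -> False.
Proof.
have Hn z q' : trE (dntr ++ dltr) (ctl p) i m q' z -> False.
  rewrite /trE mem_cat => /orP[/mem_dntr[k [q0 [q1 [r [_ _ _ H]]]]]|].
    by case: H => [[//]|[j [//]]|[j [//]]|[ps [//]]].
  case/mapP=> -[q1 [[i1 m1] [p1 [oo Y]]]] /mem_lrules[_ [k [Hk H]]] E.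
  have Eq : ctl p = q1 := congr1 fst E; subst q1.
  case: H => [[q0 [q1 [r [_ H]]]]|[ps [p2 [l [//]]]]].
  by case: H => [[//]|[j [//]]|[o1 [//]]|[ps [//]]].
case: t => [p1 s|s ts] _; first by case/tacc_leafE=> x [/Hn].
by case/tacc_nodeE=> q' [x [/Hn]].
Qed.

Lemma taccD_node s ts q i m : twf (Node s ts) -> taccD (Node s ts) q i m <->
  exists q' x, [/\ (q, ((i, m), (q', x))) \in dntr, semD x s &
    forall j, j < size ts -> taccD (nth t0 ts j) q' j.+1 (size ts)].
Proof.
move=> Hwf; rewrite tacc_nodeE; split=> -[q' [x [Ht Hx Hc]]]; exists q', x; split=> //; last first.
  by rewrite /trE mem_cat Ht.
have := Hwf; rewrite twf_node => /and3P[_ Hsz Hall].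
move: Ht; rewrite /trE mem_cat => /orP[//|/mapP[[q1 [[i1 m1] [p1 [oo Y]]]] _ E]].
have Eq : q' = ctl p1 := congr1 (fun t : trans_t => t.2.2.1) E; subst q'.
have Hs0 : 0 < size ts by case/andP: Hsz.
by case: (taccD_ctl (all_nthP t0 Hall _ Hs0) (Hc _ Hs0)).
Qed.

Lemma taccD_q0 k t q0 i m : k < size L -> twf t ->
  taccD t (q0s k q0) i m <-> taccT (ofc (aut k)) t q0 i m.
Proof.
move=> Hk; elim/tree_ind': t q0 i m => [p s|s ts IH] q0 i m Hwf.
  have /= /andP[Hp Hs] := Hwf; rewrite (taccD_leaf _ _ _ _ Hs) tacc_leafE; split.
    move=> [oo [Y [s' [/mem_lrules[_ [k1 [Hk1 H]]] Ho HY]]]].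
    case: H => [[q1 [q2 [r [Ht H]]]]|[ps [p1 [l [//]]]]].
    case: H => [[[Ek Eq] Ep Eo EY]|[j [//]]|[o1 [//]]|[ps [//]]]; subst k1 q1 p oo Y.
    exists r; split=> //; rewrite -Ho; apply/semD_base => //; first by rewrite Ho.
    by apply: HY; rewrite mem_head.
  move=> [r [Ht Ha]]; exists None, [:: bs k r], s; split=> //.
    apply/mem_lrules; split=> //; exists k; split=> //; left; exists q0, p, r; split=> //.
    exact: Or41.
  by move=> y; rewrite inE => /eqP->; apply/semD_base.
have := Hwf; rewrite twf_node => /and3P[Hs _ Hall].
rewrite (taccD_node _ _ _ Hwf) tacc_nodeE; split.
  move=> [q' [x [/mem_dntr[k1 [q1 [q2 [r [Hk1 Ht Ex H]]]]] Hx Hc]]]; subst x.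
  case: H => [[[Ek Eq] Eq']|[j [//]]|[j [//]]|[ps [//]]]; subst k1 q1 q'.
  exists q2, r; split=> //; first by apply/semD_base.
  by move=> j Hj; apply/IH => //; [apply: (all_nthP t0 Hall) | apply: Hc].
move=> [q' [r [Ht Ha Hc]]]; exists (q0s k q'), (bs k r); split.
- by apply/mem_dntr; exists k, q0, q', r; split=> //; apply: Or41.
- exact/semD_base.
by move=> j Hj; apply/IH => //; [apply: (all_nthP t0 Hall) | apply: Hc].
Qed.

Lemma taccD_q1_other k t q0 j i m : k < size L -> twf t -> 0 < j <= m -> j != i ->
  taccD t (q1s k q0 j) i m <-> taccT (ofc (aut k)) t q0 i m.
Proof.
move=> Hk; case: t => [p s|s ts] Hwf Hj Hji.
  have /= /andP[Hp Hs] := Hwf; rewrite (taccD_leaf _ _ _ _ Hs) tacc_leafE; split.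
    move=> [oo [Y [s' [/mem_lrules[_ [k1 [Hk1 H]]] Ho HY]]]].
    case: H => [[q1 [q2 [r [Ht H]]]]|[ps [p1 [l [//]]]]].
    case: H => [[//]|[j1 [[Ek Eq Ej] _ _ Ep [Eo EY]]]|[o1 [[_ _ Ej]]]|[ps [[_ _ Ej]]]];
      try by rewrite Ej eqxx in Hji.
    subst k1 q1 p oo Y.
    exists r; split=> //; rewrite -Ho; apply/semD_base => //; first by rewrite Ho.
    by apply: HY; rewrite mem_head.
  move=> [r [Ht Ha]]; exists None, [:: bs k r], s; split=> //.
    apply/mem_lrules; split=> //; exists k; split=> //; left; exists q0, p, r; split=> //.
    by apply: Or42; exists j.
  by move=> y; rewrite inE => /eqP->; apply/semD_base.
have := Hwf; rewrite twf_node => /and3P[Hs _ Hall].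
rewrite (taccD_node _ _ _ Hwf) tacc_nodeE; split.
  move=> [q' [x [/mem_dntr[k1 [q1 [q2 [r [Hk1 Ht Ex H]]]]] Hx Hc]]]; subst x.
  case: H => [[//]|[j1 [[Ek Eq Ej] _ _ Eq']]|[j1 [[_ _ Ej]]]|[ps [[_ _ Ej]]]];
    try by rewrite Ej eqxx in Hji.
  subst k1 q1 q'.
  exists q2, r; split=> //; first by apply/semD_base.
  by move=> l Hl; apply/taccD_q0 => //; [apply: (all_nthP t0 Hall) | apply: Hc].
move=> [q' [r [Ht Ha Hc]]]; exists (q0s k q'), (bs k r); split.
- by apply/mem_dntr; exists k, q0, q', r; split=> //; apply: Or42; exists j.
- exact/semD_base.
by move=> l Hl; apply/taccD_q0 => //; [apply: (all_nthP t0 Hall) | apply: Hc].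
Qed.

Lemma taccD_rho t ps i m : twf t -> taccD t (rhos ps) i m ->
  m = size ps /\ exists s, t = Leaf (nth 0 ps i.-1) s.
Proof.
case: t => [p s|s ts] Hwf.
  have /= /andP[Hp Hs] := Hwf; rewrite (taccD_leaf _ _ _ _ Hs).
  move=> [oo [Y [s' [/mem_lrules[_ [k1 [Hk1 H]]] Ho HY]]]].
  case: H => [[q1 [q2 [r [Ht H]]]]|[ps1 [p1 [l [[E] _ Hl [Ei Em Ep] _]]]]].
    by case: H => [[//]|[j1 [//]]|[o1 [//]]|[ps1 [//]]].
  by subst ps1; rewrite Em Ei Ep; split=> //; exists s.
case/(taccD_node _ _ _ Hwf)=> q' [x [/mem_dntr[k1 [q1 [q2 [r [Hk1 Ht Ex H]]]]] Hx Hc]].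
by case: H => [[//]|[j1 [//]]|[j1 [//]]|[ps1 [//]]].
Qed.

Lemma taccD_rho_leaf k ps p1 j s : k < size L -> List.In (OpMinus ps p1) (ops k) -> j < size ps ->
  is_stack n Sigma n s -> taccD (Leaf (nth 0 ps j) s) (rhos ps) j.+1 (size ps).
Proof.
move=> Hk Hin Hj Hs; apply/(taccD_leaf _ _ _ _ Hs); exists None, [::], s; split=> //.
apply/mem_lrules; split; last first.
  by exists k; split=> //; right; exists ps, p1, j.
have [_ /(_ _ Hin)/and3P[Hps _ _]] := Lwf Hk.
exact: (allP Hps) (mem_nth _ Hj).
Qed.

Lemma nth_cat_other (T : Type) (x0 : T) l r a b j : j != size l ->
  nth x0 (l ++ a :: r) j = nth x0 (l ++ b :: r) j.
Proof. by rewrite !nth_cat; case: ltnP => // H Hj; have -> : j - size l = (j - (size l).+1).+1 by lia. Qed.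

Lemma nth_cat_here (T : Type) (x0 : T) l r a : nth x0 (l ++ a :: r) (size l) = a.
Proof. by rewrite nth_cat ltnn subnn. Qed.

(** A pending operation is applied at the leaf or node reached, or passed on to the one child
    guessed; the siblings are accepted unchanged, so the rewritten tree is accepted by the k-th
    automaton. *)
Lemma taccD_q1_sound k t q0 i m : k < size L -> twf t -> taccD t (q1s k q0 i) i m ->
  exists th t', [/\ List.In th (ops k), tree_op_sem n th t t', twf t' & taccT (ofc (aut k)) t' q0 i m].
Proof.
move=> Hk; have [_ Hops] := Lwf Hk.
elim/tree_ind': t q0 i m => [p s|s ts IH] q0 i m Hwf.
  have /= /andP[Hp Hs] := Hwf; rewrite (taccD_leaf _ _ _ _ Hs).
  move=> [oo [Y [s' [/mem_lrules[_ [k1 [Hk1 H]]] Ho HY]]]].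
  case: H => [[q1 [q2 [r [Ht H]]]]|[ps [p1 [l [//]]]]].
  case: H => [[//]|[j1 [[_ _ ->] _]]|[o [[Ek Eq] Hin Eo EY]]|[ps [[Ek Eq] Hin Hsz Eo EY]]].
  - by rewrite eqxx.
  - subst k1 q1 oo Y; have /and3P[_ Hop Hp'] := Hops _ Hin.
    have Hs' := op_sem_wf Hop Hs Ho.
    exists (OpStack p o q2), (Leaf q2 s'); split=> //; first exact: SemStack.
      by rewrite /= Hp' Hs'.
    apply/tacc_leafE; exists r; split=> //; apply/semD_base => //.
    by apply: HY; rewrite mem_head.
  subst k1 q1 oo Y; move: Ho => /= Es; subst s'.
  have /and3P[_ Hps0 Hps] := Hops _ Hin.
  exists (OpPlus p ps), (Node s [seq Leaf q s | q <- ps]); split=> //.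
  - exact: SemPlus.
  - rewrite twf_node size_map Hs Hsz Hps0 /= all_map; apply: sub_all Hps => y /= Hy.
    by rewrite Hs andbT.
  apply/tacc_nodeE; exists q2, r; split=> //; first by apply/semD_base => //; apply: HY; rewrite mem_head.
  rewrite size_map => j Hj; rewrite nth_leaves //.
  have Hpj : nth 0 ps j \in P := allP Hps _ (mem_nth _ Hj).
  apply/(@taccD_q0 k) => //; first by rewrite /= Hpj Hs.
  apply/(taccD_leaf _ _ _ _ Hs)/(semD_nm _ _ _ _ Hs); apply: HY.
  by rewrite inE; apply/orP; right; apply/mapP; exists j; rewrite ?mem_iota.
have := Hwf; rewrite twf_node => /and3P[Hs Hsz Hall].
case/(taccD_node _ _ _ Hwf)=> q' [x [/mem_dntr[k1 [q1 [q2 [r [Hk1 Ht Ex H]]]]] Hx Hc]]; subst x.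
case: H => [[//]|[j1 [[_ _ ->] _]]|[j [[Ek Eq] Hj Eq']]|[ps [[Ek Eq] Hin Eq']]].
- by rewrite eqxx.
- subst k1 q1 q'.
  (* The transition bounds j only by d. That j designates an actual child is seen at the first
     child: it can be accepted only if j is its own index or at most the number of children. *)
  have Hjs : 0 < j <= size ts.
    have Hs0 : 0 < size ts by case/andP: Hsz.
    have := Hc 0 Hs0; case: (nth t0 ts 0) (all_nthP t0 Hall _ Hs0) => [p1 s1|s1 ts1] Hwf0.
      have /= /andP[_ Hs1] := Hwf0; case/(taccD_leaf _ _ _ _ Hs1)=> oo [Y [s' [/mem_lrules[_ [k1 [_ H]]] _ _]]].
      case: H => [[q3 [q4 [r1 [_ H]]]]|[ps [p2 [l [//]]]]].
      by case: H => [[//]|[j1 [[_ _ ->]]]|[o [[_ _ ->]]]|[ps [[_ _ ->]]]] //; lia.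
    case/(taccD_node _ _ _ Hwf0)=> q' [x [/mem_dntr[k1 [q1 [q3 [r1 [_ _ _ H]]]]] _ _]].
    by case: H => [[//]|[j1 [[_ _ ->]]]|[j1 [[_ _ ->]]]|[ps [[_ _ ->]]]] //; lia.
  have Hj1 : j.-1 < size ts by lia.
  have Ej : j.-1.+1 = j by lia.
  have Hwfj : twf (nth t0 ts j.-1) := all_nthP t0 Hall _ Hj1.
  have := Hc _ Hj1; rewrite Ej => /(IH _ Hj1 _ _ _ Hwfj)[th [t' [Hin Hsem Hwf' Hacc]]].
  set l := take j.-1 ts; set rr := drop j ts.
  have Els : size l = j.-1 by rewrite size_takel //; lia.
  have Ets : ts = l ++ nth t0 ts j.-1 :: rr by rewrite -[in LHS](cat_take_drop j.-1 ts) (drop_nth t0 Hj1) Ej.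
  have Esz : size ts = size (l ++ t' :: rr) by rewrite [in LHS]Ets !size_cat.
  exists th, (Node s (l ++ t' :: rr)); split=> //.
  + by rewrite [in X in Node s X]Ets; apply: SemChild.
  + move: Hall; rewrite twf_node -Esz Hs Hsz [in X in all _ X]Ets !all_cat /= Hwf'.
    by case/and3P=> -> _ ->.
  apply/tacc_nodeE; exists q2, r; split=> //; first by apply/semD_base.
  rewrite -Esz => j1 Hj2; case: (eqVneq j1 j.-1) => [->|Hne].
    by rewrite -[X in nth _ _ X]Els nth_cat_here Ej.
  have Hne' : j1 != size l by rewrite Els.
  rewrite (nth_cat_other t0 rr t' (nth t0 ts j.-1) Hne') -Ets.
  apply/(@taccD_q1_other k _ _ j) => //; [exact: (all_nthP t0 Hall) | lia | exact: Hc].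
subst k1 q1 q'.
have /and3P[Hps Hps0 Hp2] := Hops _ Hin.
have Hlf j : j < size ts -> size ts = size ps /\ exists s', nth t0 ts j = Leaf (nth 0 ps j) s'.
  by move=> Hj; apply: (taccD_rho (all_nthP t0 Hall _ Hj) (Hc _ Hj)).
have [Esz _] : size ts = size ps /\ exists s', nth t0 ts 0 = Leaf (nth 0 ps 0) s'.
  by apply: Hlf; case/andP: Hsz.
have [g Hg] := finite_choice (SEmpty 0) (fun j Hj => (Hlf j Hj).2).
have Emk : ts = [seq Leaf x.1 x.2 | x <- zip ps (mkseq g (size ps))].
  apply: (@eq_from_nth _ t0); first by rewrite size_zip_leaves ?size_mkseq.
  move=> j Hj; rewrite Hg // nth_zip_leaves ?size_mkseq -?Esz //.
  by rewrite nth_mkseq.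
exists (OpMinus ps q2), (Leaf q2 s); split=> //.
- by rewrite Emk; apply: SemMinus; rewrite size_mkseq.
- by rewrite /= Hp2 Hs.
by apply/tacc_leafE; exists r; split=> //; apply/semD_base.
Qed.

Lemma taccD_q1_complete k th t t' : k < size L -> List.In th (ops k) -> tree_op_sem n th t t' ->
  twf t -> twf t' -> forall q0 i m, taccT (ofc (aut k)) t' q0 i m -> taccD t (q1s k q0 i) i m.
Proof.
move=> Hk Hin Hsem; elim: Hsem Hin => {th t t'}.
- move=> p o p' s s' Ho Hin /= /andP[Hp Hs] /andP[Hp' Hs'] q0 i m /tacc_leafE[r [Ht Ha]].
  apply/(taccD_leaf _ _ _ _ Hs); exists (Some o), [:: bs k r], s'; split=> //.
    apply/mem_lrules; split=> //; exists k; split=> //; left; exists q0, p', r; split=> //.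
    by apply: Or43; exists o.
  by move=> y; rewrite inE => /eqP->; apply/semD_base.
- move=> p ps s Hin /= /andP[Hp Hs] /and3P[_ Hsz Hall] q0 i m /tacc_nodeE[q' [r [Ht Ha Hc]]].
  rewrite size_map in Hsz Hc.
  apply/(taccD_leaf _ _ _ _ Hs); do 3 eexists; split.
  + apply/mem_lrules; split=> //; exists k; split=> //; left; exists q0, q', r; split=> //.
    by apply: Or44; exists ps; split=> //; case/andP: Hsz.
  + by [].
  move=> y; rewrite inE => /orP[/eqP->|/mapP[j]]; first exact/semD_base.
  rewrite mem_iota => /= Hj ->; apply/(semD_nm _ _ _ _ Hs)/(taccD_leaf _ _ _ _ Hs).
  apply/taccD_q0 => //; last by have := Hc _ Hj; rewrite nth_leaves.
  have := all_nthP t0 Hall j; rewrite size_map => /(_ Hj).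
  by rewrite nth_leaves.
- move=> ps p s ss Esz Hin Hwf /= /andP[Hp Hs] q0 i m /tacc_leafE[r [Ht Ha]].
  have := Hwf; rewrite twf_node size_zip_leaves // => /and3P[_ Hsz Hall].
  apply/(taccD_node _ _ _ Hwf); exists (rhos ps), (bs k r); split.
  + by apply/mem_dntr; exists k, q0, p, r; split=> //; apply: Or44; exists ps.
  + exact/semD_base.
  rewrite size_zip_leaves // => j Hj; rewrite nth_zip_leaves //.
  apply: (taccD_rho_leaf Hk Hin Hj).
  by have /= := all_nthP t0 Hall j; rewrite size_zip_leaves // nth_zip_leaves // => /(_ Hj)/andP[].
move=> th s l t t' r _ IH Hin Hwf Hwf' q0 i m /tacc_nodeE[q' [z [Ht Ha Hc]]].
have Esz : size (l ++ t' :: r) = size (l ++ t :: r) by rewrite !size_cat.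
have := Hwf; rewrite twf_node => /and3P[Hs Hsz Hall].
have := Hwf'; rewrite twf_node => /and3P[_ _ Hall'].
have Hl : size l < size (l ++ t :: r) by rewrite size_cat /=; lia.
have Hd : size l < d by lia.
(* The right guess is the position of the rewritten child, counted from 1. *)
apply/(taccD_node _ _ _ Hwf); exists (q1s k q' (size l).+1), (bs k z); split.
- apply/mem_dntr; exists k, q0, q', z; split=> //; apply: Or43; exists (size l).+1; split=> //.
- exact/semD_base.
move=> j Hj; case: (eqVneq j (size l)) => [->|Hne].
  rewrite nth_cat_here; apply: IH => //.
  + by move: Hall; rewrite all_cat /= => /and3P[].
  + by move: Hall'; rewrite all_cat /= => /and3P[].
  by have := Hc (size l); rewrite Esz nth_cat_here; apply.
apply/taccD_q1_other => //.
- exact: (all_nthP t0 Hall).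
- by rewrite eqSS eq_sym.
rewrite (nth_cat_other t0 r t t' Hne); have := Hc j; rewrite Esz; exact.
Qed.

Theorem onestep_lang t : twf t -> in_lang (ofc onestep) t <->
  exists k, k < size L /\ if nilp (ops k) then in_lang (ofc (aut k)) t else
    exists th t', [/\ List.In th (ops k), tree_op_sem n th t t', twf t' & in_lang (ofc (aut k)) t'].
Proof.
move=> Hwf; have Hlang : in_lang (ofc onestep) t <-> exists qf, qf \in dfinals /\ taccD t qf 1 1.
  by apply: plain_lang Hwf; [exact: n_gt0 | exact: dTs_wf | exact: drules_ok | exact: dtrans_ok | exact: dfinals_ok].
split.
  case/Hlang=> qf [/mem_dfinals[k [q0 [Hk Hq0 ->]]] Hacc]; exists k; split=> //.
  have [Awf _] := Lwf Hk; case: ifP Hacc => _ Hacc.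
    by apply/(in_langP Awf); exists q0; split=> //; apply/taccD_q0.
  have [th [t' [H1 H2 H3 H4]]] := taccD_q1_sound Hk Hwf Hacc.
  by exists th, t'; split=> //; apply/(in_langP Awf); exists q0.
case=> k [Hk H]; have [Awf _] := Lwf Hk; apply/Hlang.
case E: (nilp (ops k)) H.
  case/(in_langP Awf)=> q0 [Hq0 Hacc]; exists (q0s k q0); split; last exact/taccD_q0.
  by apply/mem_dfinals; exists k, q0; rewrite E.
move=> [th [t' [H1 H2 H3 /(in_langP Awf)[q0 [Hq0 Hacc]]]]]; exists (q1s k q0 1); split.
  by apply/mem_dfinals; exists k, q0; rewrite E.
exact: (taccD_q1_complete Hk H1 H2 Hwf H3).
Qed.

End OneStep.

(** * Computability of the constructions *)

Ltac comp_unfold := intros; rewrite /nmz /stv /st /cQ /cF /cR /cFK /cD /cDK /cD1 /bs /bt /nm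
  /tQ /tRho /ctl /minus /numq /ops /aut /q0s /q1s /rhos /acons /achar /goodtr; cbv zeta; comp_tac.

Lemma comp_bU {E} {EE : Enc E} (Ts : E -> seq caut) k : comp Ts -> comp k ->
  comp (fun e => bU (Ts e) (k e)).
Proof. by rewrite /bU; comp_unfold. Qed.
Lemma comp_bF {E} {EE : Enc E} (Ts : E -> seq caut) k : comp Ts -> comp k ->
  comp (fun e => bF (Ts e) (k e)).
Proof. by rewrite /bF; comp_unfold. Qed.
Lemma comp_bD {E} {EE : Enc E} (Ts : E -> seq caut) k : comp Ts -> comp k ->
  comp (fun e => bD (Ts e) (k e)).
Proof. by rewrite /bD; comp_unfold. Qed.
Lemma comp_bC {E} {EE : Enc E} (Ts : E -> seq caut) : comp Ts -> comp (fun e => bC (Ts e)).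
Proof. by rewrite /bC; comp_unfold. Qed.

Ltac comp_reg2 := match goal with
  | |- comp (fun e => bU _ _) => apply: comp_bU
  | |- comp (fun e => bF _ _) => apply: comp_bF
  | |- comp (fun e => bD _ _) => apply: comp_bD
  | |- comp (fun e => bC _) => apply: comp_bC
  | _ => comp_reg1
  end.
Ltac comp_reg ::= comp_reg2.

(** Function parameters such as [bU] have no encoding; computability is stated for the instances
    built from a list Ts of automata, which is data. *)
Lemma comp_V {E} {EE : Enc E} n Ts names f : comp n -> comp Ts -> comp names -> comp f ->
  comp (fun e : E => V (n e) (bU (Ts e)) (names e) (f e)).
Proof. by rewrite /V /Vpair; comp_unfold. Qed.
Lemma comp_acons_of {E} {EE : Enc E} D d1 d2 : comp D -> comp d1 -> comp d2 ->
  comp (fun e : E => acons_of (D e) (d1 e) (d2 e)).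
Proof. by rewrite /acons_of; comp_unfold. Qed.
Lemma comp_achar_of {E} {EE : Enc E} C a d : comp C -> comp a -> comp d ->
  comp (fun e : E => achar_of (C e) (a e) (d e)).
Proof. by rewrite /achar_of; comp_unfold. Qed.
Lemma comp_fin {E} {EE : Enc E} n Ts Th k : comp n -> comp Ts -> comp Th -> comp k ->
  comp (fun e : E => fin (n e) (bF (Ts e)) (Th e) (k e)).
Proof. by rewrite /fin; comp_unfold. Qed.
Lemma comp_chars {E} {EE : Enc E} Ts Th : comp Ts -> comp Th ->
  comp (fun e : E => chars (bC (Ts e)) (Th e)).
Proof. by rewrite /chars; comp_unfold. Qed.

Ltac comp_reg3 := match goal with
  | |- comp (fun e => V _ _ _ _) => apply: comp_V
  | |- comp (fun e => acons_of _ _ _) => apply: comp_acons_of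
  | |- comp (fun e => achar_of _ _ _) => apply: comp_achar_of
  | |- comp (fun e => fin _ _ _ _) => apply: comp_fin
  | |- comp (fun e => chars _ _) => apply: comp_chars
  | _ => comp_reg2
  end.
Ltac comp_reg ::= comp_reg3.

Lemma comp_UU {E} {EE : Enc E} n Ts names k : comp n -> comp Ts -> comp names -> comp k ->
  comp (fun e : E => UU (n e) (bU (Ts e)) (names e) (k e)).
Proof. by rewrite /UU; comp_unfold. Qed.
Ltac comp_reg4 := match goal with
  | |- comp (fun e => UU _ _ _ _) => apply: comp_UU
  | _ => comp_reg3
  end.
Ltac comp_reg ::= comp_reg4.

Lemma comp_delta {E} {EE : Enc E} n Ts names k : comp n -> comp Ts -> comp names -> comp k ->
  comp (fun e : E => delta (n e) (bU (Ts e)) (bD (Ts e)) (names e) (k e)).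
Proof. by rewrite /delta; comp_unfold. Qed.
Lemma comp_univ {E} {EE : Enc E} n Sigma Ts names : comp n -> comp Sigma -> comp Ts -> comp names ->
  comp (fun e : E => univ (n e) (Sigma e) (bU (Ts e)) (names e)).
Proof. by rewrite /univ; comp_unfold. Qed.
Ltac comp_reg5 := match goal with
  | |- comp (fun e => delta _ _ _ _ _) => apply: comp_delta
  | |- comp (fun e => univ _ _ _ _) => apply: comp_univ
  | |- comp (fun e => acons _ _ _ _ _ _ _) => rewrite /acons
  | |- comp (fun e => achar _ _ _ _) => rewrite /achar
  | _ => comp_reg4
  end.
Ltac comp_reg ::= comp_reg5.

Lemma comp_plug {E} {EE : Enc E} n Ts names k v l :
  comp n -> comp Ts -> comp names -> comp k -> comp v -> comp l ->
  comp (fun e : E => plug (acons (n e) (bU (Ts e)) (bD (Ts e)) (names e)) (k e) (v e) (l e)).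
Proof. by rewrite /plug; comp_unfold. Qed.
Lemma comp_hval {E} {EE : Enc E} n Ts Th j h :
  comp n -> comp Ts -> comp Th -> comp j -> comp h ->
  comp (fun e : E => hval (achar (bC (Ts e)) (Th e)) (fin (n e) (bF (Ts e)) (Th e)) (j e) (h e)).
Proof. by rewrite /hval; comp_unfold. Qed.
Ltac comp_reg6 := match goal with
  | |- comp (fun e => plug _ _ _ _) => apply: comp_plug
  | |- comp (fun e => hval _ _ _ _) => apply: comp_hval
  | _ => comp_reg5
  end.
Ltac comp_reg ::= comp_reg6.

Lemma comp_op_fun {E} {EE : Enc E} n Ts names Th oo h l :
  comp n -> comp Ts -> comp names -> comp Th -> comp oo -> comp h -> comp l ->
  comp (fun e : E => op_fun (achar (bC (Ts e)) (Th e)) (acons (n e) (bU (Ts e)) (bD (Ts e)) (names e))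
    (fin (n e) (bF (Ts e)) (Th e)) (n e) (oo e) (h e) (l e)).
Proof. by move=> *; rewrite /op_fun; cbv zeta; comp_tac. Qed.
Ltac comp_reg7 := match goal with
  | |- comp (fun e => op_fun _ _ _ _ _ _ _) => apply: comp_op_fun
  | _ => comp_reg6
  end.
Ltac comp_reg ::= comp_reg7.

Lemma comp_facts {E} {EE : Enc E} n Sigma Ts names rules :
  comp n -> comp Sigma -> comp Ts -> comp names -> comp rules ->
  comp (fun e : E => facts (n e) (Sigma e) (Ts e) (names e) (rules e)).
Proof. by move=> *; rewrite /facts /sat /derivable; comp_tac; rewrite /stv /st; comp_tac. Qed.
Lemma comp_holes {E} {EE : Enc E} d Th T : comp d -> comp Th -> comp T ->
  comp (fun e : E => holes (d e) (Th e) (T e)).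
Proof. by rewrite /holes; comp_unfold. Qed.
Ltac comp_reg8 := match goal with
  | |- comp (fun e => facts _ _ _ _ _) => apply: comp_facts
  | |- comp (fun e => holes _ _ _) => apply: comp_holes
  | _ => comp_reg7
  end.
Ltac comp_reg ::= comp_reg8.

Lemma comp_mkplain {E} {EE : Enc E} n Sigma P Ts names rules trans finals :
  comp n -> comp Sigma -> comp P -> comp Ts -> comp names -> comp rules -> comp trans -> comp finals ->
  comp (fun e : E => mkplain (n e) (Sigma e) (P e) (Ts e) (names e) (rules e) (trans e) (finals e)).
Proof. by rewrite /mkplain; comp_unfold. Qed.
Lemma comp_ntr {E} {EE : Enc E} d Th T : comp d -> comp Th -> comp T ->
  comp (fun e : E => ntr (d e) (Th e) (T e)).
Proof. by rewrite /ntr; comp_unfold. Qed.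
Lemma comp_lrules {E} {EE : Enc E} d P L : comp d -> comp P -> comp L ->
  comp (fun e : E => lrules (d e) (P e) (L e)).
Proof. by rewrite /lrules /lrules0; comp_unfold. Qed.
Ltac comp_reg9 := match goal with
  | |- comp (fun e => mkplain _ _ _ _ _ _ _ _) => apply: comp_mkplain
  | |- comp (fun e => ntr _ _ _) => apply: comp_ntr
  | |- comp (fun e => lrules _ _ _) => apply: comp_lrules
  | _ => comp_reg8
  end.
Ltac comp_reg ::= comp_reg9.

Lemma comp_prestar {E} {EE : Enc E} d n Sigma P Th T :
  comp d -> comp n -> comp Sigma -> comp P -> comp Th -> comp T ->
  comp (fun e : E => prestar (d e) (n e) (Sigma e) (P e) (Th e) (T e)).
Proof. by rewrite /prestar /snames /ltr /srules; comp_unfold. Qed.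
Lemma comp_onestep {E} {EE : Enc E} d n Sigma P L :
  comp d -> comp n -> comp Sigma -> comp P -> comp L ->
  comp (fun e : E => onestep (d e) (n e) (Sigma e) (P e) (L e)).
Proof. by rewrite /onestep /dnames /drules /dltr /dfinals /dntr; comp_unfold. Qed.
Ltac comp_reg10 := match goal with
  | |- comp (fun e => prestar _ _ _ _ _ _) => apply: comp_prestar
  | |- comp (fun e => onestep _ _ _ _ _) => apply: comp_onestep
  | _ => comp_reg9
  end.
Ltac comp_reg ::= comp_reg10.

(** * Bounding the number of changes of the global state *)

Definition crule : Type := (nat * (tree_op * (nat * unit)))%type.
Definition cfam : Type := seq (nat * (caut * unit)).
Definition cgas : Type := (seq nat * (seq nat * (seq nat * (seq crule * unit))))%type.
Definition input : Type := (nat * (nat * (cgas * (cfam * (nat * unit)))))%type.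

Definition lookup (l : cfam) (g : nat) : caut := head c0 [seq x.2.1 | x <- l & x.1 == g].
Definition gops (rs : seq crule) (g : nat) : seq tree_op :=
  [seq r.2.1 | r <- rs & (r.1 == g) && (r.2.2.1 == g)].
Definition fam0 (d n : nat) (Sigma P gs : seq nat) (rs : seq crule) (l : cfam) : cfam :=
  [seq (g, (prestar d n Sigma P (gops rs g) (lookup l g), tt)) | g <- gs].
(** With one more change allowed, a run stays within g and then either needs only the budget of l or
    uses one rule starting in g and continues within that budget. *)
Definition fam1 (d n : nat) (Sigma P gs : seq nat) (rs : seq crule) (l : cfam) : cfam :=
  [seq (g, (prestar d n Sigma P (gops rs g) (onestep d n Sigma P (([::], lookup l g) ::
     [seq ([:: r.2.1], lookup l r.2.2.1) | r <- rs & r.1 == g])), tt)) | g <- gs].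
Definition algo (x : input) : cfam :=
  iter x.2.2.2.2.1
    (fam1 x.1 x.2.1 x.2.2.1.1 x.2.2.1.2.1 x.2.2.1.2.2.1 x.2.2.1.2.2.2.1)
    (fam0 x.1 x.2.1 x.2.2.1.1 x.2.2.1.2.1 x.2.2.1.2.2.1 x.2.2.1.2.2.2.1 x.2.2.2.1).

Lemma comp_algo : comp algo.
Proof.
by rewrite /algo /fam0 /fam1 /gops /lookup; comp_tac.
Qed.

(** * Instances of the problem as encoded values *)

Definition cgas_of (G : gastrs) : cgas :=
  (alphabet G, (controls G, (globals G, ([seq (r.1.1, (r.1.2, (r.2, tt))) | r <- rules G], tt)))).
Definition cfam_of (n : nat) (gs : seq nat) (T : nat -> automaton) : cfam :=
  [seq (g, (toc n (T g), tt)) | g <- gs].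
Definition input_of d n G T0 iota : input :=
  (d, (n, (cgas_of G, (cfam_of n (globals G) T0, (iota, tt))))).

Lemma enc_cfam_of n gs T : enc (cfam_of n gs T) = enc_family n gs T.
Proof.
apply: enc_seq_map => g; rewrite /= /enc_pair /=; congr (dcons _ (dcons _ _)).
exact: enc_toc.
Qed.

Lemma enc_input_of d n G T0 iota : enc (input_of d n G T0 iota) = enc_instance d n G T0 iota.
Proof.
rewrite /enc_instance -enc_cfam_of.
have E1 : enc [seq (r.1.1, (r.1.2, (r.2, tt))) | r <- rules G] =
    enc_seq (fun x : nat * tree_op * nat =>
      enc_tuple [:: enc_nat x.1.1; enc_tree_op x.1.2; enc_nat x.2]) (rules G).
  by apply: enc_seq_map.
have E2 : enc (cgas_of G) = enc_gastrs G by rewrite /enc_gastrs -E1.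
by rewrite -E2.
Qed.

Section Bounded.
Variables (d n : nat) (G : gastrs) (T0 : nat -> automaton).
Notation Sigma := (alphabet G).
Notation P := (controls G).
Notation twf := (tree_wf d n Sigma P).

(** The sum over a whole run is replaced by a budget that is spent along the run, which suits
    induction on its first step. *)
Inductive breach : nat -> nat -> tree -> Prop :=
| breach_stop i g t : in_lang (T0 g) t -> breach i g t
| breach_step i g t g' t' : step d n G (g, t) (g', t') -> (g != g') <= i ->
    breach (i - (g != g')) g' t' -> breach i g t.

Lemma bounded_reachP i g t : bounded_reach d n G T0 i g t <-> breach i g t.
Proof.
split.
  move=> [m [gs [ts [<- <- Hs Hl Hi]]]].
  elim: m gs ts i Hs Hl Hi => [|m IH] gs ts i Hs Hl; first by move=> _; apply: breach_stop.
  rewrite big_ord_recl => Hi; have Hi0 : (gs 0 != gs 1) <= i := leq_trans (leq_addr _ _) Hi.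
  apply: (breach_step (Hs 0 isT) Hi0).
  apply: (IH (fun k => gs k.+1) (fun k => ts k.+1)) => //.
    by move=> k Hk; apply: (Hs k.+1).
  by rewrite leq_subRL.
elim=> {i g t} [i g t H|i g t g' t' Hst Hi _ [m [gs [ts [Eg Et Hs Hl Hsum]]]]].
  by exists 0, (fun=> g), (fun=> t); rewrite big_ord0.
exists m.+1, (fun k => if k is k'.+1 then gs k' else g), (fun k => if k is k'.+1 then ts k' else t).
split=> //.
  by move=> [|k] Hk; [rewrite Eg Et | apply: Hs].
by rewrite big_ord_recl /= Eg -leq_subRL.
Qed.

Lemma breach_le i j g t : i <= j -> breach i g t -> breach j g t.
Proof.
move=> Hij H; elim: H j Hij => {i g t} [i g t H|i g t g' t' Hst Hi _ IH] j Hij; first exact: breach_stop.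
by apply: breach_step Hst _ _; [lia | apply: IH; lia].
Qed.

Notation rs := [seq (r.1.1, (r.1.2, (r.2, tt))) | r <- rules G].
Notation stg g := (star d n Sigma P (gops rs g)).

Lemma In_map_filter (A B : Type) (f : A -> B) (p : pred A) l b :
  List.In b [seq f a | a <- l & p a] <-> exists a, [/\ List.In a l, p a & b = f a].
Proof.
elim: l => [|a l IH] /=; first by split=> // [[a []]].
case Hp: (p a) => /=; split.
- case=> [<-|/IH[c [Hc Hpc ->]]]; first by exists a; split=> //; left.
  by exists c; split=> //; right.
- by move=> [c [[->|Hc] Hpc E]]; [left | right; apply/IH; exists c].
- by move=> /IH[c [Hc Hpc ->]]; exists c; split=> //; right.
by move=> [c [[E|Hc] Hpc Eb]]; [rewrite E Hpc in Hp | apply/IH; exists c].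
Qed.

Lemma In_rs g th g' : List.In (g, (th, (g', tt))) rs <-> List.In (g, th, g') (rules G).
Proof.
elim: (rules G) => //= -[[a b] c] l IH; rewrite IH /=.
by split=> -[[-> -> ->]|H]; [left | right | left | right].
Qed.

Lemma In_gops g th : List.In th (gops rs g) <-> List.In (g, th, g) (rules G).
Proof.
rewrite /gops In_map_filter; split.
  by case=> -[a [b [c []]]] [/In_rs H /= /andP[/eqP Ea /eqP Ec] ->]; subst.
by move/In_rs => H; exists (g, (th, (g, tt))); rewrite /= eqxx.
Qed.

Lemma star_breach i g t t' : stg g t t' -> breach i g t' -> breach i g t.
Proof.
elim=> // th a b c Hin Ha Hb Hop _ IH /IH H.
apply: (@breach_step _ _ _ g b); rewrite ?eqxx ?subn0 //.
by split=> //; exists th; split=> //; apply/In_gops.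
Qed.

Hypothesis n_gt0 : 0 < n.
Hypothesis Gwf : gastrs_wf n G.
Hypothesis T0wf : forall g, g \in globals G -> automaton_wf n Sigma P (T0 g).

Lemma rule_wf g th g' : List.In (g, th, g') (rules G) ->
  [/\ g \in globals G, g' \in globals G & tree_op_wf n Sigma P th].
Proof.
have := Gwf; rewrite /gastrs_wf; elim: (rules G) => //= r l IH /andP[Hr Hl] [E|/(IH Hl)//].
by subst r; case/and3P: Hr.
Qed.

Lemma gops_wf g th : List.In th (gops rs g) -> tree_op_wf n Sigma P th.
Proof. by move/In_gops/rule_wf => []. Qed.

Lemma lookup_map (gs : seq nat) (f : nat -> caut) g : g \in gs -> lookup [seq (g, (f g, tt)) | g <- gs] g = f g.
Proof.
rewrite /lookup; elim: gs => //= a gs IH; rewrite inE eq_sym.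
by case: eqP => [->|_] //=.
Qed.

Definition recognizes (i : nat) (l : cfam) : Prop := forall g, g \in globals G ->
  automaton_wf n Sigma P (ofc (lookup l g)) /\
  forall t, twf t -> in_lang (ofc (lookup l g)) t <-> breach i g t.

Lemma breach0 g t : twf t -> breach 0 g t -> exists t', stg g t t' /\ in_lang (T0 g) t'.
Proof.
move=> Hwf H; have [k Ek] : exists k, k = 0 by exists 0.
rewrite -Ek in H; elim: H Ek Hwf => {k g t} [k g t H|k g t g' t' [_ /= Hwf' [th [Hin Hop]]] Hi _ IH] Ek Hwf.
  by exists t; split=> //; apply: star_refl.
subst k; move: Hi IH; case: eqVneq => // E _ IH; subst g'.
have [t'' [Hst Ht'']] := IH erefl Hwf'; exists t''; split=> //.
by apply: star_step _ Hwf Hwf' Hop Hst; apply/In_gops.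
Qed.

(** The run is cut before its first change of the global state; if there is none, the smaller budget
    is enough. *)
Lemma breachS i g t : twf t -> breach i.+1 g t -> exists t', stg g t t' /\
  (breach i g t' \/ exists th g' t'', [/\ List.In (g, th, g') (rules G), tree_op_sem n th t' t'',
     twf t'' & breach i g' t'']).
Proof.
move=> Hwf H; have [k Ek] : exists k, k = i.+1 by exists i.+1.
rewrite -Ek in H; elim: H Ek Hwf => {k g t} [k g t H|k g t g' t' [_ /= Hwf' [th [Hin Hop]]] Hi Hb IH] Ek Hwf.
  by exists t; split; [apply: star_refl | left; apply: breach_stop].
subst k; move: Hi Hb IH; case: eqVneq => [E|Hne] _ Hb IH.
  subst g'; have [t'' [Hst Ht'']] := IH (subn0 _) Hwf'; exists t''; split=> //.
  by apply: star_step _ Hwf Hwf' Hop Hst; apply/In_gops.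
exists t; split; first exact: star_refl.
by right; exists th, g', t'; split=> //; move: Hb; rewrite subn1.
Qed.

(** A well-formed stack consults transitions and final states of orders 1 to n only, and these
    survive the tabulation. *)
Lemma in_lang_toc T t : automaton_wf n Sigma P T -> twf t ->
  in_lang (ofc (toc n T)) t <-> in_lang T t.
Proof.
move=> Twf Hwf.
have Hacc s : 0 < order s -> stack_wf n Sigma s -> forall r,
    stack_accepted (ofc (toc n T)) s r <-> stack_accepted T s r.
  move: s; apply: wf_stack_ind => [k Hk|a u s Eo Ws Hu Wu IHu IHs|s1 s H1 Eo Ws IH1 IHs] r.
  - by rewrite -[stack_accepted (ofc _) _ _]/(is_true (r \in FK (ofc (toc n T)) k)) FK_toc.
  - have /= ED := D1_toc n T; split=> -[Y [X [Ht HY HX]]]; exists Y, X; split;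
      try (by move=> x Hx; first [apply/IHu; exact: HY | apply/IHs; exact: HX]).
      by rewrite -ED; apply: Ht.
    by rewrite /= ED.
  have Hk : 1 < order s <= n by rewrite (wf_order Ws) Eo !ltnS H1.
  apply: (iff_trans (accepted_cons _ _ _ H1)); apply: (iff_trans _ (iff_sym (accepted_cons _ _ _ H1))).
  split=> -[r1 [X [Ht Hr1 HX]]]; exists r1, X; split; try exact/IH1;
    try (by move=> x Hx; apply/IHs; exact: HX).
    by rewrite -(DK_toc _ _ _ _ Hk).
  by rewrite (DK_toc _ _ _ _ Hk).
have Hst s r : is_stack n Sigma n s -> stack_accepted (ofc (toc n T)) s r <-> stack_accepted T s r.
  by rewrite is_stackE => /and3P[_ /eqP Eo W]; apply: Hacc; rewrite ?Eo.
have Htacc q i m : tacc (tra (ofc (toc n T))) id (accs (ofc (toc n T))) t q i m <->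
    tacc (tra T) id (accs T) t q i m.
  have Etr q1 i1 m1 q2 x : tra (ofc (toc n T)) q1 i1 m1 q2 x = tra T q1 i1 m1 q2 x by rewrite /tra DT_toc.
  elim/tree_ind': t Hwf q i m => [p s /andP[_ Hs]|s ts IH /and3P[Hs _ Hall]] q i m.
    by rewrite !tacc_leafE; split=> -[x [H1 H2]]; exists x; (split; [by rewrite ?Etr // -Etr | exact/Hst]).
  rewrite !tacc_nodeE.
  have Hc j Hj := IH j Hj (all_nthP t0 Hall j Hj).
  by split=> -[q' [x [H1 H2 H3]]]; exists q', x; (split; [by rewrite ?Etr // -Etr | exact/Hst |
    by move=> j Hj; apply/Hc => //; apply: H3]).
rewrite (in_langP (automaton_wf_toc n_gt0 Twf)) (in_langP Twf).
by split=> -[qf [Hf Ht]]; exists qf; split=> //; apply/Htacc.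
Qed.

Lemma fam0_recognizes : recognizes 0 (fam0 d n Sigma P (globals G) rs (cfam_of n (globals G) T0)).
Proof.
move=> g Hg; rewrite /fam0 (lookup_map (fun g => prestar d n Sigma P (gops rs g) _)) // /cfam_of
  (lookup_map (fun g => toc n (T0 g))) //.
have Twf := T0wf Hg; have Twf' := automaton_wf_toc n_gt0 Twf.
split; first exact: (prestar_wf d n_gt0 Twf' (@gops_wf g)).
move=> t Hwf; rewrite (prestar_lang n_gt0 Twf' (@gops_wf g) Hwf); split.
  move=> [t' [Hst Ht']]; apply: (star_breach Hst); apply: breach_stop.
  by apply/(in_lang_toc Twf) => //; apply: star_wf Hst Hwf.
case/(breach0 Hwf)=> t' [Hst Ht']; exists t'; split=> //.
by apply/(in_lang_toc Twf) => //; apply: star_wf Hst Hwf.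
Qed.

Lemma fam1_recognizes i l : recognizes i l -> recognizes i.+1 (fam1 d n Sigma P (globals G) rs l).
Proof.
move=> Hl g Hg; set L := ([::], lookup l g) :: [seq ([:: r.2.1], lookup l r.2.2.1) | r <- rs & r.1 == g].
have -> : lookup (fam1 d n Sigma P (globals G) rs l) g =
    prestar d n Sigma P (gops rs g) (onestep d n Sigma P L).
  by rewrite /fam1 (lookup_map (fun g => prestar d n Sigma P (gops rs g) (onestep d n Sigma P
    (([::], lookup l g) :: [seq ([:: r.2.1], lookup l r.2.2.1) | r <- rs & r.1 == g])))).
have HL x : List.In x L <-> x = ([::], lookup l g) \/
    exists th g', List.In (g, th, g') (rules G) /\ x = ([:: th], lookup l g').
  rewrite /L /= In_map_filter; split=> -[H|H]; try (by left); right.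
    case: H => -[a [b [c []]]] [/In_rs Hin /= /eqP Ea ->]; subst a.
    by exists b, c.
  by case: H => th [g' [/In_rs Hin ->]]; exists (g, (th, (g', tt))); rewrite /= eqxx.
have Lwf k : k < size L -> automaton_wf n Sigma P (ofc (aut L k)) /\
    forall th, List.In th (ops L k) -> tree_op_wf n Sigma P th.
  move=> Hk; have : List.In (nth ([::], c0) L k) L.
    by elim: (L) k Hk => //= a L' IH [|k] Hk; [left | right; apply: IH].
  rewrite /aut /ops; case/HL=> [->|[th [g' [Hin ->]]]] /=; first by have [] := Hl _ Hg.
  have [_ Hg' Hth] := rule_wf Hin; have [Hw _] := Hl _ Hg'; split=> // th' [<-|[]] //.
have Owf := onestep_wf d n_gt0 Lwf.
split; first exact: (prestar_wf d n_gt0 Owf (@gops_wf g)).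
move=> t Hwf; rewrite (prestar_lang n_gt0 Owf (@gops_wf g) Hwf).
have Hone t' : twf t' -> in_lang (ofc (onestep d n Sigma P L)) t' <->
    breach i g t' \/ exists th g' t'', [/\ List.In (g, th, g') (rules G), tree_op_sem n th t' t'',
      twf t'' & breach i g' t''].
  move=> Hwf'; rewrite (onestep_lang n_gt0 Lwf Hwf'); split.
    case=> k [Hk]; have : List.In (nth ([::], c0) L k) L.
      by elim: (L) k Hk => //= a L' IH [|k] Hk; [left | right; apply: IH].
    rewrite /aut /ops; case/HL=> [->|[th [g' [Hin ->]]]] /=.
      by have [_ Hlang] := Hl _ Hg; move/(Hlang _ Hwf'); left.
    move=> [th' [t'' [[<-|[]] Hop Hwf'' Ht'']]]; right; exists th, g', t''; split=> //.
    by have [_ Hg' _] := rule_wf Hin; have [_ Hlang] := Hl _ Hg'; apply/Hlang.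
  have HinL x : List.In x L -> exists2 k, k < size L & nth ([::], c0) L k = x.
    elim: (L) => //= a L' IH [<-|/IH[k Hk <-]]; first by exists 0.
    by exists k.+1.
  case=> [Hb|[th [g' [t'' [Hin Hop Hwf'' Hb]]]]].
    have /HinL[k Hk E] : List.In ([::], lookup l g) L by apply/HL; left.
    exists k; split=> //; rewrite /ops /aut E /=.
    by have [_ Hlang] := Hl _ Hg; apply/Hlang.
  have /HinL[k Hk E] : List.In ([:: th], lookup l g') L by apply/HL; right; exists th, g'.
  exists k; split=> //; rewrite /ops /aut E /=; exists th, t''; split=> //; first by left.
  by have [_ Hg' _] := rule_wf Hin; have [_ Hlang] := Hl _ Hg'; apply/Hlang.
split.
  move=> [t' [Hst /(Hone _ (star_wf Hst Hwf))Ht']]; apply: (star_breach Hst).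
  case: Ht' => [|[th [g' [t'' [Hin Hop Hwf'' Hb]]]]]; first by apply: breach_le.
  apply: (@breach_step _ _ _ g' t''); first by split=> //=; [exact: star_wf Hst Hwf | exists th].
    by case: (g != g').
  (* The rule used may keep the global state; then the remaining budget is i + 1 instead of i. *)
  by apply: breach_le Hb; case: (g != g') => /=; lia.
case/(breachS Hwf)=> t' [Hst Ht']; exists t'; split=> //.
by apply/(Hone _ (star_wf Hst Hwf)).
Qed.

Lemma algo_recognizes i : recognizes i (algo (input_of d n G T0 i)).
Proof. by rewrite /algo /=; elim: i => [|i IH]; [exact: fam0_recognizes | exact: fam1_recognizes]. Qed.

End Bounded.

(** An entry depends on its key alone, so repetitions in [globals G] carry equal automata and the
    list is the table of its own lookups, which is the form required of an encoded family. *)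
Lemma fam_shape d n G T0 i : algo (input_of d n G T0 i) =
  [seq (g, (lookup (algo (input_of d n G T0 i)) g, tt)) | g <- globals G].
Proof.
have H (f : nat -> caut) : [seq (g, (f g, tt)) | g <- globals G] =
    [seq (g, (lookup [seq (g, (f g, tt)) | g <- globals G] g, tt)) | g <- globals G].
  by apply/eq_in_map => g Hg; rewrite lookup_map.
rewrite /algo /=; case: i => [|i] /=.
  exact: (H (fun g => prestar _ _ _ _ _ _)).
exact: (H (fun g => prestar _ _ _ _ _ (onestep _ _ _ _ _))).
Qed.

Lemma prestar_toc d n Sigma P Th T : toc n (ofc (prestar d n Sigma P Th T)) = prestar d n Sigma P Th T.
Proof. by apply: toc_ofc; rewrite /= size_map size_iota. Qed.

Lemma algo_toc d n G T0 i g : g \in globals G ->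
  toc n (ofc (lookup (algo (input_of d n G T0 i)) g)) = lookup (algo (input_of d n G T0 i)) g.
Proof.
move=> Hg; rewrite /algo /=; case: i => [|i] /=.
  by rewrite /fam0 (lookup_map (fun g => prestar _ _ _ _ (gops _ g) (lookup _ g))) // prestar_toc.
by rewrite /fam1 (lookup_map (fun g => prestar _ _ _ _ (gops _ g) (onestep _ _ _ _
  (([::], lookup _ g) :: [seq ([:: r.2.1], lookup _ r.2.2.1) | r <- _ & r.1 == g])))) // prestar_toc.
Qed.

Theorem theorem5p1 :
  exists c : code,
    forall (d n : nat) (G : gastrs) (T0 : nat -> automaton) (iota : nat),
      1 <= n ->
      gastrs_wf n G ->
      (forall g, g \in globals G ->
         automaton_wf n (alphabet G) (controls G) (T0 g)) ->
      exists T : nat -> automaton,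
        [/\ eval c (enc_instance d n G T0 iota)
                   (enc_family n (globals G) T),
            forall g, g \in globals G ->
              automaton_wf n (alphabet G) (controls G) (T g) &
            forall g t, g \in globals G ->
              tree_wf d n (alphabet G) (controls G) t ->
              (in_lang (T g) t <-> bounded_reach d n G T0 iota g t)].
Proof.
have [c Hc] := comp_code comp_algo.
exists c => d n G T0 i n_gt0 Gwf T0wf.
exists (fun g => ofc (lookup (algo (input_of d n G T0 i)) g)).
have Hgood := @algo_recognizes d n G T0 n_gt0 Gwf T0wf i.
split=> [|g Hg|g t Hg Ht]; last 2 first.
- by have [] := Hgood _ Hg.
- by rewrite bounded_reachP; have [_] := Hgood _ Hg; apply.
rewrite -enc_input_of -enc_cfam_of /cfam_of.
have -> : [seq (g, (toc n (ofc (lookup (algo (input_of d n G T0 i)) g)), tt)) | g <- globals G] =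
    algo (input_of d n G T0 i).
  by rewrite [RHS]fam_shape; apply/eq_in_map => g Hg; rewrite algo_toc.
exact: Hc.
Qed.
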